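(* Let $\Theta$ be a completely random measure on $\Psi$ with no deterministic component, with $K_{fix}$ fixed-location atoms, $K_{fix}<\infty$, the $k$th of which can be written $\theta_{fix,k}\delta_{\psi_{fix,k}}$, and with ordinary component having rate measure $\mu(d\theta\times d\psi)=\nu(d\theta)\cdot G(d\psi)$, where $G$ is a diffuse probability distribution on $\Psi$ and $\nu$ is a $\sigma$-finite measure on $\mathbb{R}_+$ with $\nu(\mathbb{R}_+)=\infty$. Write $\Theta=\sum_{k=1}^\infty\theta_k\delta_{\psi_k}$, and let $X_n$ be generated i.i.d. given $\Theta$ according to $X_n=\sum_{k=1}^\infty x_{n,k}\delta_{\psi_k}$, where the $x_{n,k}$ are independent and $x_{n,k}$ has probability mass function $h(\cdot\mid\theta_k)$ on $\{0,1,2,\dots\}$. Suppose $$\sum_{x=1}^\infty\int_{\theta\in\mathbb{R}_+}\nu(d\theta)\,h(x\mid\theta)<\infty .$$ Then the marginal distribution of $X_{1:N}=(X_1,\dots,X_N)$ (with $\Theta$ integrated out) is the same as that provided by the following construction. For each $n=1,2,\dots,N$: 1. Let $\{\psi_k\}_{k=1}^{K_{n-1}}$ be the union of the atom locations in $X_1,\dots,X_{n-1}$, and let $x_{m,k}:=X_m(\{\psi_k\})$. Let $x_{n,k}$ denote the weight of $X_n\mid X_1,\dots,X_{n-1}$ at $\psi_k$. Then, independently across $k$, $x_{n,k}$ has probability mass function $$h_{cond}(x_{n,k}=x\mid x_{1:(n-1),k})=\frac{\int_{\theta\in\mathbb{R}_+}\nu(d\theta)\,h(x\mid\theta)\prod_{m=1}^{n-1}h(x_{m,k}\mid\theta)}{\int_{\theta\in\mathbb{R}_+}\nu(d\theta)\prod_{m=1}^{n-1}h(x_{m,k}\mid\theta)}.$$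 2. For each $x=1,2,\dots$, $X_n$ has $\rho_{n,x}$ new atoms of weight $x$; that is, $X_n$ has atoms of weight $x$ at locations $\{\psi_{n,x,j}\}_{j=1}^{\rho_{n,x}}$, where $\{\psi_{n,x,j}\}_{j=1}^{\rho_{n,x}}\cap\{\psi_k\}_{k=1}^{K_{n-1}}=\emptyset$ a.s. Moreover, $$\rho_{n,x}\sim\mathrm{Poisson}\left(\int_{\theta}\nu(d\theta)\,h(0\mid\theta)^{n-1}h(x\mid\theta)\right)\ \text{independently across } n,x,\qquad \psi_{n,x,j}\sim G\ \text{i.i.d. across } n,x,j,$$ these being independent of each other and of the draws in step 1.
   Context: $\Psi$ is a measurable space whose $\sigma$-algebra contains all singletons; $\mathbb{R}_+$ denotes the non-negative reals. A completely random measure (CRM) on $\Psi$ is a random measure taking independent values on disjoint measurable sets. A CRM with no deterministic component is an independent sum of a fixed-location component $\sum_k\theta_{fix,k}\delta_{\psi_{fix,k}}$ (deterministic distinct locations, independent non-negative random weights) and an ordinary component $\sum_k\theta_{ord,k}\delta_{\psi_{ord,k}}$, where $\{(\theta_{ord,k},\psi_{ord,k})\}$ are the points of a Poisson point process on $\mathbb{R}_+\times\Psi$ with rate (mean) measure $\mu$. $\Theta=\sum_k\theta_k\delta_{\psi_k}$ lists all fixed-location and ordinary atoms. For each $\theta$, $h(\cdot\mid\theta)$ is a probability mass function on $\{0,1,2,\dots\}$. A weight $x_{n,k}=0$ means that $X_n$ has no atom at $\psi_k$. For $n=1$ there are no earlier atom locations ($K_0=0$). The notation $x_{1:(n-1),k}$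 means $(x_{1,k},\dots,x_{n-1,k})$.
   Formalization: With fixed-location atoms the printed construction is false (its locations all come from the diffuse G); here step 1 also ranges over the fixed locations from n=1 on, with the law of θ_{fix,k} replacing ν in h_cond for them. With K_fix=0 nothing is changed. *)

(* Defs.v *)
From HB Require Import structures.
From mathcomp Require Import all_boot all_order all_algebra.
From mathcomp Require Import all_classical all_reals all_analysis.
From mathcomp Require Import measurable_realfun.

Set Implicit Arguments.
Unset Strict Implicit.
Unset Printing Implicit Defensive.

Import Order.TTheory GRing.Theory Num.Theory.
Import numFieldNormedType.Exports.

Local Open Scope classical_set_scope.
Local Open Scope ring_scope.

Lemma exchange_esum (R : realType) (I J : choiceType) (a : I -> J -> \bar R) :
  (forall i j, (0 <= a i j)%E) ->
  \esum_(i in [set: I]) \esum_(j in [set: J]) a i j =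
  \esum_(j in [set: J]) \esum_(i in [set: I]) a i j.
Proof.
move=> a0; rewrite !esum_esum//.
rewrite (@reindex_esum R _ _ ([set: J] `*`` (fun=> [set: I]))
  ([set: I] `*`` (fun=> [set: J])) (fun k => (k.2, k.1)))//; split => //=.
- by move=> [x1 x2] [y1 y2] _ _ /= [-> ->].
- by move=> [i j] _; exists (j, i).
Qed.

Section atomic.
Local Open Scope ereal_scope.
Context d (T : measurableType d) (R : realType) (I : choiceType).
Variables (w : I -> {nonneg R}) (l : I -> T).

(* $\sum_i w_i \delta_{l_i}$; the locations are allowed to repeat. *)
Definition atomic (B : set T) : \bar R :=
  \esum_(i in [set: I]) ((w i)%:num%:E * \d_(l i) B).

Let atomic0 : atomic set0 = 0.
Proof. by rewrite /atomic esum1// => i _; rewrite measure0 mule0. Qed.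

Let atomic_ge0 B : 0 <= atomic B.
Proof. by apply: esum_ge0 => i _; rewrite mule_ge0. Qed.

Let atomic_sigma_additive : semi_sigma_additive atomic.
Proof.
move=> F mF tF mUF; apply: cvg_toP.
  by apply: is_cvg_nneseries => n _ _; exact: atomic_ge0.
rewrite nneseries_esumT// /atomic exchange_esum; last first.
  by move=> n i; rewrite mule_ge0.
apply: eq_esum => i _.
rewrite -nneseries_esumT; last by move=> n; rewrite mule_ge0.
by rewrite nneseriesZl//= measure_semi_bigcup.
Qed.

HB.instance Definition _ := isMeasure.Build _ _ _ atomic
  atomic0 atomic_ge0 atomic_sigma_additive.

End atomic.

Section randomness.
Local Open Scope ereal_scope.
Context d (Om : measurableType d) (R : realType) (P : probability Om R).

Definition sigma_of d' (T : measurableType d') (X : Om -> T) : set (set Om) :=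
  preimage_set_system [set: Om] X measurable.

Definition mutually_independent (I : choiceType) (F : I -> set (set Om)) :=
  forall (s : seq I) (A : I -> set Om), uniq s ->
    (forall i, i \in s -> F i (A i)) ->
    P (\bigcap_(i in [set` s]) A i) = \prod_(i <- s) P (A i).

(* Given F, and for the indices j whose F-measurable "existence event" D j
   occurs, the y j are independent and y j has probability mass function p j
   (which may depend on the outcome through F). *)
Definition cond_independent_pmf (F : set (set Om)) (J : choiceType)
    (D : J -> set Om) (y : J -> Om -> nat) (p : J -> Om -> nat -> R) :=
  forall (E : set Om) (s : seq J) (a : J -> nat), F E -> uniq s ->
    (forall j, j \in s -> E `<=` D j) ->
    P (E `&` \bigcap_(j in [set` s]) (y j @^-1` [set a j])) =
    \int[P]_(w in E) (\prod_(j <- s) p j w (a j))%:E.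

Section random_measure.
Context d' (T : measurableType d').
Implicit Type M : Om -> {measure set T -> \bar R}.

Definition random_measure M := forall A, measurable A ->
  measurable_fun [set: Om] (M ^~ A).

Definition sigma_of_random_measure M : set (set Om) :=
  <<s \bigcup_(A in measurable) sigma_of (M ^~ A) >>.

Definition completely_random M := random_measure M /\
  forall A : nat -> set T, (forall i, measurable (A i)) ->
    trivIset [set: nat] A ->
    mutually_independent (fun i => sigma_of (M ^~ (A i))).

(* poisson_prob ignores its second argument. *)
Definition poisson_process M (mu : {measure set T -> \bar R}) :=
  [/\ completely_random M,
      forall A k, measurable A -> mu A < +oo ->
        P [set w | M w A = k%:R%:E] = poisson_prob (fine (mu A)) 0 [set k]
    & forall A, measurable A -> mu A = +oo -> P [set w | M w A = +oo] = 1].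

End random_measure.
End randomness.

(* The sigma-algebra generated by the evaluations m |-> m_i(A) on families of
   measures. *)
Definition evaluation_sigma (R : realType) (I : Type) d (T : measurableType d) :
    set (set (I -> {measure set T -> \bar R})) :=
  <<s \bigcup_i \bigcup_(A in measurable) preimage_set_system setT
        (fun m : I -> {measure set T -> \bar R} => m i A) measurable >>.

Definition same_law (R : realType) (I : Type) d (T : measurableType d)
    d1 (Om1 : measurableType d1) (P1 : probability Om1 R)
    (X : I -> Om1 -> {measure set T -> \bar R})
    d2 (Om2 : measurableType d2) (P2 : probability Om2 R)
    (Y : I -> Om2 -> {measure set T -> \bar R}) :=
  forall E, evaluation_sigma E ->
    P1 [set w | E (X ^~ w)] = P2 [set w | E (Y ^~ w)].

Definition diffuse (R : realType) d (T : measurableType d)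
    (G : {measure set T -> \bar R}) := forall t, G [set t] = 0%E.

Section weights.
Context (R : realType).

Definition Rplus : set R := `[0, +oo[%classic.

(* h x t is $h(x \mid t)$; only t >= 0 matters. *)
Definition pmf_family (h : nat -> R -> R) :=
  [/\ forall x, measurable_fun Rplus (h x),
      forall x t, 0 <= t -> 0 <= h x t
    & forall t, 0 <= t -> (\sum_(0 <= x <oo) (h x t)%:E = 1)%E].

Definition likelihood (h : nat -> R -> R) (s : seq nat) (t : R) : R :=
  \prod_(a <- s) h a t.

(* s is the past $x_{1:(n-1),k}$; quotient 0 when the denominator vanishes. *)
Definition hcond (m : {measure set R -> \bar R}) (h : nat -> R -> R)
    (s : seq nat) (x : nat) : R :=
  fine (\int[m]_(t in Rplus) (h x t * likelihood h s t)%:E) /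
  fine (\int[m]_(t in Rplus) (likelihood h s t)%:E).

(* n is the number of earlier steps. *)
Definition new_atom_rate (nu : {measure set R -> \bar R}) (h : nat -> R -> R)
    (n x : nat) : R :=
  fine (\int[nu]_(t in Rplus) (h 0%N t ^+ n * h x t)%:E).

End weights.

Section model.
Context (R : realType) dPsi (Psi : measurableType dPsi).
Context d (Om : measurableType d) (P : probability Om R).
Variables (K : nat) (psifix : 'I_K -> Psi) (F : 'I_K -> probability R R).
Variables (nu : {measure set R -> \bar R}) (G : probability Psi R).

(* inl k is the k-th fixed-location atom; inr k is the k-th ordinary atom,
   there being infinitely many of them because nu has infinite mass. *)
Definition crm_atom : choiceType := ('I_K + nat)%type.

Variables (theta : crm_atom -> Om -> {nonneg R}) (psi : crm_atom -> Om -> Psi).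

Definition ordinary_point_process (w : Om) :
    {measure set (R * Psi) -> \bar R} :=
  atomic (fun=> 1%:nng)
    (fun k : nat => ((theta (inr k) w)%:num, psi (inr k) w)).

(* F k is the law of the k-th fixed-location weight. *)
Record crm_atoms : Prop := {
  measurable_theta : forall l,
    measurable_fun [set: Om] (fun w => (theta l w)%:num);
  measurable_psi : forall l, measurable_fun [set: Om] (psi l);
  fixed_location : forall k w, psi (inl k) w = psifix k;
  distinct_fixed : injective psifix;
  fixed_weight_law : forall k B, measurable B ->
    P [set w | B (theta (inl k) w)%:num] = F k B;
  ordinary_poisson :
    poisson_process P ordinary_point_process (nu \x G)%E;
  fixed_ordinary_independent :
    mutually_independent P (fun o : option 'I_K =>
      if o is Some k
      then sigma_of (fun w => (theta (inl k) w)%:num)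
      else sigma_of_random_measure ordinary_point_process)
}.

Definition crm_atoms_sigma : set (set Om) :=
  <<s \bigcup_l (sigma_of (fun w => (theta l w)%:num) `|`
                 sigma_of (psi l)) >>.

(* X_1, ..., X_N are indexed by 0, ..., N-1. Conditional independence over all
   pairs (n, k) says both that the X_n are i.i.d. given the atoms and that the
   weights of each X_n are independent. *)
Definition observation_weights (N : nat) (h : nat -> R -> R)
    (x : 'I_N -> crm_atom -> Om -> nat) :=
  (forall n l, measurable_fun [set: Om] (x n l)) /\
  cond_independent_pmf P crm_atoms_sigma (fun=> setT)
    (fun nl : 'I_N * crm_atom => x nl.1 nl.2)
    (fun nl w a => h a (theta nl.2 w)%:num).

End model.

Section construction.
Context (R : realType) dPsi (Psi : measurableType dPsi).
Context d (Om : measurableType d) (P : probability Om R).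
Variables (N K : nat) (psifix : 'I_K -> Psi) (F : 'I_K -> probability R R).
Variables (nu : {sigma_finite_measure set R -> \bar R}) (G : probability Psi R).
Variable h : nat -> R -> R.

(* Steps n = 1, ..., N are indexed by 0, ..., N-1, so that n : 'I_N has n
   earlier steps. New atoms have positive weight: the index x stands for the
   weight x.+1. The label inr (n, x, j) is the j-th atom of weight x.+1 that is
   new at step n, and exists only if j < rho n x; inl k is the k-th
   fixed-location atom. *)
Definition atom_label : choiceType := ('I_K + 'I_N * nat * nat)%type.

Variables (rho : 'I_N -> nat -> Om -> nat).
Variables (newpsi : 'I_N -> nat -> nat -> Om -> Psi).
Variable y : 'I_N -> atom_label -> Om -> nat.

Definition location (l : atom_label) (w : Om) : Psi :=
  match l with
  | inl k => psifix k
  | inr (n, x, j) => newpsi n x j w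
  end.

Definition exists_atom (l : atom_label) : set Om :=
  match l with
  | inl _ => setT
  | inr (n, x, j) => [set w | (j < rho n x w)%N]
  end.

Definition before (n : 'I_N) (l : atom_label) : bool :=
  match l with
  | inl _ => true
  | inr (m, _, _) => (m < n)%N
  end.

(* The atoms present before step n. *)
Definition old_atom (n : 'I_N) (l : atom_label) : set Om :=
  [set w | before n l /\ exists_atom l w].

Definition constructed (n : 'I_N) (w : Om) : {measure set Psi -> \bar R} :=
  atomic (fun l => (y n l w)%:R%:nng) (location ^~ w).

Definition past (n : 'I_N) (l : atom_label) (w : Om) : seq nat :=
  [seq y m l w | m : 'I_N <- enum 'I_N & (m < n)%N].

(* The measure against which h is integrated in h_cond: nu for an atom that
   came from the ordinary component. A fixed-location atom is listed from the
   first step on, and its predictive law involves the law F k of its weight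
   instead of nu: G is diffuse, so the other atoms never sit at a fixed
   location. For K = 0 only nu occurs. *)
Definition prior (l : atom_label) : {measure set R -> \bar R} :=
  match l with
  | inl k => F k
  | inr _ => nu
  end.

(* Generated by the new atoms of all steps, which are independent of each other
   and of the draws of old weights, and by the weights at the steps before n;
   it determines X_1, ..., X_{n-1}. *)
Definition drawn_sigma (n : 'I_N) : set (set Om) :=
  <<s (\bigcup_m \bigcup_x sigma_of (rho m x)) `|`
      (\bigcup_m \bigcup_x \bigcup_j sigma_of (newpsi m x j)) `|`
      (\bigcup_(m in [set m : 'I_N | (m < n)%N]) \bigcup_l sigma_of (y m l)) >>.

Record marginal_construction : Prop := {
  measurable_rho : forall n x, measurable_fun [set: Om] (rho n x);
  measurable_newpsi : forall n x j, measurable_fun [set: Om] (newpsi n x j);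
  measurable_y : forall n l, measurable_fun [set: Om] (y n l);
  old_weights : forall n,
    cond_independent_pmf P (drawn_sigma n) (old_atom n) (y n)
      (fun l w a => hcond (prior l) h (past n l w) a);
  new_atom_number : forall n x U,
    P (rho n x @^-1` U) = poisson_prob (new_atom_rate nu h n x.+1) 0 U;
  new_atom_location : forall n x j B, measurable B ->
    P (newpsi n x j @^-1` B) = G B;
  new_atoms_independent :
    mutually_independent P (fun i : ('I_N * nat + 'I_N * nat * nat)%type =>
      match i with
      | inl (n, x) => sigma_of (rho n x)
      | inr (n, x, j) => sigma_of (newpsi n x j)
      end);
  new_weight : forall n x j w, exists_atom (inr (n, x, j)) w ->
    y n (inr (n, x, j)) w = x.+1;
  no_weight : forall n l w, ~ exists_atom l w -> y n l w = 0%N;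
  no_weight_before : forall (n m : 'I_N) x j w, (n < m)%N ->
    y n (inr (m, x, j)) w = 0%N;
  distinct_locations : {ae P, forall w, forall l l' : atom_label, l != l' ->
    exists_atom l w -> exists_atom l' w -> location l w <> location l' w};
  weight_at_location : {ae P, forall w, forall n (l : atom_label),
    exists_atom l w ->
    constructed n w [set location l w] = (y n l w)%:R%:E}
}.

End construction.

(* Main.v *)
Require Import Defs.
From mathcomp Require Import all_boot all_order all_algebra.
From mathcomp Require Import all_classical all_reals all_analysis.
From mathcomp Require Import measurable_realfun ring.

Set Implicit Arguments.
Unset Strict Implicit.
Unset Printing Implicit Defensive.

Import Order.TTheory GRing.Theory Num.Theory.
Import numFieldNormedType.Exports.

Local Open Scope classical_set_scope.
Local Open Scope ring_scope.

(** Both laws are identified through the same functional.  For measurable sets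
[A_1, ..., A_r], steps [n_1, ..., n_r] and [0 < u_i <= 1], consider the mean of
[u_1 ^ X_(n_1)(A_1) * ... * u_r ^ X_(n_r)(A_r)].  As functions of the [u_i],
such means determine the joint law of the counts ([pgf_determines_law]), hence
the law of the sequence of measures ([same_law_pgf]).  Each of them is also the
mean of a product over atoms: an atom at [t] with weights [x_1, ..., x_N]
contributes the product over [n] of [s_n(t) ^ x_n], where [s_n(t)] depends only
on which of the [A_i] contain [t] ([pattern_base_code]).

With [H(s, theta)] the generating function of [h(. | theta)], the common value,
[limit_functional], is the product over fixed atoms [k] of the mean under [F_k]
of [prod_n H(s_n, theta)], times [exp(- Lambda)], where [Lambda] is the integral
of [1 - prod_n H(s_n(t), theta)] against [nu(dtheta) G(dt)].

For the observations, averaging the weights given the atoms replaces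
[s_n ^ x_n] by [H(s_n, theta)] ([mean_first_atoms]), and the rest is the Laplace
functional of a Poisson process ([poisson_laplace]), proved for functions with
finitely many values and extended by monotone approximation.

For the construction, the predictive probabilities of one atom telescope: the
chance of a full weight history of a new atom is the quotient of
[int nu(dtheta) prod_n h(x_n | theta)] by the rate at which its class (first
step [m] and first weight [x]) is drawn ([history_prob]).  So, given the numbers
of new atoms, the atoms behave like a mixture over [theta], and summing over
histories, locations and Poisson numbers gives the exponential of
[- sum_(m, x) int nu(dtheta) h(0 | theta) ^ m h(x | theta)
(1 - s_m ^ x prod_(n > m) H(s_n, theta))] averaged over [G]
([mean_drawn_weight]).  This exponent is [Lambda], because splitting an atom
according to the step at which it is first seen telescopes
([seen_defect_total]).

All interchanges of sums over finitely many integer variables go through one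
principle: two functionals that are countably additive in each of finitely many
test functions agree as soon as they agree on point masses
([multimeasure_ext]). *)

(** * Functionals that are countably additive in each of finitely many slots *)

Section countable_series.
Local Open Scope ereal_scope.
Context {R : realType}.
Implicit Types f : nat -> \bar R.

Definition point_mass (a : nat) : nat -> \bar R := fun b => ((a == b)%:R)%:E.

Lemma point_mass_ge0 a b : 0 <= point_mass a b.
Proof. by rewrite lee_fin. Qed.

(** The constant may be [+oo], which the real-valued version does not cover. *)
Lemma nneseriesZle f (c : \bar R) : 0 <= c -> (forall n, 0 <= f n) ->
  \sum_(n <oo) c * f n = c * \sum_(n <oo) f n.
Proof.
move=> c0 f0; rewrite -!ge0_integral_count//; last first.
  by move=> n; exact: mule_ge0.
by rewrite ge0_integralZl.
Qed.

Lemma nneseriesZre f (c : \bar R) : 0 <= c -> (forall n, 0 <= f n) ->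
  \sum_(n <oo) f n * c = (\sum_(n <oo) f n) * c.
Proof.
by move=> c0 f0; rewrite muleC -nneseriesZle//; under eq_eseriesr do rewrite muleC.
Qed.

Lemma nneseries_single f (a : nat) : (forall n, n != a -> f n = 0) ->
  0 <= f a -> \sum_(n <oo) f n = f a.
Proof.
move=> fa f0; have f_ge0 n : 0 <= f n by have [->//|/fa ->] := eqVneq n a.
rewrite (nneseriesD1 (n := a))//= eseries0 ?adde0//.
by move=> i _ /=; exact: fa.
Qed.

Lemma point_mass_expand f : (forall n, 0 <= f n) ->
  forall b, f b = \sum_(a <oo) f a * point_mass a b.
Proof.
move=> f0 b; rewrite (nneseries_single (a := b)).
- by rewrite /point_mass eqxx mule1.
- by move=> n nb; rewrite /point_mass (negbTE nb) mule0.
- by rewrite mule_ge0// point_mass_ge0.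
Qed.

Lemma point_mass_series (p : nat -> \bar R) a : (forall n, 0 <= p n) ->
  \sum_(b <oo) p b * point_mass a b = p a.
Proof.
move=> p0; rewrite (nneseries_single (a := a)).
- by rewrite /point_mass eqxx mule1.
- by move=> n na; rewrite /point_mass eq_sym (negbTE na) mule0.
- by rewrite mule_ge0// point_mass_ge0.
Qed.

End countable_series.

Section slots.
Local Open Scope ereal_scope.
Context {R : realType} (J : eqType).
Implicit Types (f : J -> nat -> \bar R) (Phi : (J -> nat -> \bar R) -> \bar R).

Definition nonneg_slots f := forall i a, 0 <= f i a.

Definition fill f (j : J) (g : nat -> \bar R) : J -> nat -> \bar R :=
  fun i => if i == j then g else f i.

Lemma fill_eq f j g : fill f j g j = g.
Proof. by rewrite /fill eqxx. Qed.

Lemma fill_neq f j g i : i != j -> fill f j g i = f i.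
Proof. by rewrite /fill => /negbTE ->. Qed.

Lemma fill_ge0 f j g : nonneg_slots f -> (forall a, 0 <= g a) ->
  nonneg_slots (fill f j g).
Proof. by move=> f0 g0 i a; rewrite /fill; case: ifP. Qed.

(** Expanding the slot [j] over point masses: a functional with this property for
every slot behaves like a multilinear, countably additive extension of its
values on point masses. *)
Definition additive_in j Phi := forall f, nonneg_slots f ->
  Phi f = \sum_(a <oo) f j a * Phi (fill f j (point_mass a)).

(** Expand the slots one after the other, until only point masses are left in
the slots of [s]. *)
Lemma multimeasure_ext (s : seq J) Phi Psi :
  (forall j, j \in s -> additive_in j Phi) ->
  (forall j, j \in s -> additive_in j Psi) ->
  (forall f (a : J -> nat), nonneg_slots f ->
     (forall j, j \in s -> f j = point_mass (a j)) -> Phi f = Psi f) ->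
  forall f, nonneg_slots f -> Phi f = Psi f.
Proof.
move=> aPhi aPsi agree.
suff H (s1 : seq J) f : nonneg_slots f ->
    (forall j, j \in s -> j \notin s1 -> exists a, f j = point_mass a) ->
    Phi f = Psi f.
  by move=> f f0; apply: (H s f f0) => j ->.
elim: s1 f => [|j s1 IH] f f0 fs.
  pose P j a := f j = point_mass a.
  have Pex j : exists a, j \in s -> P j a.
    have [js|js] := boolP (j \in s); last by exists 0%N.
    by have [a fa] := fs j js isT; exists a.
  by have /choice[a fa] := Pex; exact: (agree f a).
have [js|js] := boolP (j \in s); last first.
  apply: IH => // i si is1; apply: fs => //.
  by rewrite inE negb_or is1 andbT; apply: contraNneq js => <-.
rewrite (aPhi _ js _ f0) (aPsi _ js _ f0); apply: eq_eseriesr => a _; congr (_ * _).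
apply: IH => [|i si is1]; first by apply: fill_ge0 => //; exact: point_mass_ge0.
have [->|ij] := eqVneq i j; first by exists a; rewrite fill_eq.
by rewrite fill_neq//; apply: fs => //; rewrite inE negb_or ij.
Qed.

Lemma additive_series j (p : nat -> \bar R) : (forall a, 0 <= p a) ->
  additive_in j (fun f => \sum_(a <oo) p a * f j a).
Proof.
move=> p0 f f0; apply: eq_eseriesr => a _.
by rewrite fill_eq point_mass_series// muleC.
Qed.

Lemma additive_eval j b : additive_in j (fun f => f j b).
Proof.
move=> f f0 /=; rewrite {1}(point_mass_expand (f0 j) b).
by under [in RHS]eq_eseriesr do rewrite fill_eq.
Qed.

Lemma additive_mull j Phi Psi : additive_in j Phi ->
  (forall f, nonneg_slots f -> 0 <= Phi f) ->
  (forall f, nonneg_slots f -> 0 <= Psi f) ->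
  (forall f g, Psi (fill f j g) = Psi f) ->
  additive_in j (fun f => Psi f * Phi f).
Proof.
move=> aPhi Phi0 Psi0 PsiE f f0; rewrite aPhi// -nneseriesZle//; last 2 first.
- exact: Psi0.
- move=> n; rewrite mule_ge0//; apply: Phi0; apply: fill_ge0 => //.
  exact: point_mass_ge0.
by apply: eq_eseriesr => a _; rewrite PsiE muleCA.
Qed.

(** Only one factor may see the slot [j]; the others are constants there. *)
Lemma additive_prod (I : eqType) (r : seq I) (i0 : I) j
    (Xi : I -> (J -> nat -> \bar R) -> \bar R) :
  uniq r -> i0 \in r -> additive_in j (Xi i0) ->
  (forall i f, nonneg_slots f -> 0 <= Xi i f) ->
  (forall i f g, i \in r -> i != i0 -> Xi i (fill f j g) = Xi i f) ->
  additive_in j (fun f => \prod_(i <- r) Xi i f).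
Proof.
move=> ur ir aXi Xi0 XiE.
rewrite (_ : (fun _ => _) =
    (fun f => (\prod_(i <- r | i != i0) Xi i f) * Xi i0 f)); last first.
  by apply/funext => f; rewrite (bigD1_seq i0)//= muleC.
apply: additive_mull => // [f f0|f f0|f g].
- exact: Xi0.
- by apply: prode_ge0 => i _; exact: Xi0.
- by rewrite big_seq_cond [RHS]big_seq_cond; apply: eq_bigr => i /andP[ir' ii]; rewrite XiE.
Qed.

Lemma additive_integral d (T : measurableType d)
    (mu : {measure set T -> \bar R}) (D : set T) j
    (Xi : T -> (J -> nat -> \bar R) -> \bar R) : measurable D ->
  (forall f, nonneg_slots f -> measurable_fun D (Xi ^~ f)) ->
  (forall t f, D t -> nonneg_slots f -> 0 <= Xi t f) ->
  (forall t, D t -> additive_in j (Xi t)) ->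
  additive_in j (fun f => \int[mu]_(t in D) Xi t f).
Proof.
move=> mD mXi Xi0 aXi f f0.
have pf0 a : nonneg_slots (fill f j (point_mass a)).
  by apply: fill_ge0 => //; exact: point_mass_ge0.
under [RHS]eq_eseriesr => a _.
  rewrite -ge0_integralZl//; last 2 first.
  - exact: mXi.
  - by move=> x Dx; exact: Xi0.
  over.
rewrite -integral_nneseries//.
- by apply: eq_integral => t; rewrite inE => Dt; exact: aXi.
- by move=> a; apply: measurable_funeM; exact: mXi.
- by move=> a t Dt; rewrite mule_ge0//; exact: Xi0.
Qed.

End slots.

(** * Expectations of finitely many integer-valued random variables *)

Lemma g_sigma_bigcap_seq (T : pointedType) (G : set (set T)) (J : choiceType)
    (s : seq J) (A : J -> set T) :
  (forall j, j \in s -> <<s G >> (A j)) ->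
  <<s G >> (\bigcap_(j in [set` s]) A j).
Proof.
move=> GA; rewrite bigcap_seq big_seq.
exact: (@bigsetI_measurable _ (g_sigma_algebraType G) _ s (fun j => j \in s)).
Qed.

Section nat_variables.
Local Open Scope ereal_scope.
Context d (Om : measurableType d) {R : realType}.

Lemma measurable_nat_fibers (z : Om -> nat) :
  (forall a, measurable (z @^-1` [set a])) -> measurable_fun [set: Om] z.
Proof.
move=> mz _ U _; rewrite setTI.
rewrite (_ : _ @^-1` _ = \bigcup_(a in U) z @^-1` [set a]).
  by apply: bigcup_measurable => a _; exact: mz.
by apply/seteqP; split => [w Uzw|w [a Ua /= ->//]]; exists (z w).
Qed.

Lemma measurable_fiber (z : Om -> nat) a : measurable_fun [set: Om] z ->
  measurable (z @^-1` [set a]).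
Proof. by move=> mz; rewrite -[X in measurable X]setTI; exact: mz. Qed.

Lemma measurable_fibers (J : choiceType) (s : seq J) (z : J -> Om -> nat)
    (a : J -> nat) : (forall j, j \in s -> measurable_fun [set: Om] (z j)) ->
  measurable (\bigcap_(j in [set` s]) (z j @^-1` [set a j])).
Proof.
move=> mz; rewrite bigcap_seq; elim: s mz => [|j s IH] mz.
  by rewrite big_nil.
rewrite big_cons; apply: measurableI.
  by apply: measurable_fiber; apply: mz; rewrite mem_head.
by apply: IH => i si; apply: mz; rewrite inE si orbT.
Qed.

(** A countable case distinction keeps measurability; this handles quantities such
as products over a random number of factors. *)
Lemma measurable_switch d' (T : measurableType d') (z : Om -> nat)
    (F : nat -> Om -> T) : measurable_fun [set: Om] z ->
  (forall a, measurable_fun [set: Om] (F a)) ->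
  measurable_fun [set: Om] (fun w => F (z w) w).
Proof.
move=> mz mF _ B mB; rewrite setTI.
rewrite (_ : _ @^-1` _ =
    \bigcup_a (z @^-1` [set a] `&` ([set: Om] `&` F a @^-1` B))).
  apply: bigcup_measurable => a _; apply: measurableI.
    exact: measurable_fiber.
  exact: mF.
apply/seteqP; split => [w FB|w [a _ [/= <- []//]]].
by exists (z w).
Qed.

Lemma emeasurable_prod_seq D (I : eqType) (s : seq I) (f : I -> Om -> \bar R) :
  (forall i, i \in s -> measurable_fun D (f i)) ->
  measurable_fun D (fun w => \prod_(i <- s) f i w).
Proof.
elim: s => [|i s IH] mf.
  by under eq_fun do rewrite big_nil; exact: measurable_cst.
under eq_fun do rewrite big_cons; apply: emeasurable_funM.
  by apply: mf; rewrite mem_head.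
by apply: IH => j js; apply: mf; rewrite inE js orbT.
Qed.

Section joint.
Variables (mu : {measure set Om -> \bar R}) (E : set Om) (mE : measurable E).
Variables (J : choiceType) (s : seq J) (us : uniq s) (z : J -> Om -> nat).
Hypothesis mz : forall j, j \in s -> measurable_fun [set: Om] (z j).
Variables (V : Om -> \bar R) (mV : measurable_fun [set: Om] V).
Hypothesis V0 : forall w, 0 <= V w.

Lemma integral_point_masses (a : J -> nat) :
  \int[mu]_(w in E) (V w * \prod_(j <- s) point_mass (a j) (z j w)) =
  \int[mu]_(w in E `&` \bigcap_(j in [set` s]) (z j @^-1` [set a j])) V w.
Proof.
rewrite [RHS]integral_mkcondr; apply: eq_integral => w _.
rewrite /patch; case: ifPn => [/set_mem zw|zw].
  rewrite big_seq big1 ?mule1// => j js.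
  by rewrite /point_mass (zw j js) eqxx.
have [j js jz] : exists2 j, j \in s & a j != z j w.
  apply: contrapT => H; move/negP : zw; apply; apply/mem_set => j /= js.
  by apply/eqP; apply: contrapT => /negP ne; apply: H; exists j; rewrite // eq_sym.
by rewrite (bigD1_seq j)//= /point_mass (negbTE jz) mul0e mule0.
Qed.

Lemma additive_expectation j : j \in s ->
  additive_in j (fun f => \int[mu]_(w in E) (V w * \prod_(j <- s) f j (z j w))).
Proof.
move=> js; apply: (@additive_integral _ _ _ _ mu E j
    (fun w f => V w * \prod_(j <- s) f j (z j w))) => //.
- move=> f f0; apply: emeasurable_funM; first exact: measurable_funTS.
  apply: emeasurable_prod_seq => i js'; apply: measurable_funTS.
  by apply: measurableT_comp => //; exact: mz.
- move=> w f _ f0; rewrite mule_ge0//; apply: prode_ge0 => i _; exact: f0.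
- move=> w _; apply: additive_mull => //.
  + apply: (additive_prod (Xi := fun i f => f i (z i w)) us js) => //.
    * exact: additive_eval.
    * by move=> i f g _ ij; rewrite fill_neq.
  + by move=> f f0; apply: prode_ge0 => i _; exact: f0.
Qed.

(** To compute the mean of [V * prod_j f_j(z_j)] it is enough to guess an expression
that is countably additive in each [f_j] and to check it on the events where all
the [z_j] have prescribed values. *)
Lemma joint_expectation_ext (Psi : (J -> nat -> \bar R) -> \bar R) :
  (forall j, j \in s -> additive_in j Psi) ->
  (forall f (a : J -> nat), nonneg_slots f ->
     (forall j, j \in s -> f j = point_mass (a j)) ->
     \int[mu]_(w in E `&` \bigcap_(j in [set` s]) (z j @^-1` [set a j])) V w =
     Psi f) ->
  forall f, nonneg_slots f ->
    \int[mu]_(w in E) (V w * \prod_(j <- s) f j (z j w)) = Psi f.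
Proof.
move=> aPsi agree; apply: (@multimeasure_ext _ _ s
  (fun f => \int[mu]_(w in E) (V w * \prod_(j <- s) f j (z j w)))) => //.
- exact: additive_expectation.
- move=> f a f0 fa; rewrite -(agree f a f0 fa) -integral_point_masses.
  by apply: eq_integral => w _; congr (_ * _); apply: eq_big_seq => j js; rewrite fa.
Qed.

End joint.

Lemma bounded_cvg_integral (P : probability Om R) (f_ : nat -> Om -> \bar R)
    (f : Om -> \bar R) :
  (forall n, measurable_fun [set: Om] (f_ n)) ->
  (forall n w, 0 <= f_ n w <= 1) ->
  (forall w, f_ ^~ w @ \oo --> f w) ->
  \int[P]_w f_ n w @[n --> \oo] --> \int[P]_w f w.
Proof.
move=> mf f01 cf.
have mlim : measurable_fun [set: Om] f by exact: (emeasurable_fun_cvg f_).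
have i1 : P.-integrable [set: Om] (cst 1).
  apply/integrableP; split => //; rewrite (eq_integral (cst 1)).
    rewrite integral_cst// mul1e.
  
  by rewrite (le_lt_trans (probability_le1 P measurableT)) ?ltry.
  by move=> w _; rewrite gee0_abs.
have [| | |_ _] :=
  @dominated_convergence _ _ _ P setT measurableT f_ f (cst 1) mf mlim.
- by apply: nearW => w _.
- by exact: i1.
- by apply: nearW => w n _; have /andP[f0 f1] := f01 n w; rewrite gee0_abs.
- exact.
Qed.

End nat_variables.

(** * Probability generating functions determine joint laws of counts *)

Section power_series.
Local Open Scope ereal_scope.
Context {R : realType}.

Lemma fin_addeI (x a b : \bar R) : x \is a fin_num -> x + a = x + b -> a = b.
Proof.
by move=> fx; rewrite ![x + _]addeC => E; rewrite -(addeK a fx) E addeK.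
Qed.

(* If the coefficients agree below [k], the tails divided by [u ^ k] give
[a_k <= b_k + u * B] with [B] the sum of the [b_n]; let [u] tend to [0]. *)
Let le_coef (a b : nat -> \bar R) k : (forall n, 0 <= a n) -> (forall n, 0 <= b n) ->
  \sum_(n <oo) a n < +oo -> \sum_(n <oo) b n < +oo ->
  (forall u : R, (0 < u < 1)%R ->
    \sum_(n <oo) a n * (u ^+ n)%:E = \sum_(n <oo) b n * (u ^+ n)%:E) ->
  (forall i, (i < k)%N -> a i = b i) -> a k <= b k.
Proof.
move=> a0 b0 afin bfin ab abk.
have fin (c : nat -> \bar R) : (forall n, 0 <= c n) -> \sum_(n <oo) c n < +oo ->
    forall n, c n \is a fin_num.
  move=> c0 cfin n; rewrite ge0_fin_numE//; apply: le_lt_trans cfin.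
  rewrite (nneseriesD1 (n := n))// leeDl//.
  by apply: nneseries_ge0 => i _ _; exact: c0.
have fa := fin _ a0 afin; have fb := fin _ b0 bfin.
pose B := fine (\sum_(n <oo) b n).
have bfn : \sum_(n <oo) b n \is a fin_num.
  by rewrite ge0_fin_numE//; apply: nneseries_ge0.
have B0 : (0 <= B)%R by rewrite fine_ge0//; apply: nneseries_ge0.
have key (u : R) : (0 < u < 1)%R -> (fine (a k) <= fine (b k) + u * B)%R.
  move=> u01; have /andP[u0 u1] := u01.
  have uk n : 0 <= (u ^+ n)%:E by rewrite lee_fin exprn_ge0// ltW.
  have au n : 0 <= a n * (u ^+ n)%:E by rewrite mule_ge0.
  have bu n : 0 <= b n * (u ^+ n)%:E by rewrite mule_ge0.
  have tails : \sum_(k <= n <oo) a n * (u ^+ n)%:E =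
               \sum_(k <= n <oo) b n * (u ^+ n)%:E.
    have := ab u u01.
    rewrite (nneseries_split 0 k); last by move=> n _; exact: au.
    rewrite (nneseries_split 0 k (f := fun n => b n * (u ^+ n)%:E)); last first.
      by move=> n _; exact: bu.
    rewrite add0n (_ : \sum_(0 <= i < k) a i * (u ^+ i)%:E =
                       \sum_(0 <= i < k) b i * (u ^+ i)%:E); last first.
      by apply: eq_big_nat => i /andP[_ ik]; rewrite abk.
    apply: fin_addeI; apply/sum_fin_numP => i _ _; rewrite fin_numM//.
  have ak : a k * (u ^+ k)%:E <= \sum_(k <= n <oo) b n * (u ^+ n)%:E.
    rewrite -tails (nneseries_split k 1); last by move=> n _; exact: au.
    by rewrite addn1 big_nat1 leeDl// nneseries_ge0.
  have bk : \sum_(k <= n <oo) b n * (u ^+ n)%:E <=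
      b k * (u ^+ k)%:E + (u ^+ k.+1)%:E * \sum_(n <oo) b n.
    rewrite (nneseries_split k 1); last by move=> n _; exact: bu.
    rewrite addn1 big_nat1 leeD2l//.
    apply: (@le_trans _ _ ((u ^+ k.+1)%:E * \sum_(n <oo) b (n + k.+1)%N)).
      rewrite -nneseries_addn// -nneseriesZle//; apply: lee_nneseries => // n _.
      rewrite muleC lee_wpmul2r// lee_fin exprD -[leRHS]mul1r ler_wpM2r//.
        by rewrite exprn_ge0// ltW.
      by rewrite exprn_ile1// ltW.
    rewrite lee_wpmul2l// nneseries_addn// [leRHS](nneseries_split 0 k.+1)//.
    by rewrite add0n leeDr// sume_ge0.
  have := le_trans ak bk.
  rewrite -(fineK (fa k)) -(fineK (fb k)) -(fineK bfn) -!EFinM -EFinD lee_fin.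
  rewrite exprSr -mulrA -/B mulrC [X in (_ <= X + _)%R]mulrC -mulrDr ler_pM2l//.
  by rewrite exprn_gt0.
rewrite -(fineK (fa k)) -(fineK (fb k)) lee_fin.
apply/ler_addgt0Pr => e e0.
pose u := Num.min 2^-1%R (e / (B + 1))%R.
have B1 : (0 < B + 1)%R by rewrite ltr_wpDl.
have u01 : (0 < u < 1)%R.
  rewrite /u lt_min invr_gt0 ltr0n divr_gt0//= gt_min invf_lt1 ?ltr0n// ltr1n.
  by [].
apply: (le_trans (key u u01)); rewrite lerD2l.
have /andP[u0 _] := u01.
apply: (@le_trans _ _ (u * (B + 1))%R).
  by rewrite ler_pM2l// lerDl.
by rewrite -ler_pdivlMr// /u ge_min lexx orbT.
Qed.

Lemma power_series_inj (a b : nat -> \bar R) :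
  (forall n, 0 <= a n) -> (forall n, 0 <= b n) ->
  \sum_(n <oo) a n < +oo -> \sum_(n <oo) b n < +oo ->
  (forall u : R, (0 < u < 1)%R ->
    \sum_(n <oo) a n * (u ^+ n)%:E = \sum_(n <oo) b n * (u ^+ n)%:E) ->
  forall k, a k = b k.
Proof.
move=> a0 b0 afin bfin ab k.
elim/ltn_ind: k => k IH; apply/eqP; rewrite eq_le; apply/andP; split.
  exact: le_coef.
by apply: le_coef => // [u u01|i ik]; [rewrite ab|rewrite IH].
Qed.

End power_series.

Section counts.
Local Open Scope ereal_scope.
Context {R : realType}.

(** Counts take values in the natural numbers and [+oo]; the code of a finite count
[k] is [k.+1] and that of [+oo] is [0], so that integer-valued random variables
suffice. *)
Definition count_code (e : \bar R) : nat :=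
  if pselect (exists k : nat, e = k%:R%:E) is left p then (sval (cid p)).+1 else 0.

Lemma count_code_nat k : count_code k%:R%:E = k.+1.
Proof.
rewrite /count_code; case: pselect => [p|]; last by case; exists k.
by case: (cid p) => j /= /eqP; rewrite eqe eqr_nat => /eqP ->.
Qed.

Lemma count_codey : count_code +oo = 0%N.
Proof. by rewrite /count_code; case: pselect => // -[]. Qed.

Lemma count_code_eqS e k : count_code e = k.+1 <-> e = k%:R%:E.
Proof.
split=> [|->]; last exact: count_code_nat.
by rewrite /count_code; case: pselect => // p [<-]; case: (cid p).
Qed.

Lemma measurable_count_code d (T : measurableType d) (f : T -> \bar R) :
  measurable_fun [set: T] f -> measurable_fun [set: T] (count_code \o f).
Proof.
move=> mf; have mk k : measurable ((count_code \o f) @^-1` [set k.+1]).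
  rewrite (_ : _ @^-1` _ = f @^-1` [set k%:R%:E]).
    by rewrite -[X in measurable X]setTI; apply: mf => //; exact: emeasurable_set1.
  by apply/seteqP; split => w /=; rewrite count_code_eqS.
apply: measurable_nat_fibers => -[|k]; last exact: mk.
rewrite (_ : _ @^-1` _ = ~` \bigcup_k ((count_code \o f) @^-1` [set k.+1])).
  by apply: measurableC; exact: bigcup_measurable.
apply/seteqP; split => w /=; first by move=> w0 [k _] /=; rewrite w0.
by case E : (count_code (f w)) => [//|k] H; exfalso; apply: H; exists k.
Qed.

(** [u] to the power of the count with code [z].  At infinity the value is [0] for
[u < 1] but [1] for [u = 1]: with this convention it is the limit of [u ^ N_n]
for finite counts [N_n] increasing to the count, and [u = 1] always means that
the variable is ignored. *)
Definition pgf (u : R) (z : nat) : R := if z is k.+1 then u ^+ k else (u == 1%R)%:R.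

Lemma pgf_ge0 u z : (0 <= u)%R -> (0 <= pgf u z)%R.
Proof. by case: z => [|k] u0 /=; rewrite ?ler0n// exprn_ge0. Qed.

Lemma pgf_le1 u z : (0 <= u <= 1)%R -> (pgf u z <= 1)%R.
Proof.
move=> /andP[u0 u1]; case: z => [|k] /=; first by rewrite lern1 leq_b1.
exact: exprn_ile1.
Qed.

Lemma pgf1 z : pgf 1 z = 1%R.
Proof. by case: z => [|k] /=; rewrite ?eqxx ?expr1n. Qed.

Section determine.
Context d1 (Om1 : measurableType d1) (P1 : probability Om1 R).
Context d2 (Om2 : measurableType d2) (P2 : probability Om2 R).
Variables (J : choiceType) (s : seq J) (us : uniq s).
Variables (z1 : J -> Om1 -> nat) (z2 : J -> Om2 -> nat).
Hypothesis mz1 : forall j, j \in s -> measurable_fun [set: Om1] (z1 j).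
Hypothesis mz2 : forall j, j \in s -> measurable_fun [set: Om2] (z2 j).

Let mean d (Om : measurableType d) (P : probability Om R) (z : J -> Om -> nat)
  (f : J -> nat -> \bar R) := \int[P]_w \prod_(j <- s) f j (z j w).

Let mean_additive d (Om : measurableType d) (P : probability Om R)
    (z : J -> Om -> nat) j :
  (forall j, j \in s -> measurable_fun [set: Om] (z j)) -> j \in s ->
  additive_in j (mean P z).
Proof.
move=> mz js; apply: (@additive_integral _ _ _ _ P setT j
    (fun w f => \prod_(j <- s) f j (z j w))) => //.
- move=> f f0; apply: emeasurable_prod_seq => i js'.
  by apply: measurableT_comp => //; exact: mz.
- by move=> w f _ f0; apply: prode_ge0 => i _; exact: f0.
- move=> w _; apply: (additive_prod (Xi := fun i f => f i (z i w)) us js) => //.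
  + exact: additive_eval.
  + by move=> i f g _ ij; rewrite fill_neq.
Qed.

Let mean_le1 d (Om : measurableType d) (P : probability Om R)
    (z : J -> Om -> nat) f :
  (forall j, j \in s -> measurable_fun [set: Om] (z j)) ->
  nonneg_slots f -> (forall j a, j \in s -> f j a <= 1) -> mean P z f <= 1.
Proof.
move=> mz f0 f1; apply: (@le_trans _ _ (\int[P]_w (cst 1) w)).
  apply: ge0_le_integral => //.
  - by move=> w _; apply: prode_ge0 => i _; exact: f0.
  - apply: emeasurable_prod_seq => i js'.
    by apply: measurableT_comp => //; exact: mz.
  - move=> w _; elim: s f1 => [|j r IH] f1; first by rewrite big_nil.
    rewrite big_cons -[leRHS]mule1; apply: lee_pmul => //.
    + by apply: prode_ge0 => i _; exact: f0.
    + by apply: f1; rewrite mem_head.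
    + by apply: IH => i a ir; apply: f1; rewrite inE ir orbT.
by rewrite integral_cst// mul1e probability_le1.
Qed.

(** One variable at a time: for [u < 1] the power series identity recovers the
probabilities of finite values, and [u = 1] then gives that of [+oo], all sums
being finite. *)
Lemma pgf_determines_law :
  (forall u : J -> R, (forall j, 0 < u j <= 1)%R ->
     \int[P1]_w \prod_(j <- s) (pgf (u j) (z1 j w))%:E =
     \int[P2]_w \prod_(j <- s) (pgf (u j) (z2 j w))%:E) ->
  forall f, nonneg_slots f ->
    \int[P1]_w \prod_(j <- s) f j (z1 j w) =
    \int[P2]_w \prod_(j <- s) f j (z2 j w).
Proof.
move=> agree.
pose is_pgf (g : nat -> \bar R) :=
  exists2 u : R, (0 < u <= 1)%R & g = fun b => (pgf u b)%:E.
pose is_point (g : nat -> \bar R) := exists a, g = point_mass a.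
suff H (s2 : seq J) f : (forall j, j \in s -> is_pgf (f j) \/ j \in s2 /\ is_point (f j)) ->
    nonneg_slots f -> mean P1 z1 f = mean P2 z2 f.
  apply: (@multimeasure_ext _ _ s (mean P1 z1) (mean P2 z2)).
  - by move=> j js; exact: mean_additive.
  - by move=> j js; exact: mean_additive.
  - by move=> f a f0 fa; apply: (H s) => // j js; right; split => //; exists (a j); exact: fa.
elim: s2 f => [|j s2 IH] f fs f0.
  have Pex j : exists u : R, (0 < u <= 1)%R /\ (j \in s -> f j = fun b => (pgf u b)%:E).
    have [js|js] := boolP (j \in s); last by exists 1%R; split => //; rewrite ltr01 lexx.
    by have [[u u01 fj]|[]//] := fs j js; exists u.
  have /choice[u uP] := Pex.
  rewrite (_ : mean P1 z1 f = \int[P1]_w \prod_(j <- s) (pgf (u j) (z1 j w))%:E).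
    rewrite agree; last by move=> j; have [] := uP j.
    by apply: eq_integral => w _; apply: eq_big_seq => j js; have [_ ->] := uP j.
  by apply: eq_integral => w _; apply: eq_big_seq => j js; have [_ ->] := uP j.
have [[js [jpgf|[_ [a fa]]]]|skip] :
    (j \in s /\ (is_pgf (f j) \/ j \in j :: s2 /\ is_point (f j))) \/ j \notin s.
  by have [js|] := boolP (j \in s); [left; split => //; exact: fs|right].
- apply: IH => // i si; have [->|ij] := eqVneq i j; first by left.
  have [?|[]] := fs i si; first by left.
  by rewrite inE (negbTE ij) => is2 ?; right.
- have IHu u : (0 < u <= 1)%R ->
      mean P1 z1 (fill f j (fun b => (pgf u b)%:E)) =
      mean P2 z2 (fill f j (fun b => (pgf u b)%:E)).
    move=> u01; apply: IH; last first.
      apply: fill_ge0 => // b; rewrite lee_fin pgf_ge0//.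
      by case/andP: u01 => /ltW.
    move=> i si; have [->|ij] := eqVneq i j.
      by left; exists u => //; rewrite fill_eq.
    rewrite fill_neq//; have [?|[]] := fs i si; first by left.
    by rewrite inE (negbTE ij) => is2 ?; right.
  pose A1 b := mean P1 z1 (fill f j (point_mass b)).
  pose A2 b := mean P2 z2 (fill f j (point_mass b)).
  have fillfill g h : fill (fill f j g) j h = fill f j h.
    by apply/funext => i; rewrite /fill; case: eqP.
  have expand d (Om : measurableType d) (P : probability Om R) (z : J -> Om -> nat) u :
      (forall j, j \in s -> measurable_fun [set: Om] (z j)) -> (0 < u <= 1)%R ->
      mean P z (fill f j (fun b => (pgf u b)%:E)) =
      \sum_(b <oo) (pgf u b)%:E * mean P z (fill f j (point_mass b)).
    move=> mz /andP[/ltW u0 _]; rewrite (mean_additive _ _ js)//; last first.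
      by apply: fill_ge0 => // b; rewrite lee_fin pgf_ge0.
    by apply: eq_eseriesr => b _; rewrite fillfill fill_eq.
  have A_ge0 d (Om : measurableType d) (P : probability Om R) (z : J -> Om -> nat) b :
      0 <= mean P z (fill f j (point_mass b)).
    apply: integral_ge0 => w _; apply: prode_ge0 => i _.
    by apply: fill_ge0 => // ?; exact: point_mass_ge0.
  have f_le1 i b : i \in s -> f i b <= 1.
    move=> si; have [[u /andP[u0 u1] ->]|[_ [c ->]]] := fs i si.
      by rewrite lee_fin pgf_le1// u1 ltW.
    by rewrite /point_mass lee_fin lern1 leq_b1.
  have A_fin d (Om : measurableType d) (P : probability Om R) (z : J -> Om -> nat) :
      (forall j, j \in s -> measurable_fun [set: Om] (z j)) ->
      \sum_(b <oo) mean P z (fill f j (point_mass b)) < +oo.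
    move=> mz; rewrite (_ : \sum_(b <oo) _ =
        mean P z (fill f j (fun b => (pgf 1 b)%:E))).
      apply: (@le_lt_trans _ _ 1); last exact: ltry.
      apply: mean_le1 => //.
        by apply: fill_ge0 => // b; rewrite pgf1.
      move=> i b si; rewrite /fill; case: ifP => _; last exact: f_le1.
      by rewrite pgf1.
    rewrite expand// ?ltr01 ?lexx//.
    by apply: eq_eseriesr => b _; rewrite pgf1 mul1e.
  have shift (h : nat -> \bar R) : (forall b, 0 <= h b) ->
      \sum_(b <oo) h b = h 0%N + \sum_(b <oo) h b.+1.
    by move=> h0; rewrite nneseries_recl// -nneseries_addn//; under eq_eseriesr do rewrite addn1.
  have AS k : A1 k.+1 = A2 k.+1.
    apply: (@power_series_inj R (fun k => A1 k.+1) (fun k => A2 k.+1)).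
    - by move=> n; exact: A_ge0.
    - by move=> n; exact: A_ge0.
    - apply: le_lt_trans (A_fin _ _ P1 _ mz1); rewrite [leRHS]shift; last first.
        by move=> b; exact: A_ge0.
      by rewrite leeDr// A_ge0.
    - apply: le_lt_trans (A_fin _ _ P2 _ mz2); rewrite [leRHS]shift; last first.
        by move=> b; exact: A_ge0.
      by rewrite leeDr// A_ge0.
    - move=> u /andP[u0 u1].
      have u01 : (0 < u <= 1)%R by rewrite u0 ltW.
      have := IHu u u01; rewrite !expand//.
      rewrite shift; last first.
        by move=> b; rewrite mule_ge0// ?A_ge0// lee_fin pgf_ge0// ltW.
      rewrite [in X in _ = X -> _]shift; last first.
        by move=> b; rewrite mule_ge0// ?A_ge0// lee_fin pgf_ge0// ltW.
      rewrite /= (lt_eqF u1) !mul0e !add0e => E.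
      under eq_eseriesr do rewrite muleC.
      by rewrite E; apply: eq_eseriesr => b _; rewrite muleC.
  have A0 : A1 0%N = A2 0%N.
    have := IHu 1%R; rewrite ltr01 lexx => /(_ isT).
    rewrite !expand ?ltr01 ?lexx//.
    under eq_eseriesr do rewrite pgf1 mul1e.
    under [in X in _ = X -> _]eq_eseriesr do rewrite pgf1 mul1e.
    rewrite shift; last by move=> b; exact: A_ge0.
    rewrite [in X in _ = X -> _]shift; last by move=> b; exact: A_ge0.
    rewrite (_ : \sum_(b <oo) mean P1 z1 (fill f j (point_mass b.+1)) =
                 \sum_(b <oo) mean P2 z2 (fill f j (point_mass b.+1))); last first.
      by apply: eq_eseriesr => b _; exact: AS.
    rewrite ![_ + \sum_(b <oo) _]addeC.
    apply: fin_addeI; rewrite ge0_fin_numE; last by apply: nneseries_ge0 => b _ _; exact: A_ge0.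
    apply: le_lt_trans (A_fin _ _ P2 _ mz2); rewrite [leRHS]shift; last first.
      by move=> b; exact: A_ge0.
    by rewrite leeDr// A_ge0.
  have -> : f = fill f j (point_mass a).
    by apply/funext => i; rewrite /fill; case: eqP => // ->.
  by case: a {fa} => [|a]; [exact: A0|exact: AS].
- apply: IH => // i si; have [?|[]] := fs i si; first by left.
  rewrite inE => /orP[/eqP ij|is2 ?]; last by right.
  by move: skip; rewrite -ij si.
Qed.

End determine.
End counts.

(** * From counts of finitely many sets to the law of a random measure *)

Section law_of_random_measures.
Local Open Scope ereal_scope.
Context {R : realType}.

Definition count_decode (z : nat) : \bar R := if z is k.+1 then k%:R%:E else +oo.

Definition counting_value (e : \bar R) := e = +oo \/ exists k : nat, e = k%:R%:E.

Lemma count_codeK e : counting_value e -> count_decode (count_code e) = e.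
Proof. by case=> [->|[k ->]]; rewrite ?count_codey ?count_code_nat. Qed.

Section transfer.
Context (I : Type) d (T : measurableType d).
Context d1 (Om1 : measurableType d1) (P1 : probability Om1 R).
Context d2 (Om2 : measurableType d2) (P2 : probability Om2 R).
Variables (X : I -> Om1 -> {measure set T -> \bar R}).
Variables (Y : I -> Om2 -> {measure set T -> \bar R}).
Hypothesis mX : forall i A, measurable A -> measurable_fun [set: Om1] (fun w => X i w A).
Hypothesis mY : forall i A, measurable A -> measurable_fun [set: Om2] (fun w => Y i w A).
Hypothesis cX : forall i w A, measurable A -> counting_value (X i w A).
Hypothesis cY : forall i w A, measurable A -> counting_value (Y i w A).

Let cylinder r (i : nat -> I) (A : nat -> set T) (C : nat -> set (\bar R)) :
    set (I -> {measure set T -> \bar R}) :=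
  [set m | forall j, (j < r)%N -> C j (m (i j) (A j))].

Let cylinders : set (set (I -> {measure set T -> \bar R})) :=
  [set E | exists r i A C, [/\ forall j, measurable (A j),
     forall j, measurable (C j) & E = cylinder r i A C]].

Let cylinders_setI : setI_closed cylinders.
Proof.
move=> _ _ [r [i [A [C [mA mC ->]]]]] [r' [i' [A' [C' [mA' mC' ->]]]]].
exists (r + r')%N, (fun j => if (j < r)%N then i j else i' (j - r)%N),
  (fun j => if (j < r)%N then A j else A' (j - r)%N),
  (fun j => if (j < r)%N then C j else C' (j - r)%N); split.
- by move=> j; case: ifP.
- by move=> j; case: ifP.
- apply/seteqP; split => [m [H H'] j jr|m H] /=.
    case: ifPn => [/H//|]; rewrite -leqNgt => rj.
    by apply: H'; rewrite -(ltn_add2l r) subnKC.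
  split => j jr.
    by have := H j (ltn_addr _ jr); rewrite jr.
  have := H (r + j)%N; rewrite ltn_add2l => /(_ jr).
  by rewrite ltnNge leq_addr /= addKn.
Qed.

Let cylinder_preimage d' (Om : measurableType d')
    (Z : I -> Om -> {measure set T -> \bar R}) r i A C :
  [set w | cylinder r i A C (Z ^~ w)] =
  \bigcap_(j in [set` iota 0 r]) ((fun w => Z (i j) w (A j)) @^-1` C j).
Proof.
apply/seteqP; split => w /= H j; first by rewrite /= mem_iota add0n => /H.
by move=> jr; apply: H; rewrite /= mem_iota.
Qed.

Let measurable_cylinder_preimage d' (Om : measurableType d')
    (Z : I -> Om -> {measure set T -> \bar R}) r i A C :
  (forall i A, measurable A -> measurable_fun [set: Om] (fun w => Z i w A)) ->
  (forall j, measurable (A j)) -> (forall j, measurable (C j)) ->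
  measurable [set w | cylinder r i A C (Z ^~ w)].
Proof.
move=> mZ mA mC; rewrite cylinder_preimage bigcap_seq.
apply: bigsetI_measurable => j _.
by rewrite -[X in measurable X]setTI; apply: mZ.
Qed.

Let cylinder_prob d' (Om : measurableType d') (P : probability Om R)
    (Z : I -> Om -> {measure set T -> \bar R}) r i A C :
  (forall i A, measurable A -> measurable_fun [set: Om] (fun w => Z i w A)) ->
  (forall i w A, measurable A -> counting_value (Z i w A)) ->
  (forall j, measurable (A j)) -> (forall j, measurable (C j)) ->
  P [set w | cylinder r i A C (Z ^~ w)] =
  \int[P]_w \prod_(j <- iota 0 r)
     (\1_(C j) (count_decode (count_code (Z (i j) w (A j)))))%:E.
Proof.
move=> mZ cZ mA mC; have mc := measurable_cylinder_preimage r i mZ mA mC.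
rewrite -[X in P X]setIT -integral_indic//; apply: eq_integral => w _.
rewrite indicE; case: (boolP (_ \in _)) => [/set_mem wc|wc] /=.
  rewrite big_seq big1// => j; rewrite mem_iota => /andP[_ jr].
  by rewrite count_codeK; [rewrite indicE mem_set//; exact: wc|exact: cZ].
have [j jr jC] : exists2 j, (j < r)%N & ~ C j (Z (i j) w (A j)).
  apply: contrapT => H; move/negP : wc; apply; apply/mem_set => j jr.
  by apply: contrapT => nC; apply: H; exists j.
rewrite (bigD1_seq j) ?mem_iota ?iota_uniq//=.
by rewrite count_codeK; [rewrite indicE memNset ?mul0e|exact: cZ].
Qed.

(** The events where finitely many evaluations lie in prescribed Borel sets form a
pi-system generating the evaluation sigma-algebra, and their probabilities are
means of products of functions of the codes. *)
Lemma same_law_pgf :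
  (forall r (i : nat -> I) (A : nat -> set T) (u : nat -> R),
     (forall j, measurable (A j)) -> (forall j, 0 < u j <= 1)%R ->
     \int[P1]_w \prod_(j <- iota 0 r) (pgf (u j) (count_code (X (i j) w (A j))))%:E =
     \int[P2]_w \prod_(j <- iota 0 r) (pgf (u j) (count_code (Y (i j) w (A j))))%:E) ->
  same_law P1 X P2 Y.
Proof.
move=> agree E evE.
pose H := [set E : set (I -> {measure set T -> \bar R}) |
  [/\ measurable [set w | E (X ^~ w)], measurable [set w | E (Y ^~ w)] &
      P1 [set w | E (X ^~ w)] = P2 [set w | E (Y ^~ w)]]].
suff : <<s cylinders >> `<=` H.
  move=> /(_ E) [|//]; move: evE; apply: sub_sigma_algebra2.
  - move=> _ [i _ [A mA [C mC <-]]].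
    exists 1%N, (fun=> i), (fun=> A), (fun=> C); split => //.
    rewrite setTI; apply/seteqP; split => [m Cm j _//|m /(_ 0%N)] /=.
    exact.
apply: lambda_system_subset => //; first split => //.
- by split; rewrite ?setT_prob//; [exact: measurableT|exact: measurableT|rewrite !probability_setT].
- move=> A B BA [mAX mAY AE] [mBX mBY BE].
  split; [exact: measurableD|exact: measurableD|].
  have fin d' (Om : measurableType d') (P : probability Om R) (U : set Om) :
      measurable U -> P U < +oo.
    by move=> mU; rewrite (le_lt_trans (probability_le1 P mU)) ?ltry.
  rewrite [LHS](measureD mAX mBX (fin _ _ P1 _ mAX)).
  rewrite [RHS](measureD mAY mBY (fin _ _ P2 _ mAY)).
  congr (_ - _)%E; first exact: AE.
  have IX : [set w | A (X ^~ w)] `&` [set w | B (X ^~ w)] = [set w | B (X ^~ w)].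
    by apply/setIidr => w /BA.
  have IY : [set w | A (Y ^~ w)] `&` [set w | B (Y ^~ w)] = [set w | B (Y ^~ w)].
    by apply/setIidr => w /BA.
  by rewrite IX IY.
- move=> F ndF HF.
  have mFX i : measurable [set w | F i (X ^~ w)] by have [] := HF i.
  have mFY i : measurable [set w | F i (Y ^~ w)] by have [] := HF i.
  have EX : [set w | (\bigcup_i F i) (X ^~ w)] = \bigcup_i [set w | F i (X ^~ w)].
    by [].
  have EY : [set w | (\bigcup_i F i) (Y ^~ w)] = \bigcup_i [set w | F i (Y ^~ w)].
    by [].
  split; [by rewrite EX; exact: bigcup_measurable|by rewrite EY; exact: bigcup_measurable|].
  have c1 := @nondecreasing_cvg_mu _ _ _ P1 _ mFX (bigcup_measurable (fun i _ => mFX i)).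
  have c2 := @nondecreasing_cvg_mu _ _ _ P2 _ mFY (bigcup_measurable (fun i _ => mFY i)).
  have nd1 : nondecreasing_seq (fun i => [set w | F i (X ^~ w)]).
    by move=> n m nm; apply/subsetPset => w /=; have /subsetPset := ndF _ _ nm; exact.
  have nd2 : nondecreasing_seq (fun i => [set w | F i (Y ^~ w)]).
    by move=> n m nm; apply/subsetPset => w /=; have /subsetPset := ndF _ _ nm; exact.
  rewrite EX EY -(cvg_lim _ (c1 nd1))// -(cvg_lim _ (c2 nd2))//.
  by congr (limn _); apply/funext => n /=; have [] := HF n.
- move=> _ [r [i [A [C [mA mC ->]]]]]; split.
  + exact: measurable_cylinder_preimage.
  + exact: measurable_cylinder_preimage.
  + rewrite !cylinder_prob//.
    apply: (@pgf_determines_law R _ _ P1 _ _ P2 nat (iota 0 r) (iota_uniq _ _)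
      (fun j w => count_code (X (i j) w (A j))) (fun j w => count_code (Y (i j) w (A j)))
      _ _ _ (fun j z => (\1_(C j) (count_decode z))%:E)).
    * by move=> j _; apply: (measurable_count_code (mX _ _)).
    * by move=> j _; apply: (measurable_count_code (mY _ _)).
    * by move=> u u01; exact: agree.
    * by move=> j a; rewrite lee_fin.
Qed.

End transfer.

Section exhaustion.
Variables (I : choiceType) (S : nat -> seq I).
Hypotheses (uS : forall n, uniq (S n))
  (ndS : forall n m, (n <= m)%N -> {subset S n <= S m}).

Let le_sum_sub (a : I -> \bar R) (s t : seq I) : uniq s -> uniq t ->
  (forall l, 0 <= a l) -> (forall l, l \in s -> a l != 0 -> l \in t) ->
  \sum_(l <- s) a l <= \sum_(l <- t) a l.
Proof.
move=> us ut a0 st.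
have -> : \sum_(l <- s) a l = \sum_(l <- [seq l <- s | l \in t]) a l.
  rewrite big_filter [RHS]big_mkcond/= big_seq [RHS]big_seq.
  apply: eq_bigr => l ls; case: ifPn => // lt.
  by apply/eqP; apply: contraNT lt => /(st _ ls).
have -> : \sum_(l <- [seq l <- s | l \in t]) a l = \sum_(l <- t | l \in s) a l.
  rewrite -[RHS]big_filter; apply: perm_big; apply: uniq_perm; rewrite ?filter_uniq//.
  by move=> l; rewrite !mem_filter andbC.
rewrite -[leLHS](eq_bigl _ _ (fun l => andTb (l \in s))).
exact: lee_sum_nneg.
Qed.

(** Sums along growing finite sets need only exhaust the support; this allows
random exhausting sets that contain the existing atoms only. *)
Lemma esum_exhaust (a : I -> \bar R) : (forall l, 0 <= a l) ->
  (forall l, a l != 0 -> exists n, l \in S n) ->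
  \sum_(l <- S n) a l @[n --> \oo] --> \esum_(l in [set: I]) a l.
Proof.
move=> a0 cov; have nd : nondecreasing_seq (fun n => \sum_(l <- S n) a l).
  by move=> n m nm; apply: le_sum_sub => // l ls _; exact: (ndS nm).
have := ereal_nondecreasing_cvgn nd; set x := ereal_sup _.
suff -> : x = \esum_(l in [set: I]) a l by [].
apply/eqP; rewrite eq_le; apply/andP; split.
  apply: ge_ereal_sup => _ [n _ <-]; apply: esum_ge; exists [set` S n].
    by split => //; exact: finite_seq.
  by rewrite -fsbig_seq.
have le_x (r : seq I) : uniq r -> \sum_(l <- r) a l <= x.
  move=> ur; have [n Hn] : exists n, forall l, l \in r -> a l != 0 -> l \in S n.
    elim: r {ur} => [|l s [n IH]]; first by exists 0%N.
    have [al|al] := eqVneq (a l) 0.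
      exists n => l'; rewrite inE => /orP[/eqP ->|]; first by rewrite al eqxx.
      exact: IH.
    have [m lm] := cov _ al; exists (maxn n m) => l'.
    rewrite inE => /orP[/eqP -> _|l's al'].
      by apply: (ndS (leq_maxr _ _)).
    by apply: (ndS (leq_maxl _ _)); exact: IH.
  apply: (@le_trans _ _ (\sum_(l <- S n) a l)).
    by apply: le_sum_sub.
  by apply: ereal_sup_ubound; exists n.
apply: ge_ereal_sup => _ [A [finA _] <-]; rewrite fsbig_finite//=.
exact: (le_x _ (finmap.fset_uniq _)).
Qed.

End exhaustion.

(** A nondecreasing sequence of integers is eventually constant or tends to
infinity. *)
Lemma nat_limit (N_ : nat -> nat) (e : \bar R) :
  {homo N_ : n m / (n <= m)%N} -> (N_ n)%:R%:E @[n --> \oo] --> e ->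
  (exists k, e = k%:R%:E /\ \forall n \near \oo, N_ n = k) \/
  (e = +oo /\ (N_ n @[n --> \oo] --> \oo)).
Proof.
move=> nd cN; have [[M NM]|unb] := pselect (exists M, forall n, (N_ n <= M)%N).
  left; pose Pk k := `[< exists n, N_ n = k >].
  have Pex : exists k, Pk k by exists (N_ 0%N); apply/asboolP; exists 0%N.
  have Pub k : Pk k -> (k <= M)%N by move=> /asboolP[n <-].
  have [k /asboolP[n0 Nk] kmax] := ex_maxnP Pex Pub.
  have near_k : \forall n \near \oo, N_ n = k.
    exists n0 => // n /= n0n; apply/eqP; rewrite eqn_leq -{2}Nk nd// andbT.
    by apply: kmax; apply/asboolP; exists n.
  exists k; split => //; apply/esym; apply: (cvg_unique _ _ cN) => //.
  apply: cvg_near_cst; apply: filterS near_k => n -> //.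
right; have Noo : N_ n @[n --> \oo] --> \oo.
  apply/cvgnyPge => A.
  have [n0 An0] : exists n0, (A <= N_ n0)%N.
    apply: contrapT => H; apply: unb; exists A => n.
    by rewrite leqNgt; apply/negP => /ltnW AN; apply: H; exists n.
  by exists n0 => // n /= /nd; exact: leq_trans.
split => //; apply: (cvg_unique _ cN) => //.
exact/cvgenyP.
Qed.

Lemma nat_limit_counting (N_ : nat -> nat) (e : \bar R) :
  {homo N_ : n m / (n <= m)%N} -> (N_ n)%:R%:E @[n --> \oo] --> e ->
  counting_value e.
Proof.
move=> nd cN; have [[k [-> _]]|[-> _]] := nat_limit nd cN; last by left.
by right; exists k.
Qed.

Lemma pgf_limit (N_ : nat -> nat) (e : \bar R) (u : R) :
  {homo N_ : n m / (n <= m)%N} -> (N_ n)%:R%:E @[n --> \oo] --> e ->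
  (0 <= u <= 1)%R -> (u ^+ N_ n)%:E @[n --> \oo] --> (pgf u (count_code e))%:E.
Proof.
move=> nd cN /andP[u0 u1]; have [[k [-> nk]]|[-> Noo]] := nat_limit nd cN.
  rewrite count_code_nat /=; apply: cvg_near_cst.
  by apply: filterS nk => n ->.
rewrite count_codey /=; have [->|un1] := eqVneq u 1%R.
  by under eq_fun do rewrite expr1n; exact: cvg_cst.
apply/cvg_EFin; first by apply: nearW.
have : (GRing.exp u) @ \oo --> (0 : R)%R.
  by apply: cvg_expr; rewrite ger0_norm// lt_neqAle un1.
by move=> /(cvg_comp _ _ Noo).
Qed.

End law_of_random_measures.

(** * Generating functions of the counts of a random atomic measure *)

(** A name for integer weights, so that statements about them do not carry proofs
of nonnegativity. *)
Definition nat_weight (R : realType) (k : nat) : {nonneg R} := k%:R%:nng.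

Section atomic_counts.
Local Open Scope ereal_scope.
Context {R : realType} (I : choiceType) d (T : measurableType d).

Section exhausting.
Variables (S : nat -> seq I).
Hypotheses (uS : forall n, uniq (S n))
  (ndS : forall n m, (n <= m)%N -> {subset S n <= S m}).
Variables (x : I -> nat) (loc : I -> T).
Hypothesis cov : forall l, x l != 0%N -> exists n, l \in S n.

Let mass (B : set T) : \bar R := atomic (fun l => (x l)%:R%:nng%R) loc B.

Let count (B : set T) n := (\sum_(l <- S n) (loc l \in B) * x l)%N.

Let term_natr (B : set T) l :
  ((x l)%:R%:nng%R : {nonneg R})%:num%:E * \d_(loc l) B =
  ((loc l \in B) * x l)%:R%:E.
Proof. by rewrite diracE -EFinM natrM mulrC. Qed.

Let count_nd B : {homo count B : n m / (n <= m)%N}.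
Proof.
move=> n m nm; rewrite /count.
rewrite [leqRHS](bigID (fun l => l \in S n))/=.
apply: leq_trans (leq_addr _ _).
rewrite -[leqRHS]big_filter [leqRHS](perm_big (S n))//.
apply: uniq_perm; [by rewrite filter_uniq|by []|] => l; rewrite mem_filter.
by have [ln|//] := boolP (l \in S n); rewrite (ndS nm ln).
Qed.

Let count_cvg B : (count B n)%:R%:E @[n --> \oo] --> mass B.
Proof.
have := @esum_exhaust R I S uS ndS
  (fun l => ((x l)%:R%:nng%R : {nonneg R})%:num%:E * \d_(loc l) B).
move=> /(_ _ _); rewrite -/(mass B); under eq_fun => n.
  under eq_bigr do rewrite term_natr.
  rewrite sumEFin -natr_sum.
  over.
apply => [l|l]; rewrite term_natr ?lee_fin//.
rewrite eqe pnatr_eq0 muln_eq0 negb_or => /andP[_]; exact: cov.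
Qed.

Lemma atomic_counting_value B : counting_value (mass B).
Proof. exact: nat_limit_counting (@count_nd B) (@count_cvg B). Qed.

Lemma atomic_pgf_cvg B (u : R) : (0 <= u <= 1)%R ->
  (\prod_(l <- S n) (if loc l \in B then u ^+ x l else 1))%:E @[n --> \oo] -->
  (pgf u (count_code (mass B)))%:E.
Proof.
move=> u01; have := pgf_limit (@count_nd B) (@count_cvg B) u01.
suff -> : (fun n => (u ^+ count B n)%:E) =
  (fun n => (\prod_(l <- S n) (if loc l \in B then u ^+ x l else 1))%:E) by [].
apply/funext => n; congr EFin; rewrite /count.
elim: (S n) => [|l s IH]; first by rewrite !big_nil.
rewrite !big_cons exprD IH; congr (_ * _)%R.
by case: ifP; rewrite ?mul1n ?mul0n.
Qed.

End exhausting.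

(** Exchanging the two products turns powers of counts of sets into a product with
one factor per atom. *)
Lemma atomic_joint_pgf_cvg (S : nat -> seq I) (A : Type) (x : A -> I -> nat)
    (loc : I -> T) (r : seq nat) (i : nat -> A) (B : nat -> set T) (u : nat -> R) :
  (forall n, uniq (S n)) ->
  (forall n m, (n <= m)%N -> {subset S n <= S m}) ->
  (forall a l, x a l != 0%N -> exists n, l \in S n) ->
  (forall j, 0 <= u j <= 1)%R ->
  (\prod_(l <- S n) \prod_(j <- r)
     (if loc l \in B j then u j ^+ x (i j) l else 1))%:E @[n --> \oo] -->
  \prod_(j <- r) (pgf (u j) (count_code
     (atomic (fun l => (x (i j) l)%:R%:nng%R : {nonneg R}) loc (B j))))%:E.
Proof.
move=> uS ndS cov u01; under eq_fun do rewrite exchange_big.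
pose P (q : seq nat) :=
  (\prod_(j <- q) \prod_(l <- S n)
     (if loc l \in B j then u j ^+ x (i j) l else 1))%:E @[n --> \oo] -->
  \prod_(j <- q) (pgf (u j) (count_code
     (atomic (fun l => nat_weight R (x (i j) l)) loc (B j))))%:E.
suff : P r by [].
elim: r => [|j r IH]; rewrite /P.
  under eq_fun do rewrite big_nil.
  by rewrite big_nil; exact: cvg_cst.
under eq_fun do rewrite big_cons EFinM.
rewrite big_cons; apply: cvgeM => //.
  by rewrite prodEFin mule_def_fin.
by apply: atomic_pgf_cvg => // l; exact: cov.
Qed.

End atomic_counts.

Lemma measurable_atomic (R : realType) (I : choiceType) d (T : measurableType d)
    d' (Om : measurableType d') (S : nat -> seq I)
    (x : I -> Om -> nat) (loc : I -> Om -> T) (B : set T) :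
  (forall n, uniq (S n)) ->
  (forall n m, (n <= m)%N -> {subset S n <= S m}) ->
  (forall l, exists n, l \in S n) ->
  (forall l, measurable_fun [set: Om] (x l)) ->
  (forall l, measurable_fun [set: Om] (loc l)) -> measurable B ->
  measurable_fun [set: Om]
    (fun w => atomic (fun l => (x l w)%:R%:nng%R : {nonneg R}) (loc ^~ w) B).
Proof.
move=> uS ndS cov mx mloc mB.
apply: (emeasurable_fun_cvg (fun n w => (\sum_(l <- S n)
    ((x l w)%:R%:nng%R : {nonneg R})%:num%:E * \d_(loc l w) B)%E)).
  move=> n; apply: emeasurable_sum => l; apply: emeasurable_funM.
    have mn : measurable_fun [set: nat] (fun k : nat => (k%:R : R)%:E) by [].
    exact: (measurableT_comp mn (mx l)).
  under eq_fun do rewrite diracE.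
  rewrite (_ : (fun _ => _) = EFin \o \1_(loc l @^-1` B)).
    apply/measurable_EFinP; apply: measurable_indic.
    by rewrite -[X in measurable X]setTI; exact: mloc.
  by apply/funext => w /=; rewrite indicE.
move=> w _; apply: esum_exhaust => // l.
by rewrite mule_ge0.
Qed.

(** An integer recording which of the [B j], [j < r], contain [t]. *)
Definition pattern_code (T : Type) (r : nat) (B : nat -> set T) (t : T) : nat :=
  pickle [seq t \in B j | j <- iota 0 r].

(** The base to which an atom whose location has pattern [b] contributes a power at
step [a]: the product of the [u j] over the indices [j] that concern step [a] and
whose set contains the location. *)
Definition pattern_base (R : realType) (A : eqType) (r : nat) (i : nat -> A)
    (u : nat -> R) (a : A) (b : nat) : R :=
  \prod_(j <- iota 0 r | i j == a)
    (if nth false (odflt [::] (unpickle b)) j then u j else 1).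

Lemma pattern_base_code (R : realType) (T : Type) (A : finType) r (i : nat -> A)
    (B : nat -> set T) (u : nat -> R) (x : A -> nat) (t : T) :
  \prod_(j <- iota 0 r) (if t \in B j then u j ^+ x (i j) else 1) =
  \prod_(a : A) pattern_base r i u a (pattern_code r B t) ^+ x a.
Proof.
rewrite (partition_big i predT)//=; apply: eq_bigr => a _.
rewrite /pattern_base -prodrXl big_seq_cond [RHS]big_seq_cond.
apply: eq_bigr => j /andP[]; rewrite mem_iota add0n => /andP[_ jr] /eqP <-.
rewrite /pattern_code. rewrite pickleK/= (nth_map 0%N) ?size_iota// nth_iota// add0n.
by case: ifP; rewrite ?expr1n.
Qed.

Lemma pattern_base_itv (R : realType) (A : eqType) r (i : nat -> A) (u : nat -> R) a b :
  (forall j, 0 < u j <= 1) -> 0 < pattern_base r i u a b <= 1.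
Proof.
move=> u01; rewrite /pattern_base; elim: (iota 0 r) => [|j s /andP[IH0 IH1]].
  by rewrite big_nil ltr01 lexx.
have /andP[u0 u1] := u01 j; rewrite big_cons; case: ifP => _; last by rewrite IH0.
case: ifP => _; last by rewrite mul1r IH0.
by rewrite mulr_gt0//= mulr_ile1// ltW.
Qed.

Lemma measurable_pattern_code d (T : measurableType d) r (B : nat -> set T) :
  (forall j, measurable (B j)) -> measurable_fun [set: T] (pattern_code r B).
Proof.
move=> mB; have mv (s : seq nat) (v : seq bool) :
    measurable [set t | [seq t \in B j | j <- s] = v].
  elim: s v => [|j s IH] [|b v].
  - by rewrite (_ : [set _ | _] = setT)//; apply/seteqP; split.
  - by rewrite (_ : [set _ | _] = set0)//; apply/seteqP; split.
  - by rewrite (_ : [set _ | _] = set0)//; apply/seteqP; split.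
  rewrite (_ : [set _ | _] = (if b then B j else ~` B j) `&`
      [set t | [seq t \in B j | j <- s] = v]).
    by apply: measurableI => //; case: b => //; exact: measurableC.
  apply/seteqP; split => t /=.
    by move=> [<- <-]; split => //; case: ifPn => [/set_mem//|/negP tB /mem_set].
  by move=> [tB <-]; congr (_ :: _); case: b tB => tB; [exact: mem_set|exact: memNset].
apply: measurable_nat_fibers => a.
have [[v va]|nv] := pselect (exists v : seq bool, pickle v = a).
  have <- : [set t | [seq t \in B j | j <- iota 0 r] = v] =
      pattern_code r B @^-1` [set a]; last exact: mv.
  apply/seteqP; split => [t tv|t]; rewrite -va.
    exact: (congr1 pickle tv).
  exact: (pcan_inj pickleK).
have -> : pattern_code r B @^-1` [set a] = set0; last exact: measurable0.
by apply/seteqP; split => [t ta|//]; apply: nv; eexists; exact: ta.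
Qed.

(** * Independence, Poisson variables and Poisson processes seen through finitely many classes *)

Section independent_codes.
Local Open Scope ereal_scope.
Context d (Om : measurableType d) {R : realType}.

Lemma integral_nat_comp (mu : {measure set Om -> \bar R}) (E : set Om)
    (z : Om -> nat) (g : nat -> \bar R) : measurable E ->
  measurable_fun [set: Om] z -> (forall a, 0 <= g a) ->
  \int[mu]_(w in E) g (z w) = \sum_(a <oo) mu (E `&` z @^-1` [set a]) * g a.
Proof.
move=> mE mz g0; under eq_integral do rewrite (point_mass_expand g0).
rewrite integral_nneseries//; last 2 first.
- move=> a; apply: measurable_funeM; apply: measurable_funTS.
  exact: (measurableT_comp (f := point_mass a)).
- by move=> a w _; rewrite mule_ge0// point_mass_ge0.
apply: eq_eseriesr => a _; rewrite ge0_integralZl//; last 2 first.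
- by apply: measurable_funTS; exact: (measurableT_comp (f := point_mass a)).
- by move=> w _; exact: point_mass_ge0.
rewrite muleC; congr (_ * _).
transitivity (\int[mu]_(w in E) (\1_(z @^-1` [set a]) w)%:E).
  apply: eq_integral => w _; rewrite /point_mass indicE eq_sym; congr (_%:R%:E).
  by congr nat_of_bool; apply/idP/idP => [/eqP zw|/set_mem ->//]; apply/mem_set.
have mfib := measurable_fiber a mz.
by rewrite (integral_indic mu mE mfib) setIC.
Qed.

Lemma independent_expectation (P : probability Om R) (J : choiceType)
    (s : seq J) (z : J -> Om -> nat) (f : J -> nat -> \bar R) :
  uniq s -> (forall j, j \in s -> measurable_fun [set: Om] (z j)) ->
  (forall a : J -> nat,
     P (\bigcap_(j in [set` s]) (z j @^-1` [set a j])) =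
     \prod_(j <- s) P (z j @^-1` [set a j])) ->
  nonneg_slots f ->
  \int[P]_w \prod_(j <- s) f j (z j w) =
  \prod_(j <- s) \int[P]_w f j (z j w).
Proof.
move=> us mz ind f0.
pose Psi (f : J -> nat -> \bar R) :=
  \prod_(j <- s) \sum_(a <oo) P (z j @^-1` [set a]) * f j a.
transitivity (Psi f); last first.
  apply: eq_big_seq => j js; rewrite integral_nat_comp//; last exact: mz.
  by apply: eq_eseriesr => a _; rewrite setTI.
have mass j a : j \in s -> \sum_(b <oo) P (z j @^-1` [set b]) * point_mass a b =
    P (z j @^-1` [set a]).
  by move=> js; rewrite point_mass_series.
have := @joint_expectation_ext _ Om R P setT measurableT J s us z mz (cst 1) _ _ Psi.
move=> /(_ _ _ _ _ f f0) <-//.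
- by apply: eq_integral => w _; rewrite mul1e.
- move=> j js; apply: (additive_prod (Xi := fun j (f : J -> nat -> \bar R) =>
    \sum_(a <oo) P (z j @^-1` [set a]) * f j a) us js).
  + by apply: additive_series => a.
  + by move=> i g g0; apply: nneseries_ge0 => a _ _; rewrite mule_ge0// g0.
  + by move=> i g g' _ ij; rewrite fill_neq.
- move=> g a g0 ga; rewrite setTI integral_cst//; last exact: measurable_fibers.
  rewrite mul1e; apply: etrans; first exact: (ind a).
  apply: eq_big_seq => j js.
  by rewrite ga// mass.
Qed.

End independent_codes.

Section poisson_pgf.
Local Open Scope ereal_scope.
Context {R : realType}.

(** The rate [0] is included, where the Poisson law is the point mass at [0]. *)
Lemma poisson_pgfE (r u : R) : (0 <= r)%R -> (0 <= u)%R ->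
  \sum_(k <oo) poisson_prob r 0 [set k] * (u ^+ k)%:E = (expR (- (r * (1 - u))))%:E.
Proof.
move=> r0 u0; rewrite /poisson_prob; have [rp|] := ltP 0%R r; last first.
  move=> r_le0; have -> : r = 0%R by apply/eqP; rewrite eq_le r_le0.
  rewrite mul0r oppr0 expR0 (nneseries_single (a := 0%N)).
  - by rewrite expr0 mule1 diracE mem_set.
  - by move=> n n0; rewrite diracE memNset ?mul0e// => /= /esym/eqP; rewrite (negbTE n0).
  - by rewrite mule_ge0// lee_fin exprn_ge0.
under eq_eseriesr => k _.
  rewrite esum_set1 ?lee_fin ?poisson_pmf_ge0// -EFinM /poisson_pmf rp.
  rewrite mulrAC mulrC (mulrAC _ _ (u ^+ k)%R) -exprMn EFinM; over.
rewrite nneseriesZle ?lee_fin ?expR_ge0//; last first.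
  by move=> k; rewrite lee_fin mulr_ge0// exprn_ge0// mulr_ge0.
have -> : \sum_(k <oo) ((r * u) ^+ k * k`!%:R^-1)%:E = (expR (r * u))%:E.
  rewrite expRE -EFin_lim; last first.
    rewrite /pseries/=; under eq_fun do rewrite mulrC.
    exact: is_cvg_series_exp_coeff.
  apply/congr_lim/funext => n/=; rewrite /pseries/= /series/= -sumEFin//.
  by apply: eq_bigr => i _; rewrite mulrC.
by rewrite -EFinM -expRD; congr (expR _)%:E; rewrite mulrBr mulr1 opprB addrC.
Qed.

End poisson_pgf.

Lemma prod_in_unit (R : realDomainType) (I : Type) (s : seq I) (f : I -> R) :
  (forall i, 0 <= f i <= 1) -> 0 <= \prod_(i <- s) f i <= 1.
Proof.
move=> f01; elim: s => [|i s /andP[IH0 IH1]]; first by rewrite big_nil ler01 lexx.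
by have /andP[f0 f1] := f01 i; rewrite big_cons mulr_ge0//= mulr_ile1.
Qed.

Section simple_laplace.
Local Open Scope ereal_scope.
Context {R : realType} d (Om : measurableType d) (P : probability Om R).
Context dT (T : measurableType dT) (mu : {measure set T -> \bar R}).
Variables (p : nat -> Om -> T) (K : nat) (xi : 'I_K -> Om -> R).
Variable F : 'I_K -> probability R R.

Let M (w : Om) : {measure set T -> \bar R} :=
  atomic (fun=> 1%:nng%R : {nonneg R}) (fun k => p k w).

Hypothesis mp : forall k, measurable_fun [set: Om] (p k).
Hypothesis mxi : forall k, measurable_fun [set: Om] (xi k).
Hypothesis xiF : forall k B, measurable B -> P (xi k @^-1` B) = F k B.
Hypothesis PP : poisson_process P M mu.
Hypothesis ind : mutually_independent P (fun o : option 'I_K =>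
  if o is Some k then sigma_of (xi k) else sigma_of_random_measure M).

Section simple.
Variables (m : nat) (i : T -> nat) (v : nat -> R).
Hypotheses (mi : measurable_fun [set: T] i) (im : forall t, (i t < m)%N)
  (v01 : forall a, (0 <= v a <= 1)%R).
Hypothesis finv : \int[mu]_t (1 - v (i t))%:E < +oo.

Let D := [seq a <- iota 0 m | v a != 1%R].
Let B a := i @^-1` [set a].
Let z a w := count_code (M w (B a)).

Let uD : uniq D. Proof. by rewrite filter_uniq// iota_uniq. Qed.

Let mB a : measurable (B a). Proof. exact: measurable_fiber. Qed.

Let unit_weight : (fun=> 1%:nng%R) = (fun=> nat_weight R 1) :> (nat -> {nonneg R}).
Proof. by apply/funext => l; apply/val_inj. Qed.

Let M_counting w A : counting_value (M w A).
Proof.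
rewrite /M unit_weight.
apply: (@atomic_counting_value R nat _ T (fun n => iota 0 n)
  (fun n => iota_uniq 0 n) _ (fun=> 1%N) (fun k => p k w) _ A).
- by move=> n n' nn' a; rewrite !mem_iota => /andP[_ an]; rewrite (leq_trans an).
- by move=> l _; exists l.+1; rewrite mem_iota/= add0n.
Qed.

Let mM A : measurable A -> measurable_fun [set: Om] (fun w => M w A).
Proof. by case: PP => -[mM _] _ _; exact: mM. Qed.

Let mz a : measurable_fun [set: Om] (z a).
Proof. by apply: measurable_count_code; exact: mM. Qed.

Let pgf_cvg w : (\prod_(l < n) v (i (p l w)))%:E @[n --> \oo] -->
  \prod_(a <- D) (pgf (v a) (z a w))%:E.
Proof.
have := @atomic_joint_pgf_cvg R nat _ T (fun n => iota 0 n) unit (fun _ _ => 1%N)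
  (fun k => p k w) D (fun=> tt) B v (fun n => iota_uniq 0 n) _ _ _.
rewrite /z /M unit_weight.
have -> : (fun n => (\prod_(l <- iota 0 n) \prod_(j <- D)
      (if p l w \in B j then v j ^+ 1 else 1))%R%:E) =
    (fun n => (\prod_(l < n) v (i (p l w)))%:E).
  apply/funext => n; congr EFin.
  rewrite -(big_mkord xpredT (fun l => v (i (p l w)))) /index_iota subn0.
  apply: eq_bigr => l _.
  have [vi1|vi1] := eqVneq (v (i (p l w))) 1%R.
    rewrite vi1 big_seq big1// => a; rewrite mem_filter => /andP[va _].
    case: ifPn => // /set_mem ia; move: va; rewrite -ia vi1 eqxx //.
  have iD : i (p l w) \in D by rewrite mem_filter vi1 mem_iota add0n im.
  rewrite (bigD1_seq (i (p l w)))//= mem_set// expr1 big1 ?mulr1// => a ai.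
  by rewrite memNset// => ia; rewrite ia eqxx in ai.
apply.
- by move=> n n' nn' a; rewrite !mem_iota => /andP[_ an]; rewrite (leq_trans an).
- by move=> _ l _; exists l.+1; rewrite mem_iota/= add0n.
- exact: v01.
Qed.

Let fiber_fin a : v a != 1%R -> mu (B a) < +oo.
Proof.
move=> va; have va0 : (0 < 1 - v a)%R.
  by rewrite subr_gt0 lt_neqAle va; have /andP[_ ->] := v01 a.
have : mu (B a) * (1 - v a)%:E < +oo.
  apply: le_lt_trans finv.
  rewrite (integral_nat_comp mu measurableT mi (g := fun a => (1 - v a)%:E)); last first.
    by move=> b; rewrite lee_fin subr_ge0; have /andP[] := v01 b.
  rewrite (nneseriesD1 (n := a))//; last first.
    by move=> b _; rewrite mule_ge0// lee_fin subr_ge0; have /andP[] := v01 b.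
  rewrite setTI leeDl//; apply: nneseries_ge0 => b _ _.
  by rewrite mule_ge0// lee_fin subr_ge0; have /andP[] := v01 b.
have : 0 <= mu (B a) by [].
by case: (mu (B a)) => [x||]//; rewrite ?ltry// mulyr gtr0_sg// mul1e.
Qed.

Let mean_pgf a : v a != 1%R ->
  \int[P]_w (pgf (v a) (z a w))%:E = (expR (- (fine (mu (B a)) * (1 - v a))))%:E.
Proof.
move=> va; have /andP[va0 _] := v01 a.
rewrite (integral_nat_comp P measurableT (mz a) (g := fun k => (pgf (v a) k)%:E)); last first.
  by move=> k; rewrite lee_fin pgf_ge0.
rewrite nneseries_recl//; last by move=> k _; rewrite mule_ge0// lee_fin pgf_ge0.
rewrite /= (negbTE va) mule0 add0e -nneseries_addn; last first.
  by move=> k; rewrite mule_ge0// lee_fin pgf_ge0.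
rewrite -poisson_pgfE// ?fine_ge0//; apply: eq_eseriesr => k _.
rewrite addn1 setTI /=; congr (_ * _); case: PP => _ pois _.
rewrite -pois//; last exact: fiber_fin.
by congr (P _); apply/seteqP; split => w /=; rewrite /z count_code_eqS.
Qed.

(** For a function [v o i] with finitely many values, the product over the points
is the product over the classes [a] of [v a] to the power of the number of points
in the class [i = a].  Classes with [v a = 1] are dropped, since they may have
infinite mass; the others have finite mass and independent Poisson numbers. *)
Lemma simple_laplace (v' : 'I_K -> nat -> R) (i' : 'I_K -> R -> nat) :
  (forall k, measurable_fun [set: R] (i' k)) ->
  (forall k a, (0 <= v' k a <= 1)%R) ->
  \int[P]_w ((\prod_k v' k (i' k (xi k w))) * \prod_(l < n) v (i (p l w)))%:E
    @[n --> \oo] -->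
  (\prod_k \int[F k]_t (v' k (i' k t))%:E) *
  (expR (- fine (\int[mu]_t (1 - v (i t))%:E)))%:E.
Proof.
move=> mi' v'01.
pose J := ('I_K + nat)%type.
pose s : seq J := [seq inl k | k <- enum 'I_K] ++ [seq inr a | a <- D].
pose Z (j : J) := match j with inl k => i' k \o xi k | inr a => z a end.
pose f (j : J) : nat -> \bar R := match j with
  | inl k => fun b => (v' k b)%:E | inr a => fun b => (pgf (v a) b)%:E end.
have us : uniq s.
  rewrite cat_uniq map_inj_uniq ?enum_uniq; last by move=> ? ? [].
  rewrite map_inj_uniq ?uD; last by move=> ? ? [].
  rewrite andbT; apply/hasPn => _ /mapP[a _ ->]; apply/negP => /mapP[k _] //.
have mZ j : measurable_fun [set: Om] (Z j).
  by case: j => [k|a]; [exact: measurableT_comp|exact: mz].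
have f0 : nonneg_slots f.
  case=> [k|a] b; rewrite lee_fin; first by have /andP[] := v'01 k b.
  by apply: pgf_ge0; have /andP[] := v01 a.
have split_s (g : J -> \bar R) :
    \prod_(j <- s) g j = (\prod_k g (inl k)) * \prod_(a <- D) g (inr a).
  by rewrite big_cat; congr (_ * _); rewrite big_map// big_enum.
have Zind a : P (\bigcap_(j in [set` s]) (Z j @^-1` [set a j])) =
    \prod_(j <- s) P (Z j @^-1` [set a j]).
  pose A (o : option 'I_K) := if o is Some k then Z (inl k) @^-1` [set a (inl k)]
    else \bigcap_(b in [set` D]) (z b @^-1` [set a (inr b)]).
  have uo : uniq (None :: [seq Some k | k <- enum 'I_K]).
    rewrite /= map_inj_uniq ?enum_uniq ?andbT; last by move=> ? ? [].
    by apply/mapP => -[].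
  have fA o : o \in None :: [seq Some k | k <- enum 'I_K] ->
      (if o is Some k then sigma_of (xi k) else sigma_of_random_measure M) (A o).
    case: o => [k|] _ /=.
      exists (i' k @^-1` [set a (inl k)]); first exact: measurable_fiber.
      by rewrite setTI.
    have sM b : sigma_of_random_measure M (z b @^-1` [set a (inr b)]).
      apply: sub_sigma_algebra; exists (B b) => //.
      exists (@count_code R @^-1` [set a (inr b)]); last by rewrite setTI.
      rewrite -[X in measurable X]setTI.
      exact: (measurable_count_code (@measurable_id _ _ setT)).
    apply: (@g_sigma_bigcap_seq Om _ nat D) => b _; exact: sM.
  have := ind uo fA; rewrite big_cons big_map big_enum/= => indA.
  rewrite split_s muleC.
  transitivity (P (\bigcap_(o in [set` None :: [seq Some k | k <- enum 'I_K]]) A o)).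
    congr (P _); apply/seteqP; split => w H.
      move=> [k|] /= _; first by apply: (H (inl k)); rewrite /= mem_cat map_f// mem_enum.
      by move=> b /= bD; apply: (H (inr b)); rewrite /= mem_cat map_f ?orbT.
    move=> [k|b] /=; rewrite mem_cat => bs.
      by apply: (H (Some k)); rewrite /= inE map_f// mem_enum.
    apply: (H None _ b); rewrite /= ?inE//.
    by case/orP: bs => /mapP[c cD] // [->].
  rewrite indA; congr (_ * _).
  case: PP => -[_ CR] _ _.
  have tB : trivIset setT B.
    apply/trivIsetP => b b' _ _ /eqP bb'; apply/seteqP; split => // t [itb itb'].
    by apply: bb'; rewrite -itb -itb'.
  have := CR B mB tB D (fun b => z b @^-1` [set a (inr b)]) uD; apply => b bD.
  exists (@count_code R @^-1` [set a (inr b)]); last by rewrite setTI.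
  rewrite -[X in measurable X]setTI.
  exact: (measurable_count_code (@measurable_id _ _ setT)).
have E := independent_expectation us (fun j _ => mZ j) Zind f0.
have lim : \int[P]_w ((\prod_k v' k (i' k (xi k w))) * \prod_(l < n) v (i (p l w)))%:E
    @[n --> \oo] --> \int[P]_w \prod_(j <- s) f j (Z j w).
  apply: bounded_cvg_integral => [n|n w|w].
  - apply/measurable_EFinP; apply: measurable_funM.
      apply: measurable_prod => k _.
      exact: (measurableT_comp (f := v' k) _ (mZ (inl k))).
    apply: measurable_prod => l _.
    apply: (measurableT_comp (f := v)) => //.
    exact: (measurableT_comp mi (mp l)).
  - have /andP[a0 a1] := prod_in_unit (enum 'I_K) (fun k => v'01 k (i' k (xi k w))).
    have /andP[b0 b1] := prod_in_unit (enum 'I_n) (fun l => v01 (i (p l w))).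
    rewrite big_enum/= in a0 a1; rewrite big_enum/= in b0 b1.
    by rewrite !lee_fin mulr_ge0//= mulr_ile1.
  - under eq_fun do rewrite EFinM.
    rewrite split_s /= [X in X * _]prodEFin; apply: cvgeZl => //.
rewrite (_ : _ * _ = \int[P]_w \prod_(j <- s) f j (Z j w))// E split_s.
congr (_ * _).
  apply: eq_bigr => k _ /=.
  rewrite (integral_nat_comp P measurableT (mZ (inl k)) (f0 (inl k))).
  rewrite (integral_nat_comp (F k) measurableT (mi' k) (f0 (inl k))).
  apply: eq_eseriesr => a _; congr (_ * _); rewrite !setTI.
  exact: (esym (xiF k (measurable_fiber a (mi' k)))).
transitivity (\prod_(a <- D) (expR (- (fine (mu (B a)) * (1 - v a))))%:E); last first.
  apply: eq_big_seq => a; rewrite mem_filter => /andP[va _].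
  by rewrite /= mean_pgf.
rewrite prodEFin -expR_sum; congr (expR _)%:E.
rewrite sumrN; congr (- _)%R.
rewrite (integral_nat_comp mu measurableT mi (g := fun a => (1 - v a)%:E)); last first.
  by move=> b; rewrite lee_fin subr_ge0; have /andP[] := v01 b.
have term0 b : 0 <= mu (setT `&` i @^-1` [set b]) * (1 - v b)%:E.
  by rewrite mule_ge0// lee_fin subr_ge0; have /andP[] := v01 b.
rewrite (nneseries_split 0 m)//; rewrite add0n [X in _ + X]eseries0 ?adde0; last first.
  move=> b mb _; rewrite (_ : _ `&` _ = set0) ?measure0 ?mul0e//.
  by apply/seteqP; split => // t [_ /= itb]; have := im t; rewrite itb ltnNge mb.
rewrite /index_iota subn0 (bigID (fun a => v a != 1%R))/= [X in _ + X]big1 ?adde0; last first.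
  by move=> b /negPn/eqP ->; rewrite subrr mule0.
rewrite -big_filter -/D.
have finB b : b \in D -> mu (B b) \is a fin_num.
  by rewrite mem_filter => /andP[vb _]; rewrite ge0_fin_numE// fiber_fin.
rewrite big_seq [in RHS]big_seq -sum_fine => [|b bD]; last first.
  by rewrite setTI fin_numM// finB.
by apply: eq_bigr => b bD; rewrite setTI fineM// finB.
Qed.

End simple.
End simple_laplace.

(** * The Laplace functional of a Poisson process *)

Section poisson_laplace.
Local Open Scope ereal_scope.
Context {R : realType}.
Import HBNNSimple.

(** Functions with finitely many values in the unit interval, written as a function of
an integer class. *)
Definition coded dT (T : measurableType dT) (f : T -> R) :=
  exists m (i : T -> nat) (v : nat -> R), [/\ measurable_fun [set: T] i,
    forall t, (i t < m)%N, forall a, (0 <= v a <= 1)%R & forall t, f t = v (i t)].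

Lemma coded_nnsfun dT (T : measurableType dT) (g : {nnsfun T >-> R}) :
  (forall t, (g t <= 1)%R) -> coded (fun t => 1 - g t)%R.
Proof.
move=> g1; have /finite_seqP[r' rangeg] : finite_set (range g) by exact: fimfunP.
pose r := undup r'; have ur : uniq r := undup_uniq _.
have rE c : c \in r -> exists t, g t = c.
  rewrite mem_undup => cr; have : range g c by rewrite rangeg.
  by move=> [t _ <-]; exists t.
have gr t : g t \in r.
  by rewrite mem_undup; have : range g (g t) by []; rewrite rangeg.
exists (size r), (fun t => index (g t) r), (fun a => 1 - nth 0 r a)%R; split.
- apply: measurable_nat_fibers => a.
  have [ar|ra] := ltnP a (size r).
    rewrite (_ : _ @^-1` _ = g @^-1` [set nth 0%R r a]); first exact: measurable_funPTI.
    apply/seteqP; split => t /=; first by move=> <-; rewrite nth_index.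
    by move=> ->; rewrite index_uniq.
  rewrite (_ : _ @^-1` _ = set0)//; apply/seteqP; split => // t /= ta.
  by move: ra; rewrite -ta leqNgt index_mem gr.
- by move=> t; rewrite index_mem.
- move=> a; have [ar|ra] := ltnP a (size r).
    have [t <-] := rE _ (mem_nth 0%R ar).
    by rewrite subr_ge0 g1/= lerBlDr lerDl.
  by rewrite nth_default// subr0 ler01 lexx.
- by move=> t; rewrite nth_index.
Qed.

Lemma coded_measurable dT (T : measurableType dT) (f : T -> R) :
  coded f -> measurable_fun [set: T] f.
Proof.
move=> [m [i [v [mi _ _ fE]]]]; rewrite (_ : f = v \o i); last exact/funext.
exact: (measurableT_comp (f := v)).
Qed.

(** Approximation from above, obtained from simple functions below [1 - phi].  It has to be
from above for the infinite products over the points to decrease as well. *)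
Lemma upper_approximation dT (T : measurableType dT) (phi : T -> R) :
  measurable_fun [set: T] phi -> (forall t, (0 <= phi t <= 1)%R) ->
  exists f : nat -> T -> R, [/\ forall n, coded (f n),
    forall n t, (0 <= f n t <= 1)%R,
    forall n m t, (n <= m)%N -> (f m t <= f n t)%R,
    forall n t, (phi t <= f n t)%R &
    forall t, (f n t)%:E @[n --> \oo] --> (phi t)%:E].
Proof.
move=> mphi phi01; pose psi t := (1 - phi t)%:E.
have mpsi : measurable_fun [set: T] psi.
  by apply/measurable_EFinP; apply: measurable_funB.
have psi0 t : 0 <= psi t by rewrite lee_fin subr_ge0; have /andP[] := phi01 t.
pose g n := nnsfun_approx measurableT mpsi n.
have cvg_g t : (g n t)%:E @[n --> \oo] --> psi t by apply: cvg_nnsfun_approx.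
have nd_g t : nondecreasing_seq (fun n => g n t).
  by move=> n m nm; exact/lefP/nd_nnsfun_approx.
have le_g n t : (g n t <= 1 - phi t)%R.
  rewrite -lee_fin; apply: (cvge_to_ge (cvg_g t)).
  by exists n => // m /= nm; rewrite lee_fin nd_g.
have g1 n t : (g n t <= 1)%R.
  by rewrite (le_trans (le_g n t))// lerBlDr lerDl; have /andP[] := phi01 t.
exists (fun n t => 1 - g n t)%R; split.
- by move=> n; exact: coded_nnsfun.
- by move=> n t; rewrite subr_ge0 g1/= lerBlDr lerDl.
- by move=> n m t nm; rewrite lerD2l lerN2 nd_g.
- by move=> n t; rewrite lerBrDr -lerBrDl.
- move=> t; under eq_fun do rewrite EFinB.
  rewrite (_ : (phi t)%:E = 1 - psi t); last by rewrite /psi -EFinB subKr.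
  by apply: cvgeB => //; exact: cvg_cst.
Qed.

Lemma prod_fin_num (I : Type) (s : seq I) (l : I -> \bar R) :
  (forall i, l i \is a fin_num) -> \prod_(i <- s) l i \is a fin_num.
Proof.
by move=> lf; elim: s => [|j s IH]; rewrite ?big_nil// big_cons fin_numM.
Qed.

Lemma prod_cvg (I : Type) (s : seq I) (f : I -> nat -> \bar R) (l : I -> \bar R) :
  (forall i, l i \is a fin_num) -> (forall i, f i n @[n --> \oo] --> l i) ->
  \prod_(i <- s) f i n @[n --> \oo] --> \prod_(i <- s) l i.
Proof.
move=> lf cf.
pose Q (q : seq I) := \prod_(i <- q) f i n @[n --> \oo] --> \prod_(i <- q) l i.
suff : Q s by []; elim: s => [|i s IH]; rewrite /Q.
  by under eq_fun do rewrite big_nil; rewrite big_nil; exact: cvg_cst.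
under eq_fun do rewrite big_cons; rewrite big_cons; apply: cvgeM => //.
by apply: mule_def_fin => //; exact: prod_fin_num.
Qed.

Lemma le_prod_unit (I : Type) (s : seq I) (f g : I -> R) :
  (forall i, 0 <= f i)%R -> (forall i, f i <= g i)%R ->
  (\prod_(i <- s) f i <= \prod_(i <- s) g i)%R.
Proof.
by move=> f0 fg; apply: ler_prod => i _; rewrite f0 fg.
Qed.

Context d (Om : measurableType d) (P : probability Om R).
Context dT (T : measurableType dT) (mu : {measure set T -> \bar R}).
Variables (p : nat -> Om -> T) (K : nat) (xi : 'I_K -> Om -> R).
Variable F : 'I_K -> probability R R.

Let M (w : Om) : {measure set T -> \bar R} :=
  atomic (fun=> 1%:nng%R : {nonneg R}) (fun k => p k w).

Hypothesis mp : forall k, measurable_fun [set: Om] (p k).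
Hypothesis mxi : forall k, measurable_fun [set: Om] (xi k).
Hypothesis xiF : forall k B, measurable B -> P (xi k @^-1` B) = F k B.
Hypothesis PP : poisson_process P M mu.
Hypothesis ind : mutually_independent P (fun o : option 'I_K =>
  if o is Some k then sigma_of (xi k) else sigma_of_random_measure M).

(** The truncated means decrease both in the number of factors and along the
approximation of [phi] and [chi] from above, so the two limits can be exchanged,
both being infima.  The factors [chi k] evaluate the independent fixed weights. *)
Lemma poisson_laplace (phi : T -> R) (chi : 'I_K -> R -> R) :
  measurable_fun [set: T] phi -> (forall t, (0 <= phi t <= 1)%R) ->
  (forall k, measurable_fun [set: R] (chi k)) ->
  (forall k t, (0 <= chi k t <= 1)%R) ->
  \int[mu]_t (1 - phi t)%:E < +oo ->
  \int[P]_w ((\prod_k chi k (xi k w)) * \prod_(l < n) phi (p l w))%:E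
    @[n --> \oo] -->
  (\prod_k \int[F k]_t (chi k t)%:E) *
  (expR (- fine (\int[mu]_t (1 - phi t)%:E)))%:E.
Proof.
move=> mphi phi01 mchi chi01 fin_phi.
have [f [cf f01 nf phif f_cvg]] := upper_approximation mphi phi01.
have /choice[g gP] := fun k => upper_approximation (mchi k) (chi01 k).
have cg k n : coded (g k n) by have [] := gP k.
have g01 k n t : (0 <= g k n t <= 1)%R by have [_ ->] := gP k.
have ng k n m t : (n <= m)%N -> (g k m t <= g k n t)%R.
  by have [_ _ H _ _] := gP k; exact: H.
have chig k n t : (chi k t <= g k n t)%R by have [_ _ _ ->] := gP k.
have g_cvg k t : (g k n t)%:E @[n --> \oo] --> (chi k t)%:E.
  by have [_ _ _ _] := gP k.
pose W (c : 'I_K -> R -> R) (h : T -> R) L w : R :=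
  ((\prod_k c k (xi k w)) * \prod_(l < L) h (p l w))%R.
pose mean c h L := \int[P]_w (W c h L w)%:E.
have mW (c : 'I_K -> R -> R) (h : T -> R) L : (forall k, measurable_fun [set: R] (c k)) ->
    measurable_fun [set: T] h -> measurable_fun [set: Om] (fun w => (W c h L w)%:E).
  move=> mc mh; apply/measurable_EFinP; apply: measurable_funM.
    by apply: measurable_prod => k _; exact: measurableT_comp.
  by apply: measurable_prod => l _; exact: measurableT_comp.
have W_ge0 (c : 'I_K -> R -> R) (h : T -> R) L w : (forall k t, 0 <= c k t)%R -> (forall t, 0 <= h t)%R ->
    (0 <= W c h L w)%R.
  by move=> c0 h0; rewrite /W mulr_ge0// prodr_ge0.
have W_le1 (c : 'I_K -> R -> R) (h : T -> R) L w : (forall k t, 0 <= c k t <= 1)%R -> (forall t, 0 <= h t <= 1)%R ->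
    (W c h L w <= 1)%R.
  move=> c01 h01; rewrite /W.
  have /andP[a0 a1] := prod_in_unit (index_enum 'I_K) (fun k => c01 k (xi k w)).
  have /andP[b0 b1] := prod_in_unit (index_enum 'I_L) (fun l => h01 (p l w)).
  by rewrite mulr_ile1.
have le_mean (c c' : 'I_K -> R -> R) (h h' : T -> R) L :
    (forall k, measurable_fun [set: R] (c k)) -> measurable_fun [set: T] h ->
    (forall k, measurable_fun [set: R] (c' k)) -> measurable_fun [set: T] h' ->
    (forall k t, 0 <= c k t)%R -> (forall t, 0 <= h t)%R ->
    (forall k t, c k t <= c' k t)%R -> (forall t, h t <= h' t)%R ->
    mean c h L <= mean c' h' L.
  move=> mc mh mc' mh' c0 h0 cc' hh'; apply: ge0_le_integral => //.
  - by move=> w _; rewrite lee_fin W_ge0.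
  - exact: mW.
  - exact: mW.
  - move=> w _; rewrite lee_fin /W ler_pM ?prodr_ge0//; exact: le_prod_unit.
have ni_mean (c : 'I_K -> R -> R) (h : T -> R) L L' : (forall k, measurable_fun [set: R] (c k)) ->
    measurable_fun [set: T] h -> (forall k t, 0 <= c k t)%R ->
    (forall t, 0 <= h t <= 1)%R -> (L <= L')%N -> mean c h L' <= mean c h L.
  move=> mc mh c0 h01 LL'; have h0 t : (0 <= h t)%R by have /andP[] := h01 t.
  apply: ge0_le_integral => //.
  - by move=> w _; rewrite lee_fin W_ge0.
  - exact: mW.
  - exact: mW.
  - move=> w _; rewrite lee_fin /W ler_wpM2l ?prodr_ge0//.
    rewrite -!(big_mkord xpredT (fun l => h (p l w))) (big_cat_nat (leq0n L) LL')//=.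
    rewrite ler_piMr ?prodr_ge0//.
    by have /andP[] := prod_in_unit (index_iota L L') (fun l => h01 (p l w)).
have f0 n t : (0 <= f n t)%R by have /andP[] := f01 n t.
have g0 k n t : (0 <= g k n t)%R by have /andP[] := g01 k n t.
have phi0 t : (0 <= phi t)%R by have /andP[] := phi01 t.
have chi0 k t : (0 <= chi k t)%R by have /andP[] := chi01 k t.
have mf n := coded_measurable (cf n).
have mg k n := coded_measurable (cg k n).
pose target (c : 'I_K -> R -> R) (h : T -> R) :=
  (\prod_k \int[F k]_t (c k t)%:E) * (expR (- fine (\int[mu]_t (1 - h t)%:E)))%:E.
pose b n := target (g ^~ n) (f n).
have fin_f n : \int[mu]_t (1 - f n t)%:E < +oo.
  apply: le_lt_trans fin_phi; apply: ge0_le_integral => //.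
  - by move=> t _; rewrite lee_fin subr_ge0; have /andP[] := f01 n t.
  - by apply/measurable_EFinP; apply: measurable_funB.
  - by apply/measurable_EFinP; apply: measurable_funB.
  - by move=> t _; rewrite lee_fin lerD2l lerN2.
have simple n : mean (g ^~ n) (f n) L @[L --> \oo] --> b n.
  have [m [i [v [mi im v01 fE]]]] := cf n.
  have /choice[m' /choice[i' /choice[v' gE]]] := fun k => cg k n.
  have fE' : f n = v \o i by apply/funext.
  have gE' k : g k n = v' k \o i' k by apply/funext => t; have [_ _ _ ->] := gE k.
  have := @simple_laplace R _ Om P _ T mu p K xi F mp mxi xiF PP ind m i v mi im v01
    _ v' i' _ _.
  move=> /(_ _ _ _); rewrite /mean /b /target /W fE'.
  under [in X in _ -> X]eq_fun do under eq_integral do under eq_bigr do rewrite gE'.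
  under [in X in _ -> X]eq_bigr do under eq_integral do rewrite gE'.
  apply.
  - by have := fin_f n; rewrite fE'.
  - by move=> k; have [] := gE k.
  - by move=> k a; have [] := gE k.
have cvg_mean L : mean (g ^~ n) (f n) L @[n --> \oo] --> mean chi phi L.
  apply: bounded_cvg_integral => [n|n w|w].
  - exact: mW.
  - by rewrite !lee_fin W_ge0//= W_le1.
  - rewrite /W EFinM -!prodEFin; under eq_fun do rewrite EFinM -!prodEFin.
    apply: cvgeM => //; [|exact: prod_cvg|exact: prod_cvg].
    by rewrite !prodEFin mule_def_fin.
have fin_chi k : \int[F k]_t (chi k t)%:E \is a fin_num.
  rewrite ge0_fin_numE; last by apply: integral_ge0 => t _; rewrite lee_fin.
  apply: (@le_lt_trans _ _ (\int[F k]_t (cst 1) t)).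
    apply: ge0_le_integral => //; first by move=> t _; rewrite lee_fin.
      exact/measurable_EFinP.
    by move=> t _; rewrite lee_fin; have /andP[] := chi01 k t.
  by rewrite integral_cst// mul1e (le_lt_trans (probability_le1 _ _))// ltry.
have cvg_b : b n @[n --> \oo] --> target chi phi.
  apply: cvgeM => //.
  - by apply: mule_def_fin => //; exact: prod_fin_num.
  - apply: prod_cvg => k //.
    apply: bounded_cvg_integral => [n|n t|t].
    + exact/measurable_EFinP.
    + by rewrite !lee_fin g01.
    + exact: g_cvg.
  - apply: cvg_EFin; first exact: nearW.
    suff : expR (- fine (\int[mu]_t (1 - f n t)%:E)) @[n --> \oo] -->
        expR (- fine (\int[mu]_t (1 - phi t)%:E)) by [].
    apply: continuous_cvg; first exact: continuous_expR.
    apply: cvgN; apply: fine_cvg; rewrite fineK; last first.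
      rewrite ge0_fin_numE//; apply: integral_ge0 => t _.
      by rewrite lee_fin subr_ge0; have /andP[] := phi01 t.
    have := @cvg_monotone_convergence _ _ _ mu setT measurableT
      (fun n t => (1 - f n t)%:E).
    rewrite (_ : (fun t => limn _) = (fun t => (1 - phi t)%:E)).
      apply.
      - by move=> n; apply/measurable_EFinP; apply: measurable_funB.
      - by move=> n t _; rewrite lee_fin subr_ge0; have /andP[] := f01 n t.
      - by move=> t _ n m nm; rewrite lee_fin lerD2l lerN2 nf.
    apply/funext => t; apply/cvg_lim => //.
    under eq_fun do rewrite EFinB; rewrite EFinB.
    by apply: cvgeB => //; exact: cvg_cst.
have lim_mean : cvgn (mean chi phi).
  by apply: ereal_nonincreasing_is_cvgn => L L' LL'; exact: ni_mean.
suff E : target chi phi = limn (mean chi phi).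
  by move: lim_mean; rewrite /= -E; exact.
apply/eqP; rewrite eq_le; apply/andP; split.
  apply: lime_ge => //; apply: nearW => L.
  rewrite -(cvg_lim _ (cvg_mean L))// -(cvg_lim _ cvg_b)//.
  apply: lee_lim; [exact: (cvgP _ cvg_b)|exact: (cvgP _ (cvg_mean L))|].
  apply: nearW => n; rewrite -(cvg_lim _ (simple n))//.
  apply: lime_le; first exact: (cvgP _ (simple n)).
  by exists L => // L' /= LL'; apply: ni_mean.
rewrite -(cvg_lim _ cvg_b)//; apply: lime_ge; first exact: (cvgP _ cvg_b).
apply: nearW => n; rewrite -(cvg_lim _ (simple n))//.
apply: lee_lim => //; first exact: (cvgP _ (simple n)).
by apply: nearW => L; apply: le_mean.
Qed.

End poisson_laplace.

(** * Generating functions of the weights, and the step at which an atom is first seen *)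

Section weight_generating_functions.
Local Open Scope ereal_scope.
Context {R : realType} (h : nat -> R -> R).
Hypothesis pmf_h : pmf_family h.
Implicit Types (t u : R).

(** Generating function of [h(. | t)]; [rpgf] below is the same number as a real. *)
Definition wpgf u t : \bar R := \sum_(a <oo) (h a t * u ^+ a)%:E.

Lemma h_ge0 a t : (0 <= t)%R -> (0 <= h a t)%R.
Proof. by case: pmf_h => _ + _; exact. Qed.

Lemma h_sum1 t : (0 <= t)%R -> \sum_(a <oo) (h a t)%:E = 1.
Proof. by case: pmf_h => _ _; exact. Qed.

Lemma measurable_h a : measurable_fun (@Rplus R) (h a).
Proof. by case: pmf_h => + _ _; exact. Qed.

Lemma measurable_Rplus : measurable (@Rplus R).
Proof. exact: measurable_itv. Qed.

Lemma in_Rplus t : Rplus t <-> (0 <= t)%R.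
Proof. by rewrite /Rplus /= in_itv/= andbT. Qed.

Let term_ge0 u t a : (0 <= t)%R -> (0 <= u)%R -> 0 <= (h a t * u ^+ a)%:E.
Proof. by move=> t0 u0; rewrite lee_fin mulr_ge0 ?h_ge0// exprn_ge0. Qed.

Lemma wpgf_ge0 u t : (0 <= t)%R -> (0 <= u)%R -> 0 <= wpgf u t.
Proof. by move=> t0 u0; apply: nneseries_ge0 => a _ _; exact: term_ge0. Qed.

Lemma wpgf_le1 u t : (0 <= t)%R -> (0 <= u <= 1)%R -> wpgf u t <= 1.
Proof.
move=> t0 /andP[u0 u1]; rewrite -(h_sum1 t0); apply: lee_nneseries => a _.
  by move=> _; exact: term_ge0.
by rewrite lee_fin ler_piMr ?h_ge0// exprn_ile1.
Qed.

Lemma h_le1 a t : (0 <= t)%R -> (h a t <= 1)%R.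
Proof.
move=> t0; rewrite -lee_fin -(h_sum1 t0) (nneseriesD1 (n := a))//.
  by rewrite leeDl//; apply: nneseries_ge0 => b _ _; rewrite lee_fin h_ge0.
by move=> b _; rewrite lee_fin h_ge0.
Qed.

Lemma measurable_wpgf u : (0 <= u)%R -> measurable_fun (@Rplus R) (wpgf u).
Proof.
move=> u0; apply: ge0_emeasurable_sum => [a t /in_Rplus t0 _|a _].
  exact: term_ge0.
by apply/measurable_EFinP; apply: measurable_funM => //; exact: measurable_h.
Qed.

Definition rpgf u t : R := fine (wpgf u t).

Lemma rpgfE u t : (0 <= t)%R -> (0 <= u <= 1)%R -> (rpgf u t)%:E = wpgf u t.
Proof.
move=> t0 u01; have /andP[u0 _] := u01; rewrite /rpgf fineK// ge0_fin_numE.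
  by rewrite (le_lt_trans (wpgf_le1 t0 u01))// ltry.
exact: wpgf_ge0.
Qed.

Lemma rpgf_unit u t : (0 <= t)%R -> (0 <= u <= 1)%R -> (0 <= rpgf u t <= 1)%R.
Proof.
move=> t0 u01; rewrite -!lee_fin rpgfE// wpgf_le1// wpgf_ge0//.
by have /andP[] := u01.
Qed.

Lemma measurable_rpgf u : (0 <= u)%R -> measurable_fun (@Rplus R) (rpgf u).
Proof.
move=> u0.
by apply: (measurableT_comp (f := fine)) => //; exact: measurable_wpgf.
Qed.

Section steps.
Context (N : nat) (s : 'I_N -> R).
Hypothesis s01 : forall n, (0 <= s n <= 1)%R.

(** What an atom of weight [t] contributes on average at the steps from [m] on. *)
Definition later_pgf (m : nat) t : R := (\prod_(n : 'I_N | (m <= n)%N) rpgf (s n) t)%R.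

Lemma later_pgf_unit m t : (0 <= t)%R -> (0 <= later_pgf m t <= 1)%R.
Proof.
move=> t0; rewrite /later_pgf -big_filter; apply: prod_in_unit => n.
exact: rpgf_unit.
Qed.

Lemma measurable_later_pgf m : measurable_fun (@Rplus R) (later_pgf m).
Proof.
rewrite /later_pgf; under eq_fun do rewrite -big_filter.
apply: measurable_prod => n _; apply: measurable_rpgf.
by have /andP[] := s01 n.
Qed.

Lemma later_pgf0 t : later_pgf 0 t = (\prod_(n < N) rpgf (s n) t)%R.
Proof. by []. Qed.

Lemma later_pgfN t : later_pgf N t = 1%R.
Proof. by rewrite /later_pgf big1// => n; rewrite leqNgt ltn_ord. Qed.

Lemma later_pgfS (m : 'I_N) t :
  later_pgf m t = (rpgf (s m) t * later_pgf m.+1 t)%R.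
Proof.
rewrite /later_pgf (bigD1 m)//=; congr (_ * _)%R; apply: eq_bigl => n.
by rewrite andbC eq_sym ltn_neqAle.
Qed.

(** The likelihood that an atom of weight [t] is not seen before step [m] and then has
weight [x.+1]; its integral is the rate at which new atoms of this class appear. *)
Definition unseen_then (m : 'I_N) (x : nat) t : R := (h 0%N t ^+ m * h x.+1 t)%R.

Lemma unseen_then_ge0 m x t : (0 <= t)%R -> (0 <= unseen_then m x t)%R.
Proof. by move=> t0; rewrite mulr_ge0 ?exprn_ge0 ?h_ge0. Qed.

Lemma measurable_unseen_then m x : measurable_fun (@Rplus R) (unseen_then m x).
Proof.
apply: measurable_funM; last exact: measurable_h.
by apply: measurable_funX; exact: measurable_h.
Qed.

(** The mean contribution of the steps from [m] on when the atom is first seen at step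
[m] with weight [x.+1]; [seen_defect] is what it lacks from [unseen_then]. *)
Definition seen_pgf (m : 'I_N) (x : nat) t : R :=
  (unseen_then m x t * (s m ^+ x.+1 * later_pgf m.+1 t))%R.

Definition seen_defect (m : 'I_N) (x : nat) t : R :=
  (unseen_then m x t * (1 - s m ^+ x.+1 * later_pgf m.+1 t))%R.

Let step_unit m x t : (0 <= t)%R -> (0 <= s m ^+ x.+1 * later_pgf m.+1 t <= 1)%R.
Proof.
move=> t0; have /andP[s0 s1] := s01 m; have /andP[l0 l1] := later_pgf_unit m.+1 t0.
by rewrite mulr_ge0 ?exprn_ge0//= mulr_ile1 ?exprn_ge0// exprn_ile1.
Qed.

Lemma seen_pgf_ge0 m x t : (0 <= t)%R -> (0 <= seen_pgf m x t)%R.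
Proof.
by move=> t0; rewrite mulr_ge0 ?unseen_then_ge0//; have /andP[] := step_unit m x t0.
Qed.

Lemma seen_defect_ge0 m x t : (0 <= t)%R -> (0 <= seen_defect m x t)%R.
Proof.
move=> t0; rewrite mulr_ge0 ?unseen_then_ge0// subr_ge0.
by have /andP[] := step_unit m x t0.
Qed.

Lemma seen_split m x t : (seen_defect m x t + seen_pgf m x t = unseen_then m x t)%R.
Proof. by rewrite -mulrDr subrK mulr1. Qed.

Lemma measurable_seen_pgf m x : measurable_fun (@Rplus R) (seen_pgf m x).
Proof.
apply: measurable_funM; first exact: measurable_unseen_then.
by apply: measurable_funM => //; exact: measurable_later_pgf.
Qed.

Lemma measurable_seen_defect m x : measurable_fun (@Rplus R) (seen_defect m x).
Proof.
apply: measurable_funM; first exact: measurable_unseen_then.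
apply: measurable_funB => //.
by apply: measurable_funM => //; exact: measurable_later_pgf.
Qed.

(** Summing [h x.+1 t] and [h x.+1 t * s m ^ x.+1] gives [1 - h 0 t] and [H - h 0 t]
for the generating function [H] at step [m], and [H] times [later_pgf m.+1] is
[later_pgf m]. *)
Lemma seen_defect_series m t : (0 <= t)%R ->
  \sum_(x <oo) (seen_defect m x t)%:E =
  (h 0%N t ^+ m * (1 - later_pgf m t) - h 0%N t ^+ m.+1 * (1 - later_pgf m.+1 t))%:E.
Proof.
move=> t0; have /andP[s0 s1] := s01 m.
pose A := \sum_(x <oo) (h x.+1 t)%:E; pose B := \sum_(x <oo) (h x.+1 t * s m ^+ x.+1)%:E.
have A0 x : 0 <= (h x.+1 t)%:E by rewrite lee_fin h_ge0.
have B0 x : 0 <= (h x.+1 t * s m ^+ x.+1)%:E by exact: term_ge0.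
have AE : A = (1 - h 0%N t)%:E.
  have := h_sum1 t0; rewrite nneseries_recl//; last by move=> k _; rewrite lee_fin h_ge0.
  rewrite -nneseries_addn; last by move=> k; rewrite lee_fin h_ge0.
  under eq_eseriesr do rewrite addn1.
  by rewrite -/A => E; rewrite EFinB -E addeAC subee// add0e.
have BE : B = (rpgf (s m) t - h 0%N t)%:E.
  have := rpgfE t0 (s01 m); rewrite /wpgf nneseries_recl//; last by move=> k _; exact: term_ge0.
  rewrite -nneseries_addn; last by move=> k; exact: term_ge0.
  under eq_eseriesr do rewrite addn1.
  by rewrite -/B expr0 mulr1 => E; rewrite EFinB E addeAC subee// add0e.
set Q := later_pgf m.+1 t; have /andP[Q0 Q1] := later_pgf_unit m.+1 t0.
have a0 := h_ge0 0%N t0.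
have h0m : (0 <= h 0%N t ^+ m)%R by rewrite exprn_ge0.
have : \sum_(x <oo) (seen_defect m x t)%:E + (h 0%N t ^+ m * Q)%:E * B =
       (h 0%N t ^+ m)%:E * A.
  rewrite -nneseriesZle ?lee_fin ?mulr_ge0// -nneseriesZle ?lee_fin//.
  have d0 x : 0 <= (seen_defect m x t)%:E by rewrite lee_fin seen_defect_ge0.
  have b0 x : 0 <= (h 0%N t ^+ m * Q)%:E * (h x.+1 t * s m ^+ x.+1)%:E.
    by rewrite mule_ge0// lee_fin mulr_ge0.
  rewrite -nneseriesD//.
  apply: eq_eseriesr => x _; rewrite -!EFinM -EFinD; congr EFin.
  by rewrite /seen_defect /unseen_then -/Q; ring.
rewrite AE BE -!EFinM => E.
have fin : \sum_(x <oo) (seen_defect m x t)%:E \is a fin_num.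
  rewrite ge0_fin_numE; last first.
    by apply: nneseries_ge0 => x _ _; rewrite lee_fin seen_defect_ge0.
  apply: (@le_lt_trans _ _ (h 0%N t ^+ m * (1 - h 0%N t))%:E); last exact: ltry.
  rewrite -E leeDl// lee_fin mulr_ge0 ?mulr_ge0// -lee_fin -BE.
  by apply: nneseries_ge0 => x _ _; exact: B0.
rewrite -(addeK (\sum_(x <oo) _) (_ : (h 0%N t ^+ m * Q * (rpgf (s m) t - h 0%N t))%:E \is a fin_num))//.
rewrite E -EFinB later_pgfS -/Q; congr EFin.
by rewrite exprSr; ring.
Qed.

(** By the previous lemma the terms telescope. *)
Lemma seen_defect_total t : (0 <= t)%R ->
  \sum_(m < N) \sum_(x <oo) (seen_defect m x t)%:E = (1 - later_pgf 0 t)%:E.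
Proof.
move=> t0; under eq_bigr do rewrite seen_defect_series//.
rewrite sumEFin; congr EFin.
pose U m := (- (h 0%N t ^+ m * (1 - later_pgf m t)))%R.
transitivity (\sum_(0 <= m < N) (U m.+1 - U m))%R.
  by rewrite big_mkord; apply: eq_bigr => m _; rewrite /U opprK addrC.
rewrite telescope_sumr// /U later_pgfN subrr mulr0 oppr0 opprK add0r.
by rewrite expr0 mul1r.
Qed.

Variable nu : {measure set R -> \bar R}.
Hypothesis summable_h :
  \sum_(1 <= a <oo) \int[nu]_(t in @Rplus R) (h a t)%:E < +oo.

Lemma integral_unseen_le (m : 'I_N) x :
  \int[nu]_(t in @Rplus R) (unseen_then m x t)%:E <=
  \int[nu]_(t in @Rplus R) (h x.+1 t)%:E.
Proof.
apply: ge0_le_integral.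
- exact: measurable_Rplus.
- by move=> t /in_Rplus t0; rewrite lee_fin unseen_then_ge0.
- by apply/measurable_EFinP; exact: measurable_unseen_then.
- by apply/measurable_EFinP; exact: measurable_h.
- move=> t /in_Rplus t0; rewrite lee_fin ler_piMl ?h_ge0//.
  by rewrite exprn_ile1 ?h_ge0 ?h_le1.
Qed.

Lemma integral_h_ge0 a : 0 <= \int[nu]_(t in @Rplus R) (h a t)%:E.
Proof. by apply: integral_ge0 => t /in_Rplus t0; rewrite lee_fin h_ge0. Qed.

Lemma summable_hS : \sum_(x <oo) \int[nu]_(t in @Rplus R) (h x.+1 t)%:E < +oo.
Proof.
have := summable_h; rewrite -nneseries_addn; last by move=> a; exact: integral_h_ge0.
by under eq_eseriesr do rewrite addn1.
Qed.

Lemma integral_unseen_fin (m : 'I_N) x :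
  \int[nu]_(t in @Rplus R) (unseen_then m x t)%:E < +oo.
Proof.
apply: le_lt_trans (integral_unseen_le m x) _; apply: le_lt_trans summable_hS.
rewrite (nneseriesD1 (n := x))//; last by move=> a _; exact: integral_h_ge0.
by rewrite leeDl//; apply: nneseries_ge0 => a _ _; exact: integral_h_ge0.
Qed.

Lemma integral_defect :
  \int[nu]_(t in @Rplus R) (1 - later_pgf 0 t)%:E =
  \sum_(m < N) \sum_(x <oo) \int[nu]_(t in @Rplus R) (seen_defect m x t)%:E.
Proof.
have mR := measurable_Rplus.
have mD m x : measurable_fun (@Rplus R) (fun t => (seen_defect m x t)%:E).
  by apply/measurable_EFinP; exact: measurable_seen_defect.
have D0 m x t : Rplus t -> 0 <= (seen_defect m x t)%:E.
  by move=> /in_Rplus t0; rewrite lee_fin seen_defect_ge0.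
transitivity (\int[nu]_(t in @Rplus R)
    \sum_(m < N) \sum_(x <oo) (seen_defect m x t)%:E).
  apply: eq_integral => t; rewrite inE => /in_Rplus t0; by rewrite seen_defect_total.
rewrite ge0_integral_sum//.
- by apply: eq_bigr => m _; rewrite integral_nneseries// => x t; exact: D0.
- move=> m; apply: ge0_emeasurable_sum => [x t tR _|x _]; first exact: D0.
  exact: mD.
- by move=> m t tR; apply: nneseries_ge0 => x _ _; exact: D0.
Qed.

Lemma integral_defect_le :
  \int[nu]_(t in @Rplus R) (1 - later_pgf 0 t)%:E <=
  \sum_(m < N) \sum_(x <oo) \int[nu]_(t in @Rplus R) (h x.+1 t)%:E.
Proof.
rewrite integral_defect; apply: lee_sum => m _; apply: lee_nneseries => x _.
  by move=> _; apply: integral_ge0 => t /in_Rplus t0; rewrite lee_fin seen_defect_ge0.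
apply: le_trans (integral_unseen_le m x); apply: ge0_le_integral.
- exact: measurable_Rplus.
- by move=> t /in_Rplus t0; rewrite lee_fin seen_defect_ge0.
- by apply/measurable_EFinP; exact: measurable_seen_defect.
- by apply/measurable_EFinP; exact: measurable_unseen_then.
- move=> t /in_Rplus t0; rewrite lee_fin -[leRHS](seen_split m x t) lerDl.
  exact: seen_pgf_ge0.
Qed.

Lemma integral_hS_fin :
  \sum_(m < N) \sum_(x <oo) \int[nu]_(t in @Rplus R) (h x.+1 t)%:E < +oo.
Proof. by apply: lte_sum_pinfty => m _; exact: summable_hS. Qed.

End steps.

End weight_generating_functions.

(** * The generating functional of the observations *)

Section functional.
Local Open Scope ereal_scope.
Context {R : realType} dPsi (Psi : measurableType dPsi).
Variables (N K : nat) (psifix : 'I_K -> Psi) (F : 'I_K -> probability R R).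
Variables (nu : {measure set R -> \bar R}) (G : {measure set Psi -> \bar R}).
Variables (h : nat -> R -> R) (c : Psi -> nat) (s : 'I_N -> nat -> R).

(** Since [G] charges only the countably many patterns [b], the integral over
locations is a sum. *)
Definition total_exponent : \bar R :=
  \sum_(b <oo) G (c @^-1` [set b]) *
    \int[nu]_(t in @Rplus R) (1 - later_pgf h (s ^~ b) 0 t)%:E.

Definition limit_functional : \bar R :=
  (\prod_k \int[F k]_(t in @Rplus R) (later_pgf h (s ^~ (c (psifix k))) 0 t)%:E) *
  (expR (- fine total_exponent))%:E.

End functional.

Section model_functional.
Local Open Scope ereal_scope.
Context {R : realType} dPsi (Psi : measurableType dPsi).
Context d (Om : measurableType d) (P : probability Om R).
Variables (N K : nat) (psifix : 'I_K -> Psi) (F : 'I_K -> probability R R).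
Variables (nu : {sigma_finite_measure set R -> \bar R}) (G : probability Psi R).
Variables (theta : crm_atom K -> Om -> {nonneg R}) (psi : crm_atom K -> Om -> Psi).
Hypothesis atoms : crm_atoms P psifix F nu G theta psi.
Variables (h : nat -> R -> R) (pmf_h : pmf_family h).
Variables (x : 'I_N -> crm_atom K -> Om -> nat).
Hypothesis weights : observation_weights P theta psi h x.
Hypothesis summable_h :
  \sum_(1 <= a <oo) \int[nu]_(t in @Rplus R) (h a t)%:E < +oo.
Variables (c : Psi -> nat) (mc : measurable_fun [set: Psi] c).
Variables (s : 'I_N -> nat -> R) (s01 : forall n b, (0 <= s n b <= 1)%R).

Definition first_atoms (L : nat) : seq (crm_atom K) :=
  [seq inl k | k <- index_enum 'I_K] ++ [seq inr i | i <- iota 0 L].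

Lemma uniq_first_atoms L : uniq (first_atoms L).
Proof.
rewrite cat_uniq !map_inj_uniq ?index_enum_uniq ?iota_uniq//; try by move=> ? ? [].
by rewrite andbT; apply/hasPn => _ /mapP[a _ ->]; apply/negP => /mapP[].
Qed.

Lemma sub_first_atoms n m : (n <= m)%N -> {subset first_atoms n <= first_atoms m}.
Proof.
move=> nm l; rewrite !mem_cat => /orP[->//|/mapP[i]].
rewrite mem_iota => /andP[_ ilt] ->; apply/orP; right; apply: map_f.
by rewrite mem_iota/= (leq_trans ilt).
Qed.

Lemma mem_first_atoms l : exists n, l \in first_atoms n.
Proof.
case: l => [k|i]; first by exists 0%N; rewrite mem_cat map_f// mem_index_enum.
by exists i.+1; rewrite mem_cat map_f ?orbT// mem_iota /=.
Qed.

Let mtheta l : measurable_fun [set: Om] (fun w => (theta l w)%:num%R).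
Proof. exact: (measurable_theta atoms). Qed.

Let mpsi l : measurable_fun [set: Om] (psi l).
Proof. exact: (measurable_psi atoms). Qed.

Let mx n l : measurable_fun [set: Om] (x n l).
Proof. by case: weights. Qed.

Let atoms_sigma_measurable E : crm_atoms_sigma theta psi E -> measurable E.
Proof.
apply: smallest_sub; first exact: sigma_algebra_measurable.
move=> A [l _ [[B mB <-]|[B mB <-]]]; first exact: mtheta.
exact: mpsi.
Qed.

Let psi_sigma l (b : nat) : crm_atoms_sigma theta psi ((c \o psi l) @^-1` [set b]).
Proof.
apply: sub_sigma_algebra; exists l => //; right.
by exists (c @^-1` [set b]); [exact: measurable_fiber|rewrite setTI].
Qed.

Let mh a l : measurable_fun [set: Om] (fun w => (h a (theta l w)%:num%R)%:E).
Proof.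
apply/measurable_EFinP.
apply: (measurable_comp (F := @Rplus R) (f := h a)
  (g := fun w => (theta l w)%:num%R)) => //.
- exact: measurable_Rplus.
- by move=> _ [w _ <-]; apply/in_Rplus.
- exact: measurable_h.
Qed.

Let h0 a l w : 0 <= (h a (theta l w)%:num%R)%:E.
Proof. by rewrite lee_fin h_ge0. Qed.

(** Given the atoms, every weight can be averaged separately. *)
Lemma conditional_mean (E : set Om) (prs : seq ('I_N * crm_atom K))
    (f : 'I_N * crm_atom K -> nat -> \bar R) :
  crm_atoms_sigma theta psi E -> uniq prs -> nonneg_slots f ->
  \int[P]_(w in E) \prod_(j <- prs) f j (x j.1 j.2 w) =
  \int[P]_(w in E) \prod_(j <- prs)
     \sum_(a <oo) (h a (theta j.2 w)%:num%R)%:E * f j a.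
Proof.
move=> EC uprs f0; have mE := atoms_sigma_measurable EC.
pose Xi w (j : 'I_N * crm_atom K) (f : 'I_N * crm_atom K -> nat -> \bar R) :=
  \sum_(a <oo) (h a (theta j.2 w)%:num%R)%:E * f j a.
have Xi0 w j g : nonneg_slots g -> 0 <= Xi w j g.
  by move=> g0; apply: nneseries_ge0 => a _ _; rewrite mule_ge0// g0.
have mXi j g : nonneg_slots g -> measurable_fun [set: Om] (fun w => Xi w j g).
  move=> g0; apply: ge0_emeasurable_sum => [a w _ _|a _].
    by rewrite mule_ge0// g0.
  by apply: emeasurable_funM => //; exact: measurable_cst.
have := @joint_expectation_ext _ Om R P E mE _ prs uprs (fun j => x j.1 j.2) _ (cst 1) _ _
  (fun f => \int[P]_(w in E) \prod_(j <- prs) Xi w j f).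
move=> /(_ _ _ _ _ _ f f0) <-//; last 2 first.
- move=> j jp; apply: (@additive_integral _ _ _ _ P E j
    (fun w f => \prod_(j <- prs) Xi w j f)) => //.
  + move=> g g0; apply: emeasurable_prod_seq => i _; apply: measurable_funTS.
    exact: mXi.
  + by move=> w g _ g0; apply: prode_ge0 => i _; exact: Xi0.
  + move=> w _; apply: (additive_prod (i0 := j)) => //.
    * by apply: additive_series => a.
    * by move=> i g g0; exact: Xi0.
    * by move=> i g g' _ ij; rewrite /Xi fill_neq.
- move=> g a g0 ga; rewrite integral_cst//; last first.
    by apply: measurableI => //; exact: measurable_fibers.
  have [_ cond] := weights.
  rewrite mul1e; etransitivity; first exact: (cond E prs a EC uprs (fun _ _ _ _ => I)).
  apply: eq_integral => w _; rewrite -prodEFin; apply: eq_big_seq => j jp.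
  by rewrite /Xi ga// point_mass_series.
by apply: eq_integral => w _; rewrite mul1e.
Qed.

(** The value [1] for [t < 0], where [h] is arbitrary, makes negative weights
invisible. *)
Definition atom_pgf (t : R) (b : nat) : R :=
  if (0 <= t)%R then later_pgf h (s ^~ b) 0 t else 1%R.

Lemma atom_pgf_unit t b : (0 <= atom_pgf t b <= 1)%R.
Proof.
rewrite /atom_pgf; case: ifPn => [t0|_]; last by rewrite ler01 lexx.
exact: later_pgf_unit.
Qed.

Lemma measurable_atom_pgf b : measurable_fun [set: R] (atom_pgf ^~ b).
Proof.
apply: measurable_fun_if => //.
- exact: measurable_fun_ler.
- rewrite setTI (_ : _ @^-1` _ = @Rplus R); first exact: measurable_later_pgf.
  by apply/seteqP; split => t /=; rewrite -/(Rplus t) in_Rplus.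
Qed.

Definition atom_weight (l : crm_atom K) (w : Om) : R :=
  (\prod_n s n (c (psi l w)) ^+ x n l w)%R.

Lemma measurable_first_weights L :
  measurable_fun [set: Om] (fun w => (\prod_(l <- first_atoms L) atom_weight l w)%R).
Proof.
apply: measurable_prod => l _; apply: measurable_prod => n _.
apply: (measurable_switch (z := x n l)
  (F := fun a w => (s n (c (psi l w)) ^+ a)%R)) => // a.
apply: (measurableT_comp (f := fun b => (s n b ^+ a)%R)) => //.
exact: measurableT_comp.
Qed.

Lemma first_weights_unit L w :
  (0 <= \prod_(l <- first_atoms L) atom_weight l w <= 1)%R.
Proof.
apply: prod_in_unit => l; apply: prod_in_unit => n.
by have /andP[u0 u1] := s01 n (c (psi l w)); rewrite exprn_ge0// exprn_ile1.
Qed.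

(** The patterns of the locations are first fixed, so that the bases become constants;
the events fixing them are measurable with respect to the atoms. *)
Lemma mean_first_atoms L :
  \int[P]_w (\prod_(l <- first_atoms L) atom_weight l w)%:E =
  \int[P]_w (\prod_(l <- first_atoms L)
     atom_pgf (theta l w)%:num%R (c (psi l w)))%:E.
Proof.
have mz l : measurable_fun [set: Om] (c \o psi l) by exact: measurableT_comp.
have mV : measurable_fun [set: Om] (fun w => (\prod_(l <- first_atoms L) atom_weight l w)%:E).
  by apply/measurable_EFinP; exact: measurable_first_weights.
have mW : measurable_fun [set: Om] (fun w => (\prod_(l <- first_atoms L)
    atom_pgf (theta l w)%:num%R (c (psi l w)))%:E).
  apply/measurable_EFinP; apply: measurable_prod => l _.
  apply: (measurable_switch (z := c \o psi l)
    (F := fun b w => atom_pgf (theta l w)%:num%R b)) => // b.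
  exact: (measurableT_comp (measurable_atom_pgf b)).
have V0 w : 0 <= (\prod_(l <- first_atoms L) atom_weight l w)%:E.
  by rewrite lee_fin; have /andP[] := first_weights_unit L w.
have W0 w : 0 <= (\prod_(l <- first_atoms L)
    atom_pgf (theta l w)%:num%R (c (psi l w)))%:E.
  rewrite lee_fin; apply: prodr_ge0 => l _.
  by have /andP[] := atom_pgf_unit (theta l w)%:num%R (c (psi l w)).
have uS := uniq_first_atoms L.
pose Psi0 (f : crm_atom K -> nat -> \bar R) :=
  \int[P]_w ((\prod_(l <- first_atoms L)
     atom_pgf (theta l w)%:num%R (c (psi l w)))%:E *
     \prod_(l <- first_atoms L) f l (c (psi l w))).
suff E : \int[P]_w ((\prod_(l <- first_atoms L) atom_weight l w)%:E *
    \prod_(l <- first_atoms L) (fun _ _ => 1 : \bar R) l (c (psi l w))) =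
    Psi0 (fun _ _ => 1).
  transitivity (Psi0 (fun _ _ => 1)); last first.
    by apply: eq_integral => w _; rewrite [X in _ * X]big1// mule1.
  by rewrite -E; apply: eq_integral => w _; rewrite [X in _ * X]big1// mule1.
apply: (@joint_expectation_ext _ Om R P setT measurableT _ (first_atoms L) uS
  (fun l => c \o psi l) (fun l _ => mz l) _ mV V0 Psi0) => //.
  move=> l lS.
  exact: (additive_expectation P measurableT uS (fun l _ => mz l) mW W0 lS).
move=> f b f0 fb.
transitivity (\int[P]_w ((\prod_(l <- first_atoms L)
     atom_pgf (theta l w)%:num%R (c (psi l w)))%:E *
     \prod_(l <- first_atoms L) point_mass (b l) ((c \o psi l) w))); last first.
  by apply: eq_integral => w _; congr (_ * _); apply: eq_big_seq => l lS; rewrite fb.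
rewrite integral_point_masses// setTI.
set E0 := \bigcap_(l in _) _.
have E0C : crm_atoms_sigma theta psi E0.
  by apply: (@g_sigma_bigcap_seq Om _ _ (first_atoms L)) => l _; exact: psi_sigma.
pose prs := [seq (n, l) | n <- index_enum 'I_N, l <- first_atoms L].
have uprs : uniq prs.
  apply: allpairs_uniq; [exact: index_enum_uniq|exact: uS|].
  by move=> [n l] [n' l'] _ _ /= [-> ->].
have big_prs (g : 'I_N -> crm_atom K -> \bar R) :
    \prod_(j <- prs) g j.1 j.2 = \prod_(l <- first_atoms L) \prod_n g n l.
  by rewrite big_allpairs exchange_big.
pose g (j : 'I_N * crm_atom K) (a : nat) := (s j.1 (b j.2) ^+ a)%:E.
have g0 : nonneg_slots g.
  by move=> j a; rewrite lee_fin exprn_ge0//; have /andP[] := s01 j.1 (b j.2).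
have := conditional_mean E0C uprs g0.
move=> CM; transitivity (\int[P]_(w in E0) \prod_(j <- prs) g j (x j.1 j.2 w)).
  apply: eq_integral => w /set_mem wE.
  rewrite (big_prs (fun n l => g (n, l) (x n l w))) -prodEFin.
  apply: eq_big_seq => l lS; rewrite -prodEFin; apply: eq_bigr => n _.
  by rewrite /g /= -(wE l lS).
rewrite CM; apply: eq_integral => w /set_mem wE.
rewrite (big_prs (fun n l => \sum_(a <oo) (h a (theta l w)%:num%R)%:E * g (n, l) a)).
rewrite -prodEFin; apply: eq_big_seq => l lS.
rewrite /atom_pgf ge0 later_pgf0 -prodEFin; apply: eq_bigr => n _.
by rewrite rpgfE// /wpgf /g /= -(wE l lS).
Qed.

Let phi (tp : R * Psi) : R := atom_pgf tp.1 (c tp.2).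

Let mphi : measurable_fun [set: R * Psi] phi.
Proof.
apply: (measurable_switch (z := c \o snd) (F := fun b (tp : R * Psi) => atom_pgf tp.1 b)).
  exact: measurableT_comp.
by move=> b; exact: (measurableT_comp (measurable_atom_pgf b)).
Qed.

Lemma integral_atom_pgf :
  \int[(nu \x G)]_tp (1 - phi tp)%:E = total_exponent nu G h c s.
Proof.
have m1phi : measurable_fun [set: R * Psi] (fun tp => (1 - phi tp)%:E).
  by apply/measurable_EFinP; apply: measurable_funB.
have phi0 tp : 0 <= (1 - phi tp)%:E.
  by rewrite lee_fin subr_ge0; have /andP[] := atom_pgf_unit tp.1 (c tp.2).
rewrite fubini_tonelli2// /fubini_G.
pose g b := \int[nu]_(t in @Rplus R) (1 - later_pgf h (s ^~ b) 0 t)%:E.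
have g0 b : 0 <= g b.
  apply: integral_ge0 => t /in_Rplus t0; rewrite lee_fin subr_ge0.
  by have /andP[] := later_pgf_unit pmf_h (fun n => s01 n b) 0 t0.
transitivity (\int[G]_q g (c q)).
  apply: eq_integral => q _; rewrite /g [RHS]integral_mkcond.
  apply: eq_integral => t _; rewrite /phi /atom_pgf patchE /=.
  have [t0|t0] := boolP (0 <= t)%R; first by rewrite mem_set//; apply/in_Rplus.
  by rewrite subrr memNset// => /in_Rplus; exact/negP.
rewrite (integral_nat_comp G measurableT mc g0).
by apply: eq_eseriesr => b _; rewrite setTI.
Qed.

Lemma total_exponent_fin : total_exponent nu G h c s < +oo.
Proof.
pose C := \sum_(m < N) \sum_(a <oo) \int[nu]_(t in @Rplus R) (h a.+1 t)%:E.
have C0 : 0 <= C.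
  by apply: sume_ge0 => m _; apply: nneseries_ge0 => a _ _; exact: integral_h_ge0.
apply: (@le_lt_trans _ _ (\sum_(b <oo) G (c @^-1` [set b]) * C)).
  apply: lee_nneseries => b _.
    move=> _; rewrite mule_ge0//; apply: integral_ge0 => t /in_Rplus t0.
    rewrite lee_fin subr_ge0.
    by have /andP[] := later_pgf_unit pmf_h (fun n => s01 n b) 0 t0.
  by rewrite lee_wpmul2l//; exact: integral_defect_le.
rewrite nneseriesZre//.
have -> : \sum_(b <oo) G (c @^-1` [set b]) = 1.
  transitivity (\int[G]_t (cst 1) (c t)); last first.
    rewrite (integral_cst G measurableT) mul1e; exact: probability_setT.
  rewrite (integral_nat_comp G measurableT mc (g := cst 1))//.
  by apply: eq_eseriesr => b _; rewrite setTI mule1.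
by rewrite mul1e; exact: integral_hS_fin.
Qed.

Lemma model_limit :
  \int[P]_w (\prod_(l <- first_atoms L) atom_weight l w)%:E @[L --> \oo] -->
  limit_functional psifix F nu G h c s.
Proof.
under eq_fun do rewrite mean_first_atoms.
pose p i w : R * Psi := ((theta (inr i) w)%:num%R, psi (inr i) w).
pose xi k w : R := (theta (inl k) w)%:num%R.
have mp i : measurable_fun [set: Om] (p i) by exact: measurable_fun_pair.
have := @poisson_laplace R _ Om P _ _ (nu \x G)%E p K xi F mp
  (fun k => mtheta (inl k)) (fixed_weight_law atoms) (ordinary_poisson atoms)
  (fixed_ordinary_independent atoms) phi (fun k t => atom_pgf t (c (psifix k))) mphi
  (fun tp => atom_pgf_unit tp.1 (c tp.2)) (fun k => measurable_atom_pgf (c (psifix k)))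
  (fun k t => atom_pgf_unit t (c (psifix k))).
rewrite integral_atom_pgf => /(_ total_exponent_fin).
set lhs := (X in X @ _ --> _ -> _); set lhs' := (X in _ -> X @ _ --> _).
have -> : lhs = lhs'.
  apply/funext => L; apply: eq_integral => w _; congr EFin.
  rewrite big_cat !big_map; congr (_ * _)%R.
    by apply: eq_bigr => k _; rewrite (fixed_location atoms).
  by rewrite -(big_mkord xpredT (fun l => phi (p l w))) /index_iota subn0.
set rhs := (X in _ --> X -> _); suff -> : rhs = limit_functional psifix F nu G h c s by [].
congr (_ * _); apply: eq_bigr => k _.
have mRc : measurable (~` @Rplus R) by apply: measurableC; exact: measurable_Rplus.
have null : F k (~` @Rplus R) = 0.
  rewrite -(fixed_weight_law atoms)// (_ : [set w | _] = set0) ?measure0//.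
  by apply/seteqP; split => // w /= []; apply/in_Rplus.
rewrite (ge0_negligible_integral mRc measurableT _ _ null)//; last 2 first.
- by apply/measurable_EFinP; exact: measurable_atom_pgf.
- by move=> t _; rewrite lee_fin; have /andP[] := atom_pgf_unit t (c (psifix k)).
rewrite setTD setCK; apply: eq_integral => t; rewrite inE => /in_Rplus t0.
by rewrite /atom_pgf t0.
Qed.

End model_functional.

(** * The law of the weight history of finitely many constructed atoms *)

Lemma g_sigma_setI (T : pointedType) (G : set (set T)) (A B : set T) :
  <<s G >> A -> <<s G >> B -> <<s G >> (A `&` B).
Proof.
move=> GA GB; have := @g_sigma_bigcap_seq T G bool [:: true; false]
  (fun b => if b then A else B).
rewrite bigcap_seq !big_cons big_nil setIT; apply => -[]//.
Qed.

Section construction_histories.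
Local Open Scope ereal_scope.
Context {R : realType} dPsi (Psi : measurableType dPsi).
Context d (Om : measurableType d) (P : probability Om R).
Variables (N K : nat) (psifix : 'I_K -> Psi) (F : 'I_K -> probability R R).
Variables (nu : {sigma_finite_measure set R -> \bar R}) (G : probability Psi R).
Variables (h : nat -> R -> R) (pmf_h : pmf_family h).
Hypothesis summable_h :
  \sum_(1 <= a <oo) \int[nu]_(t in @Rplus R) (h a t)%:E < +oo.
Variables (rho : 'I_N -> nat -> Om -> nat).
Variables (newpsi : 'I_N -> nat -> nat -> Om -> Psi).
Variable y : 'I_N -> atom_label N K -> Om -> nat.
Hypothesis construction : marginal_construction P psifix F nu G h rho newpsi y.

Local Notation label := (atom_label N K).
Local Notation prior_of := (prior (N := N) F nu).

(** The factor of step [n] in the likelihood of a history of the atom [l] with weight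
[t].  A new atom of class [(m, x)] must have weight [0] before step [m] and weight
[x.+1] at step [m]. *)
Definition kern (l : label) (n : 'I_N) (a : nat) (t : R) : R :=
  match l with
  | inl _ => h a t
  | inr (m, x, _) => if (n < m)%N then ((a == 0%N)%:R * h 0%N t)%R
                     else if n == m then ((a == x.+1)%:R * h x.+1 t)%R else h a t
  end.

(** Total mass of the histories that start like [l], inverted; for a fixed-location
atom this mass is [1]. *)
Definition inv_rate (l : label) : R :=
  match l with
  | inl _ => 1%R
  | inr (m, x, _) => (new_atom_rate nu h m x.+1)^-1%R
  end.

Lemma kern_ge0 l n a t : (0 <= t)%R -> (0 <= kern l n a t)%R.
Proof.
move=> t0; case: l => [k|[[m x] j]] /=; first exact: h_ge0.
by case: ifP => _; [|case: ifP => _]; rewrite ?mulr_ge0 ?h_ge0.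
Qed.

Lemma measurable_kern l n a : measurable_fun (@Rplus R) (kern l n a).
Proof.
have mh := measurable_h pmf_h.
case: l => [k|[[m x] j]] /=; first exact: mh.
rewrite /kern; case: (n < m)%N; first by apply: measurable_funM.
by case: (n == m); [apply: measurable_funM|exact: mh].
Qed.

Hypothesis F_Rplus : forall k, F k (@Rplus R) = 1.

Lemma new_atom_rate_ge0 (m : 'I_N) x : (0 <= new_atom_rate nu h m x.+1)%R.
Proof.
apply: fine_ge0; apply: integral_ge0 => t /in_Rplus t0.
by rewrite lee_fin mulr_ge0 ?exprn_ge0 ?h_ge0.
Qed.

Lemma new_atom_rateE (m : 'I_N) x :
  (new_atom_rate nu h m x.+1)%:E = \int[nu]_(t in @Rplus R) (unseen_then h m x t)%:E.
Proof.
rewrite /new_atom_rate fineK// ge0_fin_numE.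
  exact: integral_unseen_fin.
by apply: integral_ge0 => t /in_Rplus t0; rewrite lee_fin unseen_then_ge0.
Qed.

Section histories.
Variables (S : seq label) (uS : uniq S) (E : set Om) (mE : measurable E).
Hypothesis ES : forall n, drawn_sigma rho newpsi y n E.
Hypothesis existsS : forall l, l \in S -> E `<=` exists_atom rho l.
Variable a : 'I_N * label -> nat.

(* The prescribed weights are observed before step [n0]. *)
Let hist (n0 : nat) : set Om := [set w | E w /\
  forall (n : 'I_N) l, (n < n0)%N -> l \in S -> y n l w = a (n, l)].

Let past_of (n0 : nat) (l : label) : seq nat :=
  [seq a (n, l) | n : 'I_N <- enum 'I_N & (n < n0)%N].

(* The conditional probability of the weight prescribed for [l] at step [n0]. *)
Let factor (n0 : 'I_N) (l : label) : R :=
  if before n0 l then hcond (prior_of l) h (past_of n0 l) (a (n0, l)) else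
  match l with
  | inl _ => 1%R
  | inr (m, x, _) => if m == n0 then (a (n0, l) == x.+1)%:R%R
                     else (a (n0, l) == 0%N)%:R%R
  end.

Let drawn_measurable n A : drawn_sigma rho newpsi y n A -> measurable A.
Proof.
apply: smallest_sub; first exact: sigma_algebra_measurable.
move=> B [[|]|].
- move=> [m _ [x _ [U mU <-]]]; exact: (measurable_rho construction).
- move=> [m _ [x _ [j _ [U mU <-]]]]; exact: (measurable_newpsi construction).
- move=> [m _ [l _ [U mU <-]]]; exact: (measurable_y construction).
Qed.

Let prs n0 := [seq (n, l) | n <- [seq n : 'I_N <- enum 'I_N | (n < n0)%N], l <- S].

Let mem_prs n0 (n : 'I_N) l : ((n, l) \in prs n0) = (n < n0)%N && (l \in S).
Proof.
apply/allpairsP/andP => [[[n' l'] /= [+ ? [-> ->]]]|[nn0 lS]].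
  by rewrite mem_filter => /andP[].
by exists (n, l); rewrite mem_filter nn0 mem_enum.
Qed.

Let histE n0 : hist n0 = E `&` \bigcap_(j in [set` prs n0]) (y j.1 j.2 @^-1` [set a j]).
Proof.
apply/seteqP; split => w [Ew H]; split => //.
  by move=> [n l] /=; rewrite mem_prs => /andP[nn0 lS]; exact: H.
by move=> n l nn0 lS; apply: (H (n, l)); rewrite /= mem_prs nn0.
Qed.

Let hist_sigma (n0 : 'I_N) : drawn_sigma rho newpsi y n0 (hist n0).
Proof.
rewrite histE; apply: g_sigma_setI; first exact: ES.
apply: g_sigma_bigcap_seq => -[n l]; rewrite mem_prs => /andP[nn0 _].
apply: sub_sigma_algebra; right; exists n => //; exists l => //.
by exists [set a (n, l)] => //; rewrite setTI.
Qed.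

(* The weights of atoms that are not old are forced, so either the event is empty and
some factor vanishes, or only the old atoms matter, to which the predictive
probabilities apply. *)
Let hist_step (n0 : 'I_N) : P (hist n0.+1) = P (hist n0) * (\prod_(l <- S) factor n0 l)%:E.
Proof.
have mH : measurable (hist n0) := @drawn_measurable n0 _ (@hist_sigma n0).
have [[l lS [nb fl]]|nobad] := pselect (exists2 l, l \in S & ~~ before n0 l /\ factor n0 l = 0%R).
  rewrite (_ : hist n0.+1 = set0).
    by rewrite measure0 (bigD1_seq l)//= fl mul0r mule0.
  apply/seteqP; split => // w [Ew H]; have := H n0 l (ltnSn _) lS.
  have ex := existsS lS Ew.
  move: fl; rewrite /factor (negbTE nb).
  case: l lS ex nb => [k|[[m x] j]] lS ex nb; first by move=> /eqP; rewrite oner_eq0.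
  have [mn0|mn0] := eqVneq m n0.
    rewrite -mn0 (new_weight construction)// => fl ax.
    by move: fl; rewrite -ax eqxx => /eqP; rewrite oner_eq0.
  have n0m : (n0 < m)%N.
    by move: nb; rewrite /= -leqNgt => nb; rewrite ltn_neqAle nb andbT eq_sym; exact: mn0.
  rewrite (no_weight_before construction)//.
  by move=> fl ax; move: fl; rewrite -ax eqxx => /eqP; rewrite oner_eq0.
have fac1 l : l \in S -> ~~ before n0 l -> factor n0 l = 1%R.
  move=> lS nb; have : factor n0 l <> 0%R by move=> fl; apply: nobad; exists l.
  rewrite /factor (negbTE nb); case: l {lS nb} => [//|[[m x] j]].
  by case: ifP => _; case: eqP.
pose old := [seq l <- S | before n0 l].
have -> : (\prod_(l <- S) factor n0 l)%R =
    (\prod_(l <- old) hcond (prior_of l) h (past_of n0 l) (a (n0, l)))%R.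
  rewrite big_filter [RHS]big_mkcond/= big_seq [RHS]big_seq.
  apply: eq_bigr => l lS; case: ifPn => [b|nb]; last exact: fac1.
  by rewrite /factor b.
have -> : hist n0.+1 =
    hist n0 `&` \bigcap_(l in [set` old]) (y n0 l @^-1` [set a (n0, l)]).
  apply/seteqP; split => w.
    move=> [Ew H]; split.
      by split => // n l nn0 lS; apply: H => //; exact: ltnW.
    by move=> l /=; rewrite mem_filter => /andP[_ lS]; exact: H.
  move=> [[Ew H] H0]; split => // n l; rewrite ltnS leq_eqVlt => /orP[/eqP/val_inj ->|]; last exact: H.
  move=> lS; have [b|nb] := boolP (before n0 l).
    by apply: (H0 l); rewrite /= mem_filter b.
  have := fac1 l lS nb; have := existsS lS Ew.
  rewrite /factor (negbTE nb); case: l lS nb => [k|[[m x] j]] lS nb ex; first by [].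
  have [mn0|mn0] := eqVneq m n0.
    rewrite -mn0 (new_weight construction)//.
    by case: eqP => // _ /esym/eqP; rewrite oner_eq0.
  have n0m : (n0 < m)%N.
    by move: nb; rewrite /= -leqNgt => nb; rewrite ltn_neqAle nb andbT eq_sym; exact: mn0.
  rewrite (no_weight_before construction)//.
  by case: eqP => // _ /esym/eqP; rewrite oner_eq0.
have ow : cond_independent_pmf P (drawn_sigma rho newpsi y n0) (old_atom rho n0)
    (y n0) (fun l w a => hcond (prior_of l) h (past y n0 l w) a).
  exact: (old_weights construction).
rewrite (ow _ old (fun l => a (n0, l)) (@hist_sigma n0)) ?filter_uniq//; last first.
  move=> l; rewrite mem_filter => /andP[b lS] w [Ew _]; split => //.
  exact: (existsS lS).
transitivity (\int[P]_(w in hist n0)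
    (\prod_(l <- old) hcond (prior_of l) h (past_of n0 l) (a (n0, l)))%:E).
  apply: eq_integral => w /set_mem[Ew H]; congr EFin.
  apply: eq_big_seq => l; rewrite mem_filter => /andP[_ lS].
  congr (hcond _ _ _ _); rewrite /past /past_of; apply/eq_in_map => n.
  by rewrite mem_filter => /andP[nn0 _]; exact: H.
by rewrite (integral_cst P mH) muleC.
Qed.

Let allowed (l : label) (n : 'I_N) : R :=
  match l with
  | inl _ => 1%R
  | inr (m, x, _) => if (n < m)%N then (a (n, l) == 0%N)%:R%R
                     else if n == m then (a (n, l) == x.+1)%:R%R else 1%R
  end.

Let kern_allowed l n t : kern l n (a (n, l)) t = (allowed l n * h (a (n, l)) t)%R.
Proof.
case: l => [k|[[m x] j]] /=; first by rewrite mul1r.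
case: ifP => _; first by case: eqP => [->//|_]; rewrite !mul0r.
case: ifP => _; last by rewrite mul1r.
by case: eqP => [->//|_]; rewrite !mul0r.
Qed.

Let born (n0 : nat) (l : label) : bool :=
  match l with inl _ => true | inr (m, _, _) => (m < n0)%N end.

Let D n0 l := \int[prior_of l]_(t in @Rplus R) (likelihood h (past_of n0 l) t)%:E.

Let so_far n0 l : R := (\prod_(n : 'I_N | (n < n0)%N) allowed l n)%R.

(* The probability, given that [l] exists, of its prescribed weights before
[n0]. *)
Let part n0 l : \bar R :=
  (so_far n0 l)%:E * (if born n0 l then (inv_rate l)%:E * D n0 l else 1).

Let likelihoodE n0 l t :
  likelihood h (past_of n0 l) t = (\prod_(n : 'I_N | (n < n0)%N) h (a (n, l)) t)%R.
Proof. by rewrite /likelihood big_map big_filter big_enum_cond. Qed.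

Let likelihood_ge0 n0 l t : (0 <= t)%R -> (0 <= likelihood h (past_of n0 l) t)%R.
Proof. by move=> t0; rewrite likelihoodE prodr_ge0// => n _; exact: h_ge0. Qed.

Let measurable_likelihood n0 l : measurable_fun (@Rplus R) (likelihood h (past_of n0 l)).
Proof.
rewrite /likelihood; apply: measurable_prod => b _; exact: measurable_h.
Qed.

Let D_ge0 n0 l : 0 <= D n0 l.
Proof. by apply: integral_ge0 => t /in_Rplus t0; rewrite lee_fin likelihood_ge0. Qed.

Let prod_split (n0 : 'I_N) (g : 'I_N -> R) :
  (\prod_(n : 'I_N | (n < n0.+1)%N) g n = g n0 * \prod_(n : 'I_N | (n < n0)%N) g n)%R.
Proof.
rewrite (bigD1 n0)//=; congr (_ * _)%R; apply: eq_bigl => n.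
by rewrite ltnS ltn_neqAle andbC.
Qed.

(* A new atom already born has a positive weight in its past, so the likelihood of the
past is dominated by some [h x.+1], which is integrable. *)
Let D_fin n0 l : born n0 l -> so_far n0 l != 0%R -> D n0 l < +oo.
Proof.
move=> b sf; have mL := measurable_likelihood n0 l.
have le_prod (A : pred 'I_N) t : (0 <= t)%R -> (\prod_(n | A n) h (a (n, l)) t <= 1)%R.
  move=> t0; rewrite -big_filter.
  have h01 n : (0 <= h (a (n, l)) t <= 1)%R by rewrite h_ge0 ?h_le1.
  by have /andP[] := prod_in_unit [seq n <- index_enum 'I_N | A n] h01.
case: l b sf mL le_prod => [k|[[m x] j]] /= b sf mL le_prod.
  apply: (@le_lt_trans _ _ (\int[F k]_(t in @Rplus R) (cst 1) t)).
    apply: ge0_le_integral => //.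
    - exact: measurable_Rplus.
    - by move=> t /in_Rplus t0; rewrite lee_fin likelihood_ge0.
    - exact/measurable_EFinP.
    - by move=> t /in_Rplus t0; rewrite lee_fin likelihoodE le_prod.
  rewrite (integral_cst (F k) measurable_Rplus) mul1e.
  exact: le_lt_trans (probability_le1 (F k) measurable_Rplus) (ltry _).
have am : a (m, inr (m, x, j)) = x.+1.
  move: sf; rewrite /so_far (bigD1 m)//= ltnn eqxx.
  by have [//|_] := eqVneq (a (m, inr (m, x, j))) x.+1; rewrite mul0r eqxx.
apply: (@le_lt_trans _ _ (\int[nu]_(t in @Rplus R) (h x.+1 t)%:E)).
  apply: ge0_le_integral => //.
  - exact: measurable_Rplus.
  - by move=> t /in_Rplus t0; rewrite lee_fin likelihood_ge0.
  - exact/measurable_EFinP.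
  - by apply/measurable_EFinP; exact: measurable_h.
  - move=> t /in_Rplus t0; rewrite lee_fin likelihoodE (bigD1 m)//= am.
    by rewrite ler_piMr ?h_ge0//; exact: le_prod.
apply: le_lt_trans (summable_hS pmf_h summable_h).
rewrite (nneseriesD1 (n := x))//; last by move=> b' _; exact: integral_h_ge0.
by rewrite leeDl//; apply: nneseries_ge0 => b' _ _; exact: integral_h_ge0.
Qed.

(* When the denominator of the predictive probability vanishes, so does its
numerator, and the identity holds with the quotient read as [0]. *)
Let part_step (n0 : 'I_N) l :
  inv_rate l != 0%R ->
  part n0.+1 l = part n0 l * (factor n0 l)%:E.
Proof.
move=> rate0; rewrite /part.
have sfS : so_far n0.+1 l = (allowed l n0 * so_far n0 l)%R by rewrite /so_far prod_split.
have [sf0|sf0] := eqVneq (so_far n0 l) 0%R; first by rewrite sfS sf0 mulr0 !mul0e.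
have [b|nb] := boolP (before n0 l).
  have bn : born n0 l by case: l b {rate0 sfS sf0} => [//|[[m x] j]].
  have bn1 : born n0.+1 l by case: l bn {b rate0 sfS sf0} => [//|[[m x] j]] /= /ltnW.
  have al : allowed l n0 = 1%R.
    case: l b {rate0 sfS sf0 bn bn1} => [//|[[m x] j]] /= mn0.
    by rewrite ltnNge (ltnW mn0)/= -val_eqE/= gtn_eqF.
  rewrite bn bn1 sfS al mul1r /factor b -!muleA; congr (_ * (_ * _)).
  have Dfin : D n0 l \is a fin_num by rewrite ge0_fin_numE// D_fin.
  have DS : D n0.+1 l = \int[prior_of l]_(t in @Rplus R)
      (h (a (n0, l)) t * likelihood h (past_of n0 l) t)%:E.
    by apply: eq_integral => t _; rewrite !likelihoodE prod_split.
  have DSfin : D n0.+1 l \is a fin_num.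
    by rewrite ge0_fin_numE// D_fin// sfS al mul1r.
  rewrite /hcond -DS -/(D n0 l) -[LHS](fineK DSfin).
  rewrite -[X in _ = X * _](fineK Dfin) -EFinM; congr EFin.
  have [D0|D0] := eqVneq (fine (D n0 l)) 0%R; last by rewrite mulrCA divff// mulr1.
  rewrite D0 mul0r; apply/eqP; rewrite eq_le fine_ge0// andbT -lee_fin fineK//.
  apply: (@le_trans _ _ (D n0 l)); last by rewrite -(fineK Dfin) D0.
  rewrite DS; apply: ge0_le_integral.
  - exact: measurable_Rplus.
  - by move=> t /in_Rplus t0; rewrite lee_fin mulr_ge0 ?h_ge0 ?likelihood_ge0.
  - by apply/measurable_EFinP; apply: measurable_funM => //; exact: measurable_h.
  - exact/measurable_EFinP.
  - by move=> t /in_Rplus t0; rewrite lee_fin ler_piMl ?likelihood_ge0 ?h_le1.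
case: l rate0 sfS sf0 nb => [//|[[m x] j]]; set l : label := inr (m, x, j).
rewrite [inv_rate l]/= invr_eq0 => rate0 sfS sf0; rewrite [before n0 l]/= -leqNgt => n0m.
have nb : (m < n0)%N = false by rewrite ltnNge n0m.
rewrite /born /factor /before /l nb mule1 -/l.
have [mn0|mn0] := eqVneq m n0.
  have al : allowed l n0 = (a (n0, l) == x.+1)%:R%R by rewrite /= mn0 ltnn eqxx.
  rewrite ltnS mn0 leqnn sfS al -mn0; case: eqP => [am|_]; last by rewrite !mul0r mul0e mule0.
  rewrite mul1r mule1 -[RHS]mule1; congr (_ * _).
  have -> : D m.+1 l = (new_atom_rate nu h m x.+1)%:E.
    rewrite new_atom_rateE; apply: eq_integral => t _.
    rewrite likelihoodE prod_split am mulrC /unseen_then; congr (_ * _)%:E.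
    rewrite (eq_bigr (fun=> h 0%N t)); last first.
      move=> n nm; congr (h _ t); apply/eqP; apply: contraNT sf0 => an.
      rewrite /so_far (bigD1 n)/=; last by rewrite -mn0.
      by rewrite nm (negbTE an) mul0r.
    rewrite -(big_ord_widen N (fun=> h 0%N t) (ltnW (ltn_ord m))).
    by rewrite prodr_const card_ord.
  by rewrite -EFinM mulVf.
have n0m' : (n0 < m)%N by rewrite ltn_neqAle n0m andbT eq_sym; exact: mn0.
rewrite ltnS leqNgt n0m' /= mule1 sfS /allowed /l n0m' mulrC.
by rewrite EFinM.
Qed.

Let allowed_ge0 l n : (0 <= allowed l n)%R.
Proof.
case: l => [k|[[m x] j]]; rewrite /allowed ?ler01//.
by case: ifP => _; [|case: ifP => _]; rewrite ?ler0n ?ler01.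
Qed.

Let part0 l : part 0 l = 1.
Proof.
rewrite /part /so_far big_pred0// mul1e; case: l => [k|[[m x] j]]//.
rewrite /born /inv_rate mul1e /D.
transitivity (\int[F k]_(t in @Rplus R) (cst 1) t).
  by apply: eq_integral => t _; rewrite likelihoodE big_pred0.
rewrite (integral_cst (F k) measurable_Rplus) mul1e; exact: F_Rplus.
Qed.

Let partN l : part N l = (inv_rate l)%:E *
  \int[prior_of l]_(t in @Rplus R) (\prod_n kern l n (a (n, l)) t)%:E.
Proof.
have bN : born N l by case: l => [//|[[m x] j]] /=.
rewrite /part bN muleCA; congr (_ * _); rewrite /D -ge0_integralZl_EFin.
- apply: eq_integral => t _; rewrite -EFinM likelihoodE -big_split/=; congr EFin.
  by apply: eq_big => [n|n _]; rewrite ?ltn_ord// kern_allowed.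
- exact: measurable_Rplus.
- by move=> t /in_Rplus t0; rewrite lee_fin likelihood_ge0.
- by apply/measurable_EFinP; exact: measurable_likelihood.
- by apply: prodr_ge0 => n _; exact: allowed_ge0.
Qed.

Let inv_rate_null l : l \in S -> inv_rate l = 0%R -> P E = 0.
Proof.
move=> lS.
case: l lS => [k _ /eqP|[[m x] j] lS]; first by rewrite oner_eq0.
move=> /eqP; rewrite invr_eq0 => /eqP rate0.
have mr : measurable (rho m x @^-1` [set~ 0%N]).
  by rewrite -[X in measurable X]setTI; exact: (measurable_rho construction).
apply/eqP; rewrite -measure_le0.
apply: (@le_trans _ _ (P (rho m x @^-1` [set~ 0%N]))).
  apply: le_measure; rewrite ?inE//.
  by move=> w /(existsS lS) /= jr /eqP; rewrite -leqn0 leqNgt (leq_ltn_trans _ jr).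
rewrite (new_atom_number construction) rate0 /poisson_prob ltxx diracE memNset//.
by move=> /=.
Qed.

(** The predictive probabilities telescope.  If some [l] in [S] has rate [0], then [E] is
null, since such an atom almost surely does not exist. *)
Lemma history_prob :
  P (E `&` \bigcap_(j in [set` [seq (n, l) | n <- enum 'I_N, l <- S]])
       (y j.1 j.2 @^-1` [set a j])) =
  P E * \prod_(l <- S) ((inv_rate l)%:E *
    \int[prior_of l]_(t in @Rplus R) (\prod_n kern l n (a (n, l)) t)%:E).
Proof.
have [[l [lS l0]]|rates] := pselect (exists l, l \in S /\ inv_rate l = 0%R).
  have PE := inv_rate_null lS l0; rewrite PE mul0e.
  apply/eqP; rewrite -measure_le0 -[leRHS]PE; apply: le_measure; rewrite ?inE//.
  apply: measurableI => //; apply: measurable_fibers => j _.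
  exact: (measurable_y construction).
have main n0 : (n0 <= N)%N -> P (hist n0) = P E * \prod_(l <- S) part n0 l.
  elim: n0 => [_|n0 IH n0N].
    rewrite big1 ?mule1//; congr (P _); apply/seteqP; split => w; first by case.
    by move=> Ew; split.
  have := hist_step (Ordinal n0N) => /= ->; rewrite (IH (ltnW n0N)) -muleA; congr (_ * _).
  rewrite -prodEFin -big_split/= big_seq [RHS]big_seq; apply: eq_bigr => l lS.
  rewrite -(@part_step (Ordinal n0N) l)//.
  by apply/eqP => l0; apply: rates; exists l.
transitivity (P (hist N)).
  rewrite histE /prs (_ : [seq n : 'I_N <- enum 'I_N | (n < N)%N] = enum 'I_N)//.
  by apply/all_filterP/allP => n _; exact: ltn_ord.
by rewrite main//; congr (_ * _); apply: eq_bigr => l _; exact: partN.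
Qed.

End histories.
End construction_histories.

(** * Generating functions of the weights of constructed atoms *)

Section construction_means.
Local Open Scope ereal_scope.
Context {R : realType} dPsi (Psi : measurableType dPsi).
Context d (Om : measurableType d) (P : probability Om R).
Variables (N K : nat) (psifix : 'I_K -> Psi) (F : 'I_K -> probability R R).
Variables (nu : {sigma_finite_measure set R -> \bar R}) (G : probability Psi R).
Variables (h : nat -> R -> R) (pmf_h : pmf_family h).
Hypothesis summable_h :
  \sum_(1 <= a <oo) \int[nu]_(t in @Rplus R) (h a t)%:E < +oo.
Variables (rho : 'I_N -> nat -> Om -> nat).
Variables (newpsi : 'I_N -> nat -> nat -> Om -> Psi).
Variable y : 'I_N -> atom_label N K -> Om -> nat.
Hypothesis construction : marginal_construction P psifix F nu G h rho newpsi y.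
Hypothesis F_Rplus : forall k, F k (@Rplus R) = 1.
Variables (c : Psi -> nat) (mc : measurable_fun [set: Psi] c).
Variables (s : 'I_N -> nat -> R) (s01 : forall n b, (0 <= s n b <= 1)%R).

Local Notation label := (atom_label N K).
Local Notation prior_of := (prior (N := N) F nu).
Local Notation kernel_of := (kern (N := N) (K := K) h).
Local Notation inv_rate_of := (inv_rate (N := N) (K := K) nu h).

Lemma inv_rate_ge0 (l : label) : (0 <= inv_rate_of l)%R.
Proof. by case: l => [k|[[m x] j]] //=; rewrite invr_ge0 new_atom_rate_ge0. Qed.

Lemma measurable_step_weight n l : measurable_fun [set: Om] (y n l).
Proof. exact: (measurable_y construction). Qed.

(** By [history_prob] the weights of the atoms are mixtures of products, each atom having
its own mixing variable [t]. *)
Lemma history_mean (S : seq label) (E : set Om)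
    (f : 'I_N * label -> nat -> \bar R) :
  uniq S -> measurable E -> (forall n, drawn_sigma rho newpsi y n E) ->
  (forall l, l \in S -> E `<=` exists_atom rho l) -> nonneg_slots f ->
  \int[P]_(w in E) \prod_(j <- [seq (n, l) | n <- enum 'I_N, l <- S])
     f j (y j.1 j.2 w) =
  P E * \prod_(l <- S) ((inv_rate_of l)%:E * \int[prior_of l]_(t in @Rplus R)
     \prod_n \sum_(a <oo) (kernel_of l n a t)%:E * f (n, l) a).
Proof.
move=> uS mE ES exS f0.
set prs := [seq (n, l) | n <- enum 'I_N, l <- S].
have uprs : uniq prs.
  apply: allpairs_uniq; [exact: enum_uniq|exact: uS|].
  by move=> [n l] [n' l'] _ _ /= [-> ->].
pose slot l n t (g : 'I_N * label -> nat -> \bar R) :=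
  \sum_(a <oo) (kernel_of l n a t)%:E * g (n, l) a.
have slot0 l n t g : Rplus t -> nonneg_slots g -> 0 <= slot l n t g.
  move=> /in_Rplus t0 g0; apply: nneseries_ge0 => a _ _.
  by rewrite mule_ge0 ?g0// lee_fin kern_ge0.
have mslot l n g : nonneg_slots g -> measurable_fun (@Rplus R) (fun t => slot l n t g).
  move=> g0; apply: ge0_emeasurable_sum => [a t /in_Rplus t0 _|a _].
    by rewrite mule_ge0 ?g0// lee_fin kern_ge0.
  apply: emeasurable_funM; last exact: measurable_cst.
  by apply/measurable_EFinP; exact: measurable_kern.
pose Xi l g := (inv_rate_of l)%:E * \int[prior_of l]_(t in @Rplus R) \prod_n slot l n t g.
have Xi0 l g : nonneg_slots g -> 0 <= Xi l g.
  move=> g0; rewrite mule_ge0 ?lee_fin ?inv_rate_ge0//.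
  by apply: integral_ge0 => t tR; apply: prode_ge0 => n _; exact: slot0.
have := @joint_expectation_ext _ Om R P E mE _ prs uprs (fun j => y j.1 j.2)
  (fun j _ => measurable_step_weight j.1 j.2) (cst 1) _ _ (fun g => P E * \prod_(l <- S) Xi l g).
move=> /(_ _ _ _ _ f f0) <-//.
- by apply: eq_integral => w _; rewrite mul1e.
- move=> j /allpairsP[[n0 l0] /= [_ l0S ->]].
  apply: additive_mull => //; last by move=> g g0; apply: prode_ge0 => l _; exact: Xi0.
  apply: (additive_prod (i0 := l0)) => //; last first.
    move=> l g g' lS ll0; rewrite /Xi; congr (_ * _); apply: eq_integral => t _.
    apply: eq_bigr => n _; rewrite /slot fill_neq//.
    by apply: contra ll0 => /eqP[_ ->].
  apply: additive_mull => //.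
  + apply: (@additive_integral _ _ _ _ (prior_of l0) (@Rplus R) (n0, l0)
      (fun t g => \prod_n slot l0 n t g)).
    * exact: measurable_Rplus.
    * by move=> g g0; apply: emeasurable_prod_seq => n _; exact: mslot.
    * by move=> t g tR g0; apply: prode_ge0 => n _; exact: slot0.
    * move=> t tR; apply: (additive_prod (i0 := n0)).
      - exact: index_enum_uniq.
      - exact: mem_index_enum.
      - apply: additive_series => a; rewrite lee_fin kern_ge0//; exact/in_Rplus.
      - by move=> n g g0; exact: slot0.
      - move=> n g g' _ nn0; rewrite /slot fill_neq//.
        by apply: contra nn0 => /eqP[->].
  + move=> g g0; apply: integral_ge0 => t tR; apply: prode_ge0 => n _; exact: slot0.
  + by move=> g _; rewrite lee_fin inv_rate_ge0.
- move=> g a g0 ga; rewrite integral_cst//; last first.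
    by apply: measurableI => //; apply: measurable_fibers => j _; exact: measurable_step_weight.
  rewrite mul1e; etransitivity.
    exact: (history_prob pmf_h summable_h construction F_Rplus uS mE ES exS a).
  congr (_ * _); apply: eq_big_seq => l lS; congr (_ * _).
  apply: eq_integral => t; rewrite inE => tR; rewrite -prodEFin; apply: eq_bigr => n _.
  rewrite /slot ga ?point_mass_series//.
  + by move=> b; rewrite lee_fin kern_ge0//; exact/in_Rplus.
  + by apply/allpairsP; exists (n, l); rewrite mem_enum.
Qed.

Definition label_weight (l : label) (w : Om) : R :=
  (\prod_n s n (c (location psifix newpsi l w)) ^+ y n l w)%R.

Definition label_mass (l : label) (b : nat) : \bar R :=
  match l with
  | inl k => \int[F k]_(t in @Rplus R) (later_pgf h (s ^~ b) 0 t)%:E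
  | inr (m, x, _) => (new_atom_rate nu h m x.+1)^-1%:E *
      \int[nu]_(t in @Rplus R) (seen_pgf h (s ^~ b) m x t)%:E
  end.

(** The steps before the birth of a new atom contribute [h 0 t] each, its birth
contributes its class, and the later steps their generating functions. *)
Lemma kern_pgf (l : label) (b : nat) t : (0 <= t)%R ->
  \prod_n \sum_(a <oo) (kernel_of l n a t)%:E * (s n b ^+ a)%:E =
  match l with
  | inl _ => (later_pgf h (s ^~ b) 0 t)%:E
  | inr (m, x, _) => (seen_pgf h (s ^~ b) m x t)%:E
  end.
Proof.
move=> t0; have hE n : \sum_(a <oo) (h a t)%:E * (s n b ^+ a)%:E = (rpgf h (s n b) t)%:E.
  by rewrite rpgfE.
case: l => [k|[[m x] j]].
  by rewrite later_pgf0 -prodEFin; apply: eq_bigr => n _; rewrite -hE.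
pose g (n : 'I_N) : R := if (n < m)%N then h 0%N t else
  if n == m then (h x.+1 t * s m b ^+ x.+1)%R else rpgf h (s n b) t.
transitivity (\prod_n (g n)%:E).
  apply: eq_bigr => n _; rewrite /g /kern.
  have sb a : (0 <= s n b ^+ a)%R by rewrite exprn_ge0//; have /andP[] := s01 n b.
  case: ifP => _.
    rewrite (nneseries_single (a := 0%N)) ?eqxx ?mul1r ?expr0 ?mule1 ?lee_fin ?h_ge0//.
    by move=> a a0; rewrite (negbTE a0) mul0r mul0e.
  case: eqP => [nm|_]; last exact: hE.
  rewrite (nneseries_single (a := x.+1)) ?eqxx ?mul1r.
  - by rewrite -EFinM nm.
  - by move=> a a0; rewrite (negbTE a0) mul0r mul0e.
  - by rewrite mule_ge0 ?lee_fin ?h_ge0.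
rewrite prodEFin; congr EFin; rewrite (bigID (fun n : 'I_N => (n < m)%N))/=.
rewrite /seen_pgf /unseen_then -mulrA; congr (_ * _)%R.
  rewrite (eq_bigr (fun=> h 0%N t)); last by move=> n nm; rewrite /g nm.
  rewrite -(big_ord_widen N (fun=> h 0%N t) (ltnW (ltn_ord m))).
  by rewrite prodr_const card_ord.
rewrite (bigD1 m)/= ?ltnn// /g ltnn eqxx mulrA; congr (_ * _)%R.
rewrite /later_pgf; apply: eq_big => [n|n].
  by rewrite -leqNgt andbC eq_sym -ltn_neqAle.
by move=> /andP[/negbTE -> /negbTE ->].
Qed.

(** On [E] the location patterns are constant, so the bases are. *)
Lemma event_mean (S : seq label) (E : set Om) (b : label -> nat) :
  uniq S -> measurable E -> (forall n, drawn_sigma rho newpsi y n E) ->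
  (forall l, l \in S -> E `<=` exists_atom rho l) ->
  (forall l w, l \in S -> E w -> c (location psifix newpsi l w) = b l) ->
  \int[P]_(w in E) (\prod_(l <- S) label_weight l w)%:E =
  P E * \prod_(l <- S) label_mass l (b l).
Proof.
move=> uS mE ES exS cb.
pose f (j : 'I_N * label) (a : nat) := (s j.1 (b j.2) ^+ a)%:E.
have f0 : nonneg_slots f.
  by move=> j a; rewrite lee_fin exprn_ge0//; have /andP[] := s01 j.1 (b j.2).
transitivity (\int[P]_(w in E) \prod_(j <- [seq (n, l) | n <- enum 'I_N, l <- S])
     f j (y j.1 j.2 w)).
  apply: eq_integral => w /set_mem wE.
  rewrite big_allpairs big_enum [RHS]exchange_big/= -prodEFin.
  apply: eq_big_seq => l lS; rewrite -prodEFin; apply: eq_bigr => n _.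
  by rewrite /f /= (cb l w lS wE).
rewrite (history_mean uS mE ES exS f0); congr (_ * _).
apply: eq_bigr => l _.
have E1 t : Rplus t -> \prod_n \sum_(a <oo) (kernel_of l n a t)%:E * f (n, l) a =
    match l with
    | inl _ => (later_pgf h (s ^~ (b l)) 0 t)%:E
    | inr (m, x, _) => (seen_pgf h (s ^~ (b l)) m x t)%:E
    end.
  by move=> /in_Rplus t0; rewrite -(kern_pgf l (b l) t0).
rewrite (eq_integral _ _ (fun t (tR : t \in @Rplus R) => E1 t (set_mem tR))).
by case: l {E1} => [k|[[m x] j]]; rewrite /= ?mul1e.
Qed.

End construction_means.

(** * The generating functional of the construction *)

Section construction_functional.
Local Open Scope ereal_scope.
Context {R : realType} dPsi (Psi : measurableType dPsi).
Context d (Om : measurableType d) (P : probability Om R).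
Variables (N K : nat) (psifix : 'I_K -> Psi) (F : 'I_K -> probability R R).
Variables (nu : {sigma_finite_measure set R -> \bar R}) (G : probability Psi R).
Variables (h : nat -> R -> R) (pmf_h : pmf_family h).
Hypothesis summable_h :
  \sum_(1 <= a <oo) \int[nu]_(t in @Rplus R) (h a t)%:E < +oo.
Variables (rho : 'I_N -> nat -> Om -> nat).
Variables (newpsi : 'I_N -> nat -> nat -> Om -> Psi).
Variable y : 'I_N -> atom_label N K -> Om -> nat.
Hypothesis construction : marginal_construction P psifix F nu G h rho newpsi y.
Hypothesis F_Rplus : forall k, F k (@Rplus R) = 1.
Variables (c : Psi -> nat) (mc : measurable_fun [set: Psi] c).
Variables (s : 'I_N -> nat -> R) (s01 : forall n b, (0 <= s n b <= 1)%R).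

Local Notation label := (atom_label N K).
Local Notation mass := (@label_mass R N K F nu h s).
Local Notation weight := (label_weight psifix newpsi y c s).
Local Notation rate m x := (new_atom_rate nu h m x.+1).

Let mass0 (l : label) b : 0 <= mass l b.
Proof.
have s01b n : (0 <= s n b <= 1)%R := s01 n b.
case: l => [k|[[m x] j]] /=.
  apply: integral_ge0 => t /in_Rplus t0; rewrite lee_fin.
  by have /andP[] := later_pgf_unit pmf_h s01b 0 t0.
rewrite mule_ge0 ?lee_fin ?invr_ge0 ?new_atom_rate_ge0//.
by apply: integral_ge0 => t /in_Rplus t0; rewrite lee_fin seen_pgf_ge0.
Qed.

Let mloc (l : label) : measurable_fun [set: Om] (location psifix newpsi l).
Proof.
case: l => [k|[[m x] j]] /=; first exact: measurable_cst.
exact: (measurable_newpsi construction).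
Qed.

Let mweight (l : label) : measurable_fun [set: Om] (weight l).
Proof.
apply: measurable_prod => n _.
apply: (measurable_switch (z := y n l)
  (F := fun a w => (s n (c (location psifix newpsi l w)) ^+ a)%R)).
  exact: (measurable_y construction).
move=> a; apply: (measurableT_comp (f := fun b => (s n b ^+ a)%R)) => //.
exact: measurableT_comp.
Qed.

Let weight_unit (l : label) w : (0 <= weight l w <= 1)%R.
Proof.
apply: prod_in_unit => n; have /andP[u0 u1] := s01 n (c (location psifix newpsi l w)).
by rewrite exprn_ge0// exprn_ile1.
Qed.

Definition first_classes (L : nat) : seq ('I_N * nat) :=
  [seq (m, x) | m <- index_enum 'I_N, x <- iota 0 L].

Definition drawn_triples L (r : 'I_N * nat -> nat) : seq ('I_N * nat * nat) :=
  [seq (mx, j) | mx <- first_classes L, j <- iota 0 (r mx)].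

Definition drawn_labels L (r : 'I_N * nat -> nat) : seq label :=
  [seq inl k | k <- index_enum 'I_K] ++ [seq inr q | q <- drawn_triples L r].

Lemma mem_first_classes L m x : ((m, x) \in first_classes L) = (x < L)%N.
Proof.
apply/allpairsP/idP => [[[m' x'] /= [_ + [_ ->]]]|xL]; first by rewrite mem_iota.
by exists (m, x); rewrite mem_iota mem_index_enum.
Qed.

Lemma uniq_first_classes L : uniq (first_classes L).
Proof.
apply: allpairs_uniq; [exact: index_enum_uniq|exact: iota_uniq|].
by move=> [n l] [n' l'] _ _ /= [-> ->].
Qed.

Lemma mem_drawn_triples L r m x j :
  ((m, x, j) \in drawn_triples L r) = (x < L)%N && (j < r (m, x))%N.
Proof.
apply/allpairsPdep/andP => [[mx [j' [mxL jr E]]]|[xL jr]].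
  by case: E mxL jr => <- <-; rewrite mem_first_classes mem_iota /= => -> ->.
by exists (m, x), j; split; rewrite ?mem_first_classes ?mem_iota.
Qed.

Lemma uniq_drawn_triples L r : uniq (drawn_triples L r).
Proof.
apply: allpairs_uniq_dep; first exact: uniq_first_classes.
  by move=> mx _; exact: iota_uniq.
by move=> [mx j] [mx' j'] _ _ /= [-> ->].
Qed.

Lemma uniq_drawn_labels L r : uniq (drawn_labels L r).
Proof.
rewrite cat_uniq !map_inj_uniq ?index_enum_uniq ?uniq_drawn_triples//; try by move=> ? ? [].
by rewrite andbT; apply/hasPn => _ /mapP[q _ ->]; apply/negP => /mapP[].
Qed.

Lemma mem_drawn_labels_new L r m x j :
  (inr (m, x, j) \in drawn_labels L r) = (x < L)%N && (j < r (m, x))%N.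
Proof.
rewrite mem_cat -(mem_drawn_triples L r m x j); apply/orP/idP => [[]|qin].
- by move=> /mapP[].
- by move=> /mapP[q qin [->]].
- by right; apply/mapP; exists (m, x, j).
Qed.

Lemma mem_drawn_labels_fixed L r k : inl k \in drawn_labels L r.
Proof. by rewrite mem_cat map_f// mem_index_enum. Qed.

Let big_labels L r (g : label -> \bar R) :
  \prod_(l <- drawn_labels L r) g l =
  (\prod_k g (inl k)) * \prod_(q <- drawn_triples L r) g (inr q).
Proof. by rewrite big_cat !big_map. Qed.

Let z (q : 'I_N * nat * nat) := c \o newpsi q.1.1 q.1.2 q.2.

Let mz q : measurable_fun [set: Om] (z q).
Proof. by apply: measurableT_comp => //; exact: (measurable_newpsi construction). Qed.

Let numbers L (r : 'I_N * nat -> nat) : set Om :=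
  \bigcap_(mx in [set` first_classes L]) (rho mx.1 mx.2 @^-1` [set r mx]).

Let mnumbers L r : measurable (numbers L r).
Proof. by apply: measurable_fibers => mx _; exact: (measurable_rho construction). Qed.

Let fixed_mass := \prod_k mass (inl k) (c (psifix k)).

Let new_prob L r (b : 'I_N * nat * nat -> nat) (qs : seq ('I_N * nat * nat)) : uniq qs ->
  P (numbers L r `&` \bigcap_(q in [set` qs]) (z q @^-1` [set b q])) =
  (\prod_(mx <- first_classes L) P (rho mx.1 mx.2 @^-1` [set r mx])) *
  \prod_(q <- qs) G (c @^-1` [set b q]).
Proof.
move=> uqs.
pose I := ('I_N * nat + 'I_N * nat * nat)%type.
pose idx : seq I := [seq inl mx | mx <- first_classes L] ++ [seq inr q | q <- qs].
pose A (i : I) : set Om := match i with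
  | inl mx => rho mx.1 mx.2 @^-1` [set r mx] | inr q => z q @^-1` [set b q] end.
have uidx : uniq idx.
  rewrite cat_uniq !map_inj_uniq ?uniq_first_classes ?uqs//; try by move=> ? ? [].
  by rewrite andbT; apply/hasPn => _ /mapP[q _ ->]; apply/negP => /mapP[].
have := new_atoms_independent construction uidx (A := A) _.
rewrite big_cat !big_map/= => H.
transitivity (P (\bigcap_(i in [set` idx]) A i)).
  congr (P _); apply/seteqP; split => w.
    move=> [H1 H2] i /=; rewrite mem_cat => /orP[] /mapP[q qin ->]; first exact: H1.
    exact: H2.
  move=> Hi; split => q /= qin.
    by apply: (Hi (inl q)); rewrite /= mem_cat map_f.
  by apply: (Hi (inr q)); rewrite /= mem_cat map_f ?orbT.
rewrite H.
  congr (_ * _); apply: eq_bigr => -[[m x] j] _.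
  exact: (new_atom_location construction _ _ _ (measurable_fiber (b (m, x, j)) mc)).
case=> [[m x]|[[m x] j]] _ /=.
  by exists [set r (m, x)] => //; rewrite setTI.
by exists (c @^-1` [set b (m, x, j)]); [exact: measurable_fiber|rewrite setTI].
Qed.

Let numbers_prob L r : P (numbers L r) =
  \prod_(mx <- first_classes L) P (rho mx.1 mx.2 @^-1` [set r mx]).
Proof.
have := @new_prob L r (fun=> 0%N) [::] isT; rewrite big_nil mule1 => <-.
by rewrite set_nil bigcap_set0 setIT.
Qed.

(** The mean contribution of one new atom of class [(m, x)], its location included; the
third index of the label has no influence on it. *)
Definition new_mass (m : 'I_N) (x : nat) : \bar R :=
  \sum_(b <oo) G (c @^-1` [set b]) * mass (inr (m, x, 0%N)) b.

(** The numbers of new atoms are fixed; the location patterns are summed out. *)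
Lemma numbers_mean L r :
  \int[P]_(w in numbers L r) (\prod_(l <- drawn_labels L r) weight l w)%:E =
  P (numbers L r) * (fixed_mass * \prod_(q <- drawn_triples L r) new_mass q.1.1 q.1.2).
Proof.
set qs := drawn_triples L r; have uqs : uniq qs := uniq_drawn_triples L r.
have mV : measurable_fun [set: Om] (fun w => (\prod_(l <- drawn_labels L r) weight l w)%:E).
  by apply/measurable_EFinP; apply: measurable_prod => l _.
have V0 w : 0 <= (\prod_(l <- drawn_labels L r) weight l w)%:E.
  by rewrite lee_fin prodr_ge0// => l _; have /andP[] := weight_unit l w.
pose p (q : 'I_N * nat * nat) b := G (c @^-1` [set b]) * mass (inr q) b.
have p0 q b : 0 <= p q b by rewrite mule_ge0.
pose Psi0 (f : 'I_N * nat * nat -> nat -> \bar R) :=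
  (P (numbers L r) * fixed_mass) * \prod_(q <- qs) \sum_(b <oo) p q b * f q b.
have fixed0 : 0 <= fixed_mass by apply: prode_ge0.
suff E : \int[P]_(w in numbers L r) ((\prod_(l <- drawn_labels L r) weight l w)%:E *
    \prod_(q <- qs) (fun _ _ => 1 : \bar R) q (z q w)) = Psi0 (fun _ _ => 1).
  transitivity (Psi0 (fun _ _ => 1)).
    by rewrite -E; apply: eq_integral => w _; rewrite [X in _ * X]big1// mule1.
  rewrite /Psi0 -muleA; congr (_ * (_ * _)); apply: eq_bigr => -[[m x] j] _.
  by apply: eq_eseriesr => b _; rewrite mule1.
apply: (@joint_expectation_ext _ Om R P _ (mnumbers L r) _ qs uqs z
  (fun q _ => mz q) _ mV V0 Psi0) => //.
  move=> q qin; apply: additive_mull => //.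
  - apply: (additive_prod (i0 := q)) => //.
    + exact: additive_series.
    + by move=> q' f f0; apply: nneseries_ge0 => b _ _; rewrite mule_ge0// f0.
    + by move=> q' f g _ qq'; rewrite fill_neq.
  - move=> f f0; apply: prode_ge0 => q' _; apply: nneseries_ge0 => b _ _.
    by rewrite mule_ge0// f0.
  - by move=> f _; rewrite mule_ge0.
move=> f b f0 fb.
set E := _ `&` _.
pose b' (l : label) := match l with inl k => c (psifix k) | inr q => b q end.
have mE : measurable E by apply: measurableI => //; exact: measurable_fibers.
have drawnE n : drawn_sigma rho newpsi y n E.
  apply: g_sigma_setI; apply: g_sigma_bigcap_seq.
    move=> [m x] _; apply: sub_sigma_algebra; left; left; exists m => //; exists x => //.
    by exists [set r (m, x)] => //; rewrite setTI.
  move=> [[m x] j] _; apply: sub_sigma_algebra; left; right.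
  exists m => //; exists x => //; exists j => //.
  by exists (c @^-1` [set b (m, x, j)]); [exact: measurable_fiber|rewrite setTI].
have in_labels l : l \in drawn_labels L r -> match l with inl _ => true | inr q => q \in qs end.
  rewrite mem_cat => /orP[] /mapP[q qin ->] //.
rewrite (event_mean pmf_h summable_h construction F_Rplus s01 (uniq_drawn_labels L r) mE drawnE
  (b := b')); last 2 first.
- move=> [k|[[m x] j]] lin w [rw _] //=.
  have := in_labels _ lin; rewrite mem_drawn_triples => /andP[xL jr].
  by have := rw (m, x); rewrite /= mem_first_classes xL => /(_ isT) ->.
- move=> [k|[[m x] j]] w lin [_ zw] //=.
  exact: (zw _ (in_labels _ lin)).
rewrite new_prob// -numbers_prob big_labels /Psi0 -!muleA; congr (_ * _).
rewrite muleCA; congr (_ * _); rewrite -big_split/=; apply: eq_big_seq => q qin.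
by rewrite fb// point_mass_series.
Qed.

Let fixed0 : 0 <= fixed_mass. Proof. by apply: prode_ge0. Qed.

Let sum_G : \sum_(b <oo) G (c @^-1` [set b]) = 1.
Proof.
transitivity (\int[G]_t (cst 1) (c t)); last first.
  by rewrite (integral_cst G measurableT) mul1e; exact: probability_setT.
rewrite (integral_nat_comp G measurableT mc (g := cst 1))//.
by apply: eq_eseriesr => b _; rewrite setTI mule1.
Qed.

Let defect (m : 'I_N) x : \bar R := \sum_(b <oo) G (c @^-1` [set b]) *
  \int[nu]_(t in @Rplus R) (seen_defect h (s ^~ b) m x t)%:E.

Let s01b b n : (0 <= s n b <= 1)%R := s01 n b.

Let int_defect_ge0 (m : 'I_N) x b :
  0 <= \int[nu]_(t in @Rplus R) (seen_defect h (s ^~ b) m x t)%:E.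
Proof. by apply: integral_ge0 => t /in_Rplus t0; rewrite lee_fin seen_defect_ge0. Qed.

Let int_seen_ge0 (m : 'I_N) x b :
  0 <= \int[nu]_(t in @Rplus R) (seen_pgf h (s ^~ b) m x t)%:E.
Proof. by apply: integral_ge0 => t /in_Rplus t0; rewrite lee_fin seen_pgf_ge0. Qed.

Let rate_split (m : 'I_N) x b :
  \int[nu]_(t in @Rplus R) (seen_defect h (s ^~ b) m x t)%:E +
  \int[nu]_(t in @Rplus R) (seen_pgf h (s ^~ b) m x t)%:E = (rate m x)%:E.
Proof.
rewrite (new_atom_rateE pmf_h summable_h) -ge0_integralD.
- by apply: eq_integral => t _; rewrite -EFinD seen_split.
- exact: measurable_Rplus.
- by move=> t /in_Rplus t0; rewrite lee_fin seen_defect_ge0.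
- apply/measurable_EFinP; exact: measurable_seen_defect.
- by move=> t /in_Rplus t0; rewrite lee_fin seen_pgf_ge0.
- apply/measurable_EFinP; exact: measurable_seen_pgf.
Qed.

Let rate_ge0 (m : 'I_N) x : (0 <= rate m x)%R := new_atom_rate_ge0 nu pmf_h m x.

Let new_mass_ge0 (m : 'I_N) x : 0 <= new_mass m x.
Proof. by apply: nneseries_ge0 => b _ _; rewrite mule_ge0. Qed.

Let rate_new_mass (m : 'I_N) x : (rate m x)%:E * new_mass m x = \sum_(b <oo) G (c @^-1` [set b]) *
  \int[nu]_(t in @Rplus R) (seen_pgf h (s ^~ b) m x t)%:E.
Proof.
rewrite /new_mass -nneseriesZle ?lee_fin//; last by move=> b; rewrite mule_ge0.
apply: eq_eseriesr => b _ /=; rewrite muleCA; congr (_ * _).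
rewrite muleA -EFinM; have [r0|r0] := eqVneq (rate m x) 0%R; last first.
  by rewrite divff// mul1e.
rewrite r0 mul0r mul0e; apply/esym/eqP; rewrite eq_le int_seen_ge0 andbT.
apply: (@le_trans _ _ 0%:E) => //.
by have := rate_split m x b; rewrite r0 => <-; rewrite leeDr.
Qed.

Let defect_new_mass (m : 'I_N) x : defect m x + (rate m x)%:E * new_mass m x = (rate m x)%:E.
Proof.
rewrite rate_new_mass /defect -nneseriesD; last 2 first.
- by move=> b _ _; rewrite mule_ge0.
- by move=> b _ _; rewrite mule_ge0.
under eq_eseriesr do rewrite -ge0_muleDr// rate_split.
by rewrite nneseriesZre ?lee_fin// sum_G mul1e.
Qed.

Let new_mass_fin (m : 'I_N) x : new_mass m x \is a fin_num.
Proof.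
rewrite ge0_fin_numE//; apply: (@le_lt_trans _ _ 1); last exact: ltry.
rewrite -sum_G; apply: lee_nneseries => [b _ _|b _].
  by apply: mule_ge0 => //; exact: (mass0 (inr (m, x, 0%N))).
rewrite -[leRHS]mule1 lee_wpmul2l//=.
have [r0|r0] := eqVneq (rate m x) 0%R; first by rewrite /= r0 invr0 mul0e lee_fin ler01.
have rp : (0 < rate m x)%R by rewrite lt_def r0 rate_ge0.
have rE : ((rate m x)^-1)%:E * (rate m x)%:E = 1 by rewrite -EFinM mulVf.
rewrite -[leRHS]rE lee_wpmul2l ?lee_fin ?invr_ge0//.
by rewrite -(rate_split m x b) leeDr.
Qed.

Let kappa (m : 'I_N) x : R := fine (new_mass m x).

Let kappaE (m : 'I_N) x : (kappa m x)%:E = new_mass m x. Proof. by rewrite /kappa fineK. Qed.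

Let kappa_ge0 (m : 'I_N) x : (0 <= kappa m x)%R. Proof. exact: fine_ge0. Qed.

(* The exponent of the Poisson generating function of the class [(m, x)]; this also
holds for the rate [0]. *)
Let defectE (m : 'I_N) x : defect m x = (rate m x * (1 - kappa m x))%:E.
Proof.
have fp : (rate m x)%:E * new_mass m x \is a fin_num by rewrite fin_numM.
rewrite -(addeK (defect m x) fp) defect_new_mass -kappaE -EFinM -EFinB.
by rewrite mulrBr mulr1.
Qed.

(** The random set of labels contains all the existing atoms of each class considered, so
that given the numbers of new atoms it is a finite product without truncation. *)
Definition drawn_weight L w : R :=
  (\prod_(l <- drawn_labels L (fun mx => rho mx.1 mx.2 w)) weight l w)%R.

Let drawn_weightE L w : drawn_weight L w = ((\prod_k weight (inl k) w) *
  \prod_(mx <- first_classes L)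
     \prod_(j <- iota 0 (rho mx.1 mx.2 w)) weight (inr (mx, j)) w)%R.
Proof.
rewrite /drawn_weight big_cat !big_map; congr (_ * _)%R.
by rewrite big_allpairs_dep.
Qed.

Lemma measurable_drawn_weight L : measurable_fun [set: Om] (drawn_weight L).
Proof.
rewrite (funext (drawn_weightE L)).
apply: measurable_funM; first by apply: measurable_prod => k _.
apply: measurable_prod => mx _.
apply: (measurable_switch (z := rho mx.1 mx.2)
  (F := fun r w => \prod_(j <- iota 0 r) weight (inr (mx, j)) w)%R).
  exact: (measurable_rho construction).
by move=> r; apply: measurable_prod => j _.
Qed.

Lemma drawn_weight_unit L w : (0 <= drawn_weight L w <= 1)%R.
Proof. by apply: prod_in_unit => l. Qed.

(** Given the numbers of new atoms, each class contributes a power of its mean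
contribution [kappa]; the Poisson numbers are then summed out. *)
Lemma mean_drawn_weight L :
  \int[P]_w (drawn_weight L w)%:E =
  fixed_mass * (expR (- \sum_(mx <- first_classes L)
     rate mx.1 mx.2 * (1 - kappa mx.1 mx.2)))%:E.
Proof.
have mV : measurable_fun [set: Om] (fun w => (drawn_weight L w)%:E).
  by apply/measurable_EFinP; exact: measurable_drawn_weight.
have V0 w : 0 <= (drawn_weight L w)%:E.
  by rewrite lee_fin; have /andP[] := drawn_weight_unit L w.
pose z1 (mx : 'I_N * nat) := rho mx.1 mx.2.
have mz1 mx : measurable_fun [set: Om] (z1 mx) := measurable_rho construction mx.1 mx.2.
have uq := uniq_first_classes L.
pose p (mx : 'I_N * nat) r := P (z1 mx @^-1` [set r]) * (kappa mx.1 mx.2 ^+ r)%:E.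
have p0 mx r : 0 <= p mx r by rewrite mule_ge0// lee_fin exprn_ge0.
pose Psi0 (f : 'I_N * nat -> nat -> \bar R) :=
  fixed_mass * \prod_(mx <- first_classes L) \sum_(r <oo) p mx r * f mx r.
suff E : \int[P]_w ((drawn_weight L w)%:E *
    \prod_(mx <- first_classes L) (fun _ _ => 1 : \bar R) mx (z1 mx w)) =
    Psi0 (fun _ _ => 1).
  transitivity (Psi0 (fun _ _ => 1)).
    by rewrite -E; apply: eq_integral => w _; rewrite [X in _ * X]big1// mule1.
  rewrite /Psi0; congr (_ * _); rewrite -sumrN expR_sum -prodEFin.
  apply: eq_bigr => -[m x] _; rewrite -poisson_pgfE//.
  apply: eq_eseriesr => r _; rewrite mule1 /p /z1 /=.
  by rewrite (new_atom_number construction).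
apply: (@joint_expectation_ext _ Om R P setT measurableT _ (first_classes L) uq z1
  (fun mx _ => mz1 mx) _ mV V0 Psi0) => //.
  move=> mx mxin; apply: additive_mull => //.
  - apply: (additive_prod (i0 := mx)) => //.
    + exact: additive_series.
    + by move=> mx' f f0; apply: nneseries_ge0 => b _ _; rewrite mule_ge0// f0.
    + by move=> mx' f g _ mm'; rewrite fill_neq.
  - move=> f f0; apply: prode_ge0 => mx' _; apply: nneseries_ge0 => b _ _.
    by rewrite mule_ge0// f0.
move=> f r f0 fr; rewrite setTI.
transitivity (\int[P]_(w in numbers L r) (\prod_(l <- drawn_labels L r) weight l w)%:E).
  apply: eq_integral => w /set_mem rw; congr EFin.
  rewrite /drawn_weight (_ : drawn_labels L _ = drawn_labels L r)//.
  congr (_ ++ map _ _); rewrite /drawn_triples; congr flatten.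
  by apply/eq_in_map => mx mxin; have <- : rho mx.1 mx.2 w = r mx := rw mx mxin.
rewrite numbers_mean numbers_prob /Psi0 muleCA; congr (_ * _).
rewrite [X in _ * X]big_allpairs_dep -big_split/=; apply: eq_big_seq => mx mxin.
rewrite fr// point_mass_series// /p; congr (_ * _).
under eq_bigr do rewrite -kappaE.
by rewrite prodEFin big_const_seq count_predT size_iota -Monoid.iteropE.
Qed.

Let defect_ge0 (m : 'I_N) x : 0 <= defect m x.
Proof. by apply: nneseries_ge0 => b _ _; rewrite mule_ge0. Qed.

(* Every ordinary atom that is seen at all is first seen at exactly one step and with one
weight. *)
Let total_defect : \sum_(m < N) \sum_(x <oo) defect m x = total_exponent nu G h c s.
Proof.
rewrite /total_exponent.
under [RHS]eq_eseriesr => b _.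
  rewrite (integral_defect pmf_h (s01b b)).
  rewrite ge0_sume_distrr; last first.
    by move=> m _; apply: nneseries_ge0 => x _ _.
  over.
rewrite nneseries_sum; last first.
  by move=> m b _; rewrite mule_ge0//; apply: nneseries_ge0 => x _ _.
apply: eq_bigr => m _; rewrite /defect nneseries_interchange; last first.
  by move=> x b; rewrite mule_ge0.
by apply: eq_eseriesr => b _; rewrite nneseriesZle.
Qed.

Lemma construction_limit : \int[P]_w (drawn_weight L w)%:E @[L --> \oo] -->
  limit_functional psifix F nu G h c s.
Proof.
under eq_fun do rewrite mean_drawn_weight.
have fixed_fin : fixed_mass \is a fin_num.
  apply: prod_fin_num => k; rewrite ge0_fin_numE//.
  apply: (@le_lt_trans _ _ (\int[F k]_(t in @Rplus R) (cst 1) t)).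
    apply: ge0_le_integral => //.
    - exact: measurable_Rplus.
    - move=> t /in_Rplus t0; rewrite lee_fin.
      by have /andP[] := later_pgf_unit pmf_h (s01b (c (psifix k))) 0 t0.
    - by apply/measurable_EFinP; apply: measurable_later_pgf => // n; exact: s01b.
    - move=> t /in_Rplus t0; rewrite lee_fin.
      by have /andP[] := later_pgf_unit pmf_h (s01b (c (psifix k))) 0 t0.
  rewrite (integral_cst (F k) measurable_Rplus) mul1e.
  exact: le_lt_trans (probability_le1 (F k) measurable_Rplus) (ltry _).
apply: cvgeZl => //; apply: cvg_EFin; first exact: nearW.
suff : expR (- \sum_(mx <- first_classes L) rate mx.1 mx.2 * (1 - kappa mx.1 mx.2))%R
    @[L --> \oo] --> expR (- fine (total_exponent nu G h c s)) by [].
apply: continuous_cvg; first exact: continuous_expR.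
apply: cvgN.
have total_fin := total_exponent_fin G pmf_h summable_h mc s01.
have : \sum_(0 <= x < L) \sum_(m < N) defect m x @[L --> \oo] -->
    total_exponent nu G h c s.
  rewrite -total_defect -nneseries_sum; last by move=> m x _.
  by apply: is_cvg_nneseries => x _ _; apply: sume_ge0.
rewrite -(fineK (x := total_exponent nu G h c s)); last first.
  rewrite ge0_fin_numE//; apply: nneseries_ge0 => b _ _; rewrite mule_ge0//.
  apply: integral_ge0 => t /in_Rplus t0; rewrite lee_fin subr_ge0.
  by have /andP[] := later_pgf_unit pmf_h (s01b b) 0 t0.
move=> /fine_cvg; rewrite (_ : _ \o _ = fun L => (\sum_(mx <- first_classes L)
  rate mx.1 mx.2 * (1 - kappa mx.1 mx.2))%R)//.
apply/funext => L /=; rewrite big_allpairs exchange_big/= /index_iota subn0.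
rewrite -sum_fine; last by move=> x _; rewrite sum_fin_num; apply/allP => e /mapP[m _ ->]; rewrite defectE.
apply: eq_bigr => x _; rewrite -sum_fine; last by move=> m _; rewrite defectE.
by apply: eq_bigr => m _; rewrite defectE.
Qed.

End construction_functional.

(** * Equality of the two laws *)

Theorem theorem6p1 (R : realType)
  (dPsi : measure_display) (Psi : measurableType dPsi)
  (singletons : forall t : Psi, measurable [set t])
  (d : measure_display) (Om : measurableType d) (P : probability Om R)
  (K : nat) (psifix : 'I_K -> Psi)
  (F : 'I_K -> probability R R)
  (nu : {sigma_finite_measure set R -> \bar R})
  (nu_Rplus : nu (~` @Rplus R) = 0%E) (nu_oo : nu (@Rplus R) = +oo%E)
  (G : probability Psi R) (diffuseG : diffuse G)
  (theta : crm_atom K -> Om -> {nonneg R}) (psi : crm_atom K -> Om -> Psi)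
  (atoms : crm_atoms P psifix F nu G theta psi)
  (Theta : Om -> {measure set Psi -> \bar R})
  (ThetaE : forall w, Theta w = atomic (theta ^~ w) (psi ^~ w))
  (crm : completely_random P Theta)
  (h : nat -> R -> R) (pmf_h : pmf_family h)
  (N : nat) (x : 'I_N -> crm_atom K -> Om -> nat)
  (weights : observation_weights P theta psi h x)
  (X : 'I_N -> Om -> {measure set Psi -> \bar R})
  (XE : forall n w, X n w = atomic (fun l => (x n l w)%:R%:nng) (psi ^~ w))
  (summable_h :
    (\sum_(1 <= a <oo) \int[nu]_(t in @Rplus R) (h a t)%:E < +oo)%E)
  (d' : measure_display) (Om' : measurableType d') (P' : probability Om' R)
  (rho : 'I_N -> nat -> Om' -> nat)
  (newpsi : 'I_N -> nat -> nat -> Om' -> Psi)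
  (y : 'I_N -> atom_label N K -> Om' -> nat)
  (construction :
    marginal_construction P' psifix F nu G h rho newpsi y) :
  same_law P X P' (constructed R psifix newpsi y).
Proof.
have F_Rplus k : (F k (@Rplus R) = 1)%E.
  rewrite -(fixed_weight_law atoms k measurable_Rplus) -(@probability_setT _ _ _ P).
  congr (P _); apply/seteqP; split => // w _ /=; exact/in_Rplus.
have constructedE n w : constructed R psifix newpsi y n w =
  atomic (fun l => (y n l w)%:R%:nng) (location psifix newpsi ^~ w) by [].
pose box L : seq (atom_label N K) := drawn_labels K L (fun=> L).
have ubox L : uniq (box L) by exact: uniq_drawn_labels.
have mem_box L m z j : (inr (m, z, j) \in box L) = (z < L)%N && (j < L)%N.
  exact: mem_drawn_labels_new.
have sub_box L L' : (L <= L')%N -> {subset box L <= box L'}.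
  move=> LL' [k _|[[m z] j]]; first exact: mem_drawn_labels_fixed.
  by rewrite !mem_box => /andP[zL jL]; rewrite !(leq_trans _ LL').
have cover_box l : exists L, l \in box L.
  case: l => [k|[[m z] j]]; first by exists 0%N; exact: mem_drawn_labels_fixed.
  by exists (maxn z j).+1; rewrite mem_box !ltnS leq_maxl leq_maxr.
apply: same_law_pgf.
- move=> n A mA; under eq_fun do rewrite XE.
  apply: (measurable_atomic (@uniq_first_atoms K) (@sub_first_atoms K) (@mem_first_atoms K)).
  + by case: weights.
  + exact: (measurable_psi atoms).
  + exact: mA.
- move=> n A mA; apply: (measurable_atomic ubox sub_box cover_box).
  + exact: (measurable_y construction).
  + case=> [k|[[m z] j]] /=; first exact: measurable_cst.
    exact: (measurable_newpsi construction).
  + exact: mA.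
- move=> n w A mA; rewrite XE.
  by apply: (atomic_counting_value (@uniq_first_atoms K) (@sub_first_atoms K)) => l _;
    exact: mem_first_atoms.
- move=> n w A mA; rewrite constructedE.
  by apply: (atomic_counting_value ubox sub_box) => l _; exact: cover_box.
move=> r i A u mA u01.
have u01' j : 0 <= u j <= 1 by have /andP[/ltW -> ->] := u01 j.
pose c := pattern_code r A; pose s : 'I_N -> nat -> R := pattern_base r i u.
have mc : measurable_fun [set: Psi] c by exact: measurable_pattern_code.
have s01 n b : 0 <= s n b <= 1.
  by have /andP[/ltW -> ->] := @pattern_base_itv R _ r i u n b u01.
have model := model_limit atoms pmf_h weights summable_h mc s01.
have constr := construction_limit pmf_h summable_h construction F_Rplus mc s01.
have model' : (\int[P]_w (\prod_(l <- first_atoms K L) atom_weight psi x c s l w)%:E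
    @[L --> \oo] --> \int[P]_w \prod_(j <- iota 0 r)
      (pgf (u j) (count_code (X (i j) w (A j))))%:E)%E.
  apply: bounded_cvg_integral => [L|L w|w].
  - by apply/measurable_EFinP; exact: (measurable_first_weights atoms weights mc s L).
  - by rewrite !lee_fin (first_weights_unit psi x c s01).
  - have := @atomic_joint_pgf_cvg R _ _ Psi (@first_atoms K) 'I_N (fun n l => x n l w)
      (psi ^~ w) (iota 0 r) i A u (@uniq_first_atoms K) (@sub_first_atoms K)
      (fun _ l _ => mem_first_atoms l) u01'.
    under eq_fun => L do under eq_bigr => l _ do
      rewrite (@pattern_base_code R Psi _ r i A u (fun n => x n l w) (psi l w)).
    have -> : (\prod_(j <- iota 0 r) (pgf (u j) (count_code (X (i j) w (A j))))%:E =
        \prod_(j <- iota 0 r) (pgf (u j) (count_code (atomic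
          (fun l => (x (i j) l w)%:R%:nng%R : {nonneg R}) (psi ^~ w) (A j))))%:E)%E.
      by apply: eq_bigr => j _; rewrite XE.
    exact.
have constr' : (\int[P']_w (drawn_weight psifix rho newpsi y c s L w)%:E
    @[L --> \oo] --> \int[P']_w \prod_(j <- iota 0 r)
      (pgf (u j) (count_code (constructed R psifix newpsi y (i j) w (A j))))%:E)%E.
  apply: bounded_cvg_integral => [L|L w|w].
  - by apply/measurable_EFinP; exact: (measurable_drawn_weight construction mc s L).
  - by rewrite !lee_fin (drawn_weight_unit psifix rho newpsi y c s01).
  - pose S L := drawn_labels K L (fun mz : 'I_N * nat => rho mz.1 mz.2 w).
    have uS L : uniq (S L) by exact: uniq_drawn_labels.
    have subS L L' : (L <= L')%N -> {subset S L <= S L'}.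
      move=> LL' [k _|[[m z] j]]; first exact: mem_drawn_labels_fixed.
      by rewrite !mem_drawn_labels_new => /andP[zL ->]; rewrite (leq_trans zL LL').
    have covS n l : y n l w != 0%N -> exists L, l \in S L.
      case: l => [k _|[[m z] j] yl]; first by exists 0%N; exact: mem_drawn_labels_fixed.
      exists z.+1; rewrite mem_drawn_labels_new ltnSn /=.
      have [//|nex] := pselect (exists_atom rho (inr (m, z, j) : atom_label N K) w).
      by move: yl; rewrite (no_weight construction n nex) eqxx.
    have := @atomic_joint_pgf_cvg R _ _ Psi S 'I_N (fun n l => y n l w)
      (location psifix newpsi ^~ w) (iota 0 r) i A u uS subS covS u01'.
    under eq_fun => L do under eq_bigr => l _ do
      rewrite (@pattern_base_code R Psi _ r i A u (fun n => y n l w)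
        (location psifix newpsi l w)).
    exact.
rewrite -(cvg_lim _ model')// -(cvg_lim _ constr')//.
by rewrite (cvg_lim _ model)// (cvg_lim _ constr).
Qed.
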